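(* Let $\alpha\ge 3$, let $N\ge 1$, let $\omega_1,\dots,\omega_N>0$ be rationally independent, and let $\bm p\in\mathcal C^4(\mathbb T^N)$. For $\bar\Theta=(\bar\theta_1,\dots,\bar\theta_N)\in\mathbb T^N$ let $$p_{\bar\Theta}(t)=\bm p(\overline{\theta_1+t\omega_1},\dots,\overline{\theta_N+t\omega_N}),\qquad t\in\mathbb R.$$ There is a constant $v_*<0$, depending only upon $\alpha$, $\omega=(\omega_1,\dots,\omega_N)$ and $\|\bm p\|_{\mathcal C^4(\mathbb T^N)}$, such that for every $\bar\Theta\in\mathbb T^N$ the successor map $\psi=\psi_{\bar\Theta}$ of the equation $$\ddot x+|x|^{\alpha-1}x=p_{\bar\Theta}(t)$$ (defined in the context) is well defined on $(-\infty,v_* )\times\mathbb R$, and such that the following holds. For $\bar\Theta\in\mathbb T^N$ let $\mathcal E_{\bar\Theta}\subset\mathbb R^2$ be the set of all $(v_0,t_0)\in\mathbb R^2$ such that (a) $v_0<v_*$, (b) the forward iterates $(v_n,t_n)=\psi_{\bar\Theta}^n(v_0,t_0)$ are defined for all $n\in\mathbb N$, where $\psi_{\bar\Theta}$ is regarded as a map with domain $(-\infty,v_* )\times\mathbb R$, and (c) $\lim_{n\to\infty}v_n=-\infty$. Then, for almost all $\bar\Theta\in\mathbb T^N$ (with respect to Haar measure), the set $\mathcal E_{\bar\Theta}$ has two-dimensional Lebesgue measure zero.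
   Context: $\mathbb T=\mathbb R/\mathbb Z$; for $\theta\in\mathbb R$, $\bar\theta=\theta+\mathbb Z$ is its class in $\mathbb T$. $\mathcal C^k(\mathbb T^N)$ is the space of functions $\bm p\in \mathcal C^k(\mathbb R^N)$ that are $1$-periodic in each argument. ''Rationally independent'' means linearly independent over $\mathbb Q$. For a bounded continuous forcing $p$, solutions of $\ddot x+|x|^{\alpha-1}x=p(t)$ are unique and exist for all time. For $(v_0,t_0)\in\mathbb R^2$ let $x(t;v_0,t_0)$ be the solution with $x(t_0)=0$, $\dot x(t_0)=v_0$. The successor map is $\psi:(v_0,t_0)\mapsto(v_1,t_1)$, where $$t_1=\inf\{s\in(t_0,\infty):\ x(s;v_0,t_0)=0,\ \dot x(s;v_0,t_0)<0\},\qquad v_1=\dot x(t_1;v_0,t_0).$$ ''Well defined on $(-\infty,v_* )\times\mathbb R$'' means that for every $(v_0,t_0)$ in this set the set over which the infimum is taken is nonempty and the infimum is attained (so $t_1>t_0$ is a zero of the solution with $v_1<0$, namely the next zero with negative derivative). *)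

(* Defs.v *)
From HB Require Import structures.
From mathcomp Require Import all_boot all_order all_algebra.
From mathcomp Require Import all_classical all_reals all_analysis.

Set Implicit Arguments.
Unset Strict Implicit.
Unset Printing Implicit Defensive.

Import Order.TTheory GRing.Theory Num.Theory.
Import numFieldNormedType.Exports.

Local Open Scope ring_scope.
Local Open Scope classical_set_scope.

Section smooth_functions_on_torus.
Context {R : realType} {N : nat}.
Implicit Types (f : 'rV[R]_N -> R) (omega : 'rV[R]_N).

Definition rationally_independent omega :=
  forall q : 'I_N -> rat,
    \sum_(i < N) ratr (q i) * omega 0 i = 0 -> forall i, q i = 0.

Definition periodic1 f := forall x i, f (x + delta_mx 0 i) = f x.

Definition partial (i : 'I_N) f : 'rV[R]_N -> R :=
  fun x => 'D_(delta_mx 0 i) f x.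

Fixpoint Ck (k : nat) f : Prop :=
  match k with
  | 0 => continuous f
  | k'.+1 => continuous f /\
      forall i, (forall x, derivable f x (delta_mx 0 i)) /\ Ck k' (partial i f)
  end.

Definition Ck_torus (k : nat) f := Ck k f /\ periodic1 f.

(* The maximum of the sup norms of all partial derivatives of order at most k;
   a word s over 'I_N lists the variables of differentiation. *)
Definition Ck_norm (k : nat) f : R :=
  sup [set y | exists (s : seq 'I_N) (x : 'rV[R]_N),
         (size s <= k)%N /\ y = `|foldr partial f s x|].

(* A point of the torus is given by a representative Theta in R^N; for a
   1-periodic p the forcing depends only on the class of Theta modulo Z^N. *)
Definition forcing (p : 'rV[R]_N -> R) omega (Theta : 'rV[R]_N) : R -> R :=
  fun t => p (Theta + t *: omega).

End smooth_functions_on_torus.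

Section successor_map.
Context {R : realType}.
Implicit Types (alpha : R) (f x : R -> R).

Definition duffing_solution alpha f x :=
  forall t, [/\ derivable x t 1, derivable x^`() t 1 &
    x^`(2)%classic t + `|x t| `^ (alpha - 1) * x t = f t].

(* z = (v0, t0); for bounded continuous f the initial value problem has exactly
   one global solution, so the default value of xget is never used. *)
Definition duffing_flow alpha f (z : R * R) : R -> R :=
  xget (cst 0)
    [set x | [/\ duffing_solution alpha f x, x z.2 = 0 & x^`() z.2 = z.1]].

Definition descending_zeros alpha f (z : R * R) : set R :=
  [set s | [/\ z.2 < s, duffing_flow alpha f z s = 0 &
               (duffing_flow alpha f z)^`() s < 0]].

Definition successor alpha f (z : R * R) : R * R :=
  let t1 := inf (descending_zeros alpha f z) in
  ((duffing_flow alpha f z)^`() t1, t1).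

Definition successor_well_defined alpha f (D : set (R * R)) :=
  forall z, D z -> descending_zeros alpha f z !=set0 /\
    descending_zeros alpha f z (inf (descending_zeros alpha f z)).

Definition left_of (v : R) : set (R * R) := [set z | z.1 < v].

(* When the successor map is well defined on D, the forward iterates of z under
   the map with domain D all exist iff every one of them lies in D. *)
Definition iterates_defined alpha f (D : set (R * R)) (z : R * R) :=
  forall n, D (iter n (successor alpha f) z).

Definition escaping_set alpha f (vstar : R) : set (R * R) :=
  [set z | [/\ z.1 < vstar, iterates_defined alpha f (left_of vstar) z &
     (iter n (successor alpha f) z).1 @[n --> \oo] --> -oo]].

End successor_map.

Section haar.
Context {R : realType}.

Local Notation T := (measurableTypeR R).

Definition cons_pair (n : nat) (u : T * n.-tuple T) : n.+1.-tuple T :=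
  [tuple of u.1 :: u.2].

Lemma measurable_cons_pair n : measurable_fun setT (@cons_pair n).
Proof. exact: measurable_cons measurable_fst measurable_snd. Qed.

HB.instance Definition _ n :=
  isMeasurableFun.Build _ _ _ _ (@cons_pair n) (@measurable_cons_pair n).

(* The N-fold product of the uniform probability on [0, 1]; its image under the
   projection R^N -> R^N / Z^N is the normalized Haar measure of the torus. *)
Fixpoint haar_torus (N : nat) : probability (N.-tuple T) R :=
  match N with
  | 0 => dirac [tuple]
  | n.+1 => distribution (uniform_prob (@ltr01 R) \x haar_torus n)%E (@cons_pair n)
  end.

Definition row_of_tuple (N : nat) (theta : N.-tuple T) : 'rV[R]_N :=
  \row_(i < N) tnth theta i.

Definition lebesgue2 : set (T * T) -> \bar R :=
  (@lebesgue_measure R \x @lebesgue_measure R)%E.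

End haar.

(* Main.v *)
Require Import Defs.
From HB Require Import structures.
From mathcomp Require Import all_boot all_order all_algebra.
From mathcomp Require Import all_classical all_reals all_analysis.
From mathcomp Require Import measurable_realfun ring lra.
Import Order.TTheory GRing.Theory Num.Theory.
Import numFieldNormedType.Exports.
Local Open Scope classical_set_scope.
Local Open Scope ring_scope.

Set Implicit Arguments.
Unset Strict Implicit.
Unset Printing Implicit Defensive.

(** Escaping orbits can be seen in the flow of the equation instead of the successor
    map. Adding the phase as a variable makes the equation
    autonomous: its time-1 map on the product of the torus and the plane,
    [torus_step], rotates the phase by omega and moves the state (x, v) along the
    solution. It preserves the product of Haar measure with area: rotations preserve
    the former, and the flow for each phase is Hamiltonian. The last fact is obtained
    without differentiating the flow: symplectic Euler steps are compositions of
    shears and converge uniformly to the flow when the fields are bounded and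
    Lipschitz ([flow_preserving]); the energy bound [dsol_energy] allows the equation
    to be replaced by such a system on bounded sets ([dflow_preserving]).

    The energy of a solution grows slowly, because the effect of the forcing averages
    out over a turn; adding correction terms to the energy makes this visible. A state
    from which a fixed box is reached after n steps satisfies |x| <= C (1 + n) ^ a and
    |v| <= C (1 + n) ^ b with a + b < 1 ([growth]). Consider the states in a box that
    never come back to it. The preimages of this set W under the time-1 map are
    disjoint and have equal measure, while the first m of them lie over a rectangle of
    area o(m); so W is null ([wandering_null]). A trajectory that leaves all boxes
    visits some box a last time, hence the states on such trajectories form a null set
    ([escaping_states_null]), and by Fubini they form, for almost every phase, a null
    set of the plane at time 0 ([almost_all_phases]).

    For large initial velocity the solution turns around the origin with energy bounded
    below, which gives the next descending zero within a bounded time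
    ([successor_map_well_defined]); between the zeros of an escaping orbit the energy
    cannot become small, so that the solution leaves every box
    ([escaping_leaves_boxes]). It remains to pass from states at time 0 to initial
    conditions (v0, t0) on the section x = 0 of the space (t, x, v). By Fubini almost
    every section x = x1 of the set of escaping states is null; between x = x1 and
    x = 0 the position serves as independent variable, and the resulting flow in the
    time and the kinetic energy preserves area by [flow_preserving] again
    ([escaping_initial_null]). *)

(** * Calculus in one real variable *)

Section real_derivatives.
Context {R : realType}.
Implicit Types (f g : R -> R) (t l m : R).

(** The rules below produce derivatives that are rarely in the wanted form; the
    two forms are compared afterwards by this lemma. *)
Lemma der_eq f t l m : is_derive t 1 f l -> l = m -> is_derive t 1 f m.
Proof. by move=> ? <-. Qed.

Lemma der_cst (c t : R) : is_derive t 1 (fun _ : R => c) 0.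
Proof. exact: is_derive_cst. Qed.

Lemma der_id t : is_derive t 1 (fun s : R => s) 1.
Proof. exact: is_derive_id. Qed.

Lemma derD f g t l m : is_derive t 1 f l -> is_derive t 1 g m ->
  is_derive t 1 (fun s => f s + g s) (l + m).
Proof. by move=> ? ?; exact: is_deriveD. Qed.

Lemma derN f t l : is_derive t 1 f l -> is_derive t 1 (fun s => - f s) (- l).
Proof. by move=> ?; exact: is_deriveN. Qed.

Lemma derB f g t l m : is_derive t 1 f l -> is_derive t 1 g m ->
  is_derive t 1 (fun s => f s - g s) (l - m).
Proof. by move=> ? ?; exact: is_deriveB. Qed.

Lemma derM f g t l m : is_derive t 1 f l -> is_derive t 1 g m ->
  is_derive t 1 (fun s => f s * g s) (l * g t + f t * m).
Proof.
move=> df dg; have H := is_deriveM df dg.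
have E : f * g = (fun s => f s * g s) by [].
by rewrite E in H; apply: der_eq H _; rewrite /GRing.scale/= addrC mulrC.
Qed.

Lemma derZ c f t l : is_derive t 1 f l ->
  is_derive t 1 (fun s => c * f s) (c * l).
Proof.
by move=> df; apply: der_eq (derM (der_cst c t) df) _; rewrite mul0r add0r.
Qed.

Lemma der_sqr f t l : is_derive t 1 f l ->
  is_derive t 1 (fun s => f s ^+ 2) (2 * f t * l).
Proof.
move=> df; have -> : (fun s => f s ^+ 2) = (fun s => f s * f s).
  by apply/funext => s; rewrite expr2.
by apply: der_eq (derM df df) _; ring.
Qed.

Lemma derV f t l : f t != 0 -> is_derive t 1 f l ->
  is_derive t 1 (fun s => (f s)^-1) (- l / f t ^+ 2).
Proof.
move=> f0 df; have H := is_deriveV f0 df.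
by apply: der_eq H _; rewrite /GRing.scale/= !mulNr mulrC.
Qed.

Lemma der_comp f g t l m : is_derive t 1 g m -> is_derive (g t) 1 f l ->
  is_derive t 1 (fun s => f (g s)) (l * m).
Proof.
by move=> dg df; exact: (is_derive1_comp df dg).
Qed.

Lemma der_shift f c t l : is_derive (t + c) 1 f l ->
  is_derive t 1 (fun s => f (s + c)) l.
Proof.
move=> df; apply: der_eq (der_comp (derD (der_id t) (der_cst c t)) df) _.
by ring.
Qed.

Lemma der_opp f t l : is_derive (- t) 1 f l ->
  is_derive t 1 (fun s => f (- s)) (- l).
Proof.
by move=> df; apply: der_eq (der_comp (derN (der_id t)) df) _; ring.
Qed.

Lemma der_continuous f t l : is_derive t 1 f l -> {for t, continuous f}.
Proof.
by move=> df; apply/differentiable_continuous/derivable1_diffP; case: df.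
Qed.

Lemma der_near f g t l : is_derive t 1 f l -> (\forall s \near t, f s = g s) ->
  is_derive t 1 g l.
Proof.
by move=> df fg; apply: near_eq_is_derive df; rewrite ?oner_neq0.
Qed.

Lemma der_ge0_le f (df : R -> R) (a b : R) : a <= b ->
  (forall t, a <= t <= b -> is_derive t 1 f (df t)) ->
  (forall t, a <= t <= b -> 0 <= df t) -> f a <= f b.
Proof.
move=> ab Hd H0.
have [c cab /eqP] : exists2 c, c \in `[a, b]%R & f b - f a = df c * (b - a).
  apply: MVT_segment => // [t|].
    by rewrite in_itv/= => /andP[/ltW at_ /ltW tb]; apply: Hd; rewrite at_ tb.
  apply: derivable_within_continuous => t; rewrite in_itv/= => /Hd.
  by case.
rewrite subr_eq => /eqP ->; rewrite lerDr mulr_ge0 ?subr_ge0//.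
by apply: H0; move: cab; rewrite in_itv.
Qed.

Lemma der_le_diff f (df : R -> R) g (dg : R -> R) (a b : R) : a <= b ->
  (forall t, a <= t <= b -> is_derive t 1 f (df t)) ->
  (forall t, a <= t <= b -> is_derive t 1 g (dg t)) ->
  (forall t, a <= t <= b -> df t <= dg t) -> f b - f a <= g b - g a.
Proof.
move=> ab Hf Hg H.
have : g a - f a <= g b - f b.
  apply: (@der_ge0_le (fun t => g t - f t) (fun t => dg t - df t)) => // t tab.
    by apply: derB; [exact: Hg|exact: Hf].
  by rewrite subr_ge0 H.
by lra.
Qed.

Lemma der_norm_le_diff f (df : R -> R) g (dg : R -> R) (a b : R) : a <= b ->
  (forall t, a <= t <= b -> is_derive t 1 f (df t)) ->
  (forall t, a <= t <= b -> is_derive t 1 g (dg t)) ->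
  (forall t, a <= t <= b -> `|df t| <= dg t) -> `|f b - f a| <= g b - g a.
Proof.
move=> ab Hf Hg H; rewrite ler_norml; apply/andP; split.
  have := @der_le_diff (fun t => - f t) (fun t => - df t) g dg a b ab.
  move=> h; suff : - f b - - f a <= g b - g a by lra.
  apply: h => // t tab; first by apply: derN; exact: Hf.
  by have := H t tab; rewrite ler_norml => /andP[]; lra.
apply: (der_le_diff ab Hf Hg) => t tab.
exact: le_trans (ler_norm _) (H _ tab).
Qed.

Lemma der_lipschitz f (df : R -> R) M (a b : R) :
  (forall t, Num.min a b <= t <= Num.max a b -> is_derive t 1 f (df t)) ->
  (forall t, Num.min a b <= t <= Num.max a b -> `|df t| <= M) ->
  `|f b - f a| <= M * `|b - a|.
Proof.
wlog ab : a b / a <= b => [hw|].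
  have [ab|/ltW ba] := leP a b; first by move=> *; apply: hw; rewrite // ?min_l ?max_r.
  move=> h1 h2; rewrite distrC (distrC b); apply: hw => // t.
    by rewrite (min_l ba) (max_r ba); exact: h1.
  by rewrite (min_l ba) (max_r ba); exact: h2.
rewrite (min_l ab) (max_r ab) => Hd HM.
rewrite (ger0_norm (_ : 0 <= b - a)) ?subr_ge0//.
have -> : M * (b - a) = M * b - M * a by ring.
apply: (@der_norm_le_diff f df (fun t => M * t) (fun=> M)) => // t tab.
by apply: der_eq (derZ M (der_id t)) _; ring.
Qed.

Lemma gronwall_fwd (u du : R -> R) (K a b : R) : a <= b ->
  (forall t, a <= t <= b -> is_derive t 1 u (du t)) ->
  (forall t, a <= t <= b -> du t <= K * u t) ->
  u b <= u a * expR (K * (b - a)).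
Proof.
move=> ab Hd H.
have dE t : is_derive t 1 (fun s => expR (K * (a - s))) (- K * expR (K * (a - t))).
  have dl := derZ K (derB (der_cst a t) (der_id t)).
  by apply: der_eq (der_comp dl (is_derive_expR _)) _; ring.
have : 0 <= u a * expR (K * (a - a)) - u b * expR (K * (a - b)).
  rewrite subr_ge0 -lerN2.
  apply: (@der_ge0_le (fun s => - (u s * expR (K * (a - s))))
    (fun s => - (du s * expR (K * (a - s)) + u s * (- K * expR (K * (a - s)))))) => //.
    by move=> t tab; apply/derN/derM => //; exact: Hd.
  move=> t tab; have := H t tab; have := expR_gt0 (K * (a - t)).
  by move: (expR _) (du t) (u t) => e d w; nra.
have eab : expR (K * (a - b)) * expR (K * (b - a)) = 1.
  by rewrite -expRD (_ : _ + _ = 0) ?expR0//; ring.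
rewrite subrr mulr0 expR0 mulr1 subr_ge0 => /(ler_wpM2r (expR_ge0 (K * (b - a)))).
by rewrite -mulrA eab mulr1.
Qed.

(** The bound on the absolute value of the derivative makes the estimate valid in
    both directions of time. *)
Lemma gronwall (u du : R -> R) (K a b : R) :
  (forall t, Num.min a b <= t <= Num.max a b -> is_derive t 1 u (du t)) ->
  (forall t, Num.min a b <= t <= Num.max a b -> `|du t| <= K * u t) ->
  u b <= u a * expR (K * `|b - a|).
Proof.
have [ab|/ltW ba] := leP a b.
  rewrite ger0_norm ?subr_ge0// => Hd H; apply: gronwall_fwd => // t tab.
  exact: le_trans (ler_norm _) (H _ tab).
rewrite ler0_norm ?subr_le0// => Hd H.
have := @gronwall_fwd (fun s => u (- s)) (fun s => - du (- s)) K (- a) (- b).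
rewrite !opprK (_ : - b + a = - (b - a)); last by ring.
apply; first by rewrite lerN2.
  by move=> t tab; apply: der_opp; apply: Hd; move: tab; lra.
move=> t tab; apply: le_trans (H (- t) _); last by move: tab; lra.
by rewrite -normrN ler_norm.
Qed.

End real_derivatives.

Section gluing.
Context {R : realType}.

(** Passage from solutions on bounded intervals to a global one. *)
Lemma glue (c : R) (X : nat -> R -> R) :
  (forall n m t, (n <= m)%N -> `|t - c| < n%:R -> X n t = X m t) ->
  exists Y : R -> R, forall n t, `|t - c| < n%:R -> Y t = X n t.
Proof.
move=> H; pose k t := (Num.truncn `|t - c|).+1.
have kP t : `|t - c| < (k t)%:R by exact: truncnS_gt.
exists (fun t => X (k t) t) => n t tn.
by have [kn|/ltnW nk] := leqP (k t) n; [exact: H|exact/esym/H].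
Qed.

Lemma near_ball_nat (c t : R) (n : nat) : `|t - c| < n%:R ->
  \forall s \near t, `|s - c| < n%:R.
Proof.
move=> tn; near=> s.
have : `|s - t| < n%:R - `|t - c|.
  rewrite distrC; near: s; apply: (@nbhsx_ballx _ R^o).
  by rewrite subr_gt0.
by have := ler_distD t s c; lra.
Unshelve. all: by end_near. Qed.

(** The fundamental theorem of calculus gives an antiderivative to the right of
    c - n; those that vanish at c agree, by the mean value theorem, wherever two of
    them are defined, and are glued. *)
Lemma continuous_antiderivative (f : R -> R) (c : R) : continuous f ->
  exists F : R -> R, F c = 0 /\ forall t : R, is_derive t 1 F (f t).
Proof.
move=> cf.
pose mu := @lebesgue_measure R.
have intf (a b : R) : mu.-integrable `[a, b] (EFin \o f).
  apply: continuous_compact_integrable; first exact: segment_compact.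
  by apply: continuous_subspaceT => x; exact: cf.
pose I (a b : R) := (\int[mu]_(t in `[a, b]) f t)%R.
pose X (n : nat) t := I (c - n%:R) t - I (c - n%:R) c.
have dX n t : `|t - c| < n%:R -> is_derive t 1 (X n) (f t).
  move=> tn; refine (der_eq (derB (f := I (c - n%:R)) _ (der_cst (I (c - n%:R) c) t)) (subr0 _)).
  have tt1 : t < t + 1 by rewrite ltrDl.
  have ct : c - n%:R < t by move: tn; rewrite ltr_norml; lra.
  have [dI IE] := @continuous_FTC1_closed R f _ t _ tt1 (intf _ _) ct (cf t).
  by apply: DeriveDef; [exact: dI|rewrite -derive1E].
have X0 n : X n c = 0 by rewrite /X subrr.
have [|F FX] := @glue c X.
  move=> n m t nm tn.
  have nmR : (n%:R : R) <= m%:R by rewrite ler_nat.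
  have : `|(X n t - X m t) - (X n c - X m c)| <= 0 * `|t - c|.
    have tP s : Num.min c t <= s <= Num.max c t -> `|s - c| < n%:R.
      by move: tn; rewrite !ltr_norml; have [] := leP c t; lra.
    apply: (@der_lipschitz _ (fun s => X n s - X m s) (fun=> 0)) => s /tP sn.
      by apply: der_eq (derB (dX n s sn) (dX m s _)) _; [exact: lt_le_trans sn nmR|rewrite subrr].
    by rewrite normr0.
  by rewrite mul0r normr_le0 !X0 subrr subr0 subr_eq0 => /eqP.
exists F; split; first by rewrite (FX 1%N) ?X0// subrr normr0.
move=> t; pose n := (Num.truncn `|t - c|).+1.
have tn : `|t - c| < n%:R by exact: truncnS_gt.
apply: der_near (dX n t tn) _.
by apply: filterS (near_ball_nat tn) => s sn; rewrite (FX n).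
Qed.

End gluing.

(** * Separable planar systems *)

Section planar_systems.
Context {R : realType}.
Implicit Types (a b : R -> R -> R) (x v y w : R -> R).

(** Lipschitz continuity in time is included because it enters the error of the
    discretised flow. *)
Definition bounded_lipschitz (L M : R) a :=
  (forall s z, `|a s z| <= M) /\
  (forall s s' z z', `|a s z - a s' z'| <= L * (`|s - s'| + `|z - z'|)).

(** The velocity of a coordinate depends on time and on the other coordinate only;
    this makes the steps of an explicit integration scheme shears of the plane. *)
Definition solves a b x v := forall s : R,
  is_derive s 1 x (a s (v s)) /\ is_derive s 1 v (b s (x s)).

(** Gronwall for the squared distance. The velocities are compared only along the
    two given curves, so that a local Lipschitz constant suffices. *)
Lemma lipschitz_dependence x v y w (dx dv dy dw : R -> R) (L s t : R) :
  0 <= L -> (forall r, Num.min s t <= r <= Num.max s t ->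
    is_derive r 1 x (dx r) /\ is_derive r 1 v (dv r)) ->
  (forall r, Num.min s t <= r <= Num.max s t ->
    is_derive r 1 y (dy r) /\ is_derive r 1 w (dw r)) ->
  (forall r, Num.min s t <= r <= Num.max s t ->
    `|dx r - dy r| <= L * `|v r - w r| /\ `|dv r - dw r| <= L * `|x r - y r|) ->
  (x t - y t) ^+ 2 + (v t - w t) ^+ 2 <=
  ((x s - y s) ^+ 2 + (v s - w s) ^+ 2) * expR (2 * L * `|t - s|).
Proof.
move=> L0 Hx Hy HL.
apply: (@gronwall R (fun r => (x r - y r) ^+ 2 + (v r - w r) ^+ 2)
  (fun r => 2 * (x r - y r) * (dx r - dy r) + 2 * (v r - w r) * (dv r - dw r))).
  move=> r rst; have [xr vr] := Hx r rst; have [yr wr] := Hy r rst.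
  by apply: derD; apply: der_sqr; apply: derB.
move=> r /HL [].
move: (x r - y r) (v r - w r) (dx r - dy r) (dv r - dw r) => p q p' q' h1 h2.
have h3 : `|p * p'| <= L * (`|p| * `|q|).
  by rewrite normrM; have := normr_ge0 p; move: h1; nra.
have h4 : `|q * q'| <= L * (`|p| * `|q|).
  by rewrite normrM; have := normr_ge0 q; move: h2; nra.
have h5 : 2 * (`|p| * `|q|) <= p ^+ 2 + q ^+ 2.
  rewrite -(real_normK (num_real p)) -(real_normK (num_real q)).
  by have := sqr_ge0 (`|p| - `|q|); lra.
have := ler_normD (p * p') (q * q').
have -> : 2 * p * p' + 2 * q * q' = 2 * (p * p' + q * q') by ring.
rewrite (normrM 2) (gtr0_norm (_ : 0 < 2 :> R)) ?ltr0n//.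
by nra.
Qed.

Lemma half_pow_small (z C : R) : (forall n : nat, `|z| <= C / 2 ^+ n) -> z = 0.
Proof.
move=> H; apply/eqP; rewrite -normr_le0 leNgt; apply/negP => z0.
pose n := (Num.truncn (C / `|z|)).+1.
have : C / `|z| < n%:R by exact: truncnS_gt.
rewrite ltr_pdivrMr// => Cn.
have := H n; rewrite ler_pdivlMr ?exprn_gt0// => h.
have : n%:R <= 2 ^+ n :> R by rewrite -natrX ler_nat ltnW// ltn_expl.
by nra.
Qed.

(** The intervals of centre u n and radius 2 C / 2 ^ n are nested; the supremum of
    their left ends belongs to all of them. *)
Lemma half_pow_cauchy (u : nat -> R) (C : R) :
  (forall n, `|u n.+1 - u n| <= C / 2 ^+ n) ->
  exists l, forall n, `|u n - l| <= 2 * C / 2 ^+ n.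
Proof.
move=> H.
have e2 n : C / 2 ^+ n = 2 * (C / 2 ^+ n.+1).
  by rewrite exprS; field; rewrite expf_neq0.
pose lo n := u n - 2 * (C / 2 ^+ n); pose hi n := u n + 2 * (C / 2 ^+ n).
have H2 n : u n - C / 2 ^+ n <= u n.+1 <= u n + C / 2 ^+ n.
  by have := H n; rewrite ler_norml; lra.
have loS n k : lo n <= lo (n + k)%N.
  elim: k => [|k IH]; rewrite ?addn0// addnS; apply: le_trans IH _.
  by have := H2 (n + k)%N; rewrite /lo (e2 (n + k)%N); lra.
have hiS n k : hi (n + k)%N <= hi n.
  elim: k => [|k]; rewrite ?addn0// addnS; apply: le_trans.
  by have := H2 (n + k)%N; rewrite /hi (e2 (n + k)%N); lra.
have C0 n : 0 <= C / 2 ^+ n by exact: le_trans (H n).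
have lohi n m : lo n <= hi m.
  apply: le_trans (loS n m) _; apply: le_trans (_ : hi (n + m)%N <= _).
    by rewrite /lo /hi; have := C0 (n + m)%N; lra.
  by rewrite addnC.
exists (sup (range lo)) => n.
have hs : has_sup (range lo).
  by split; [exists (lo 0%N), 0%N|exists (hi 0%N) => _ [m _ <-]].
have : lo n <= sup (range lo) by apply: sup_upper_bound => //; exists n.
have : sup (range lo) <= hi n by apply: ge_sup; [exact: hs.1|move=> _ [m _ <-]].
by rewrite ler_norml /lo /hi mulrA; lra.
Qed.

(** Integrates a bound that grows exponentially away from s0. With this weight a
    Picard step for L-Lipschitz fields gains a factor L / K on the whole line. *)
Lemma exp_weight_bound (z dz : R -> R) (c K s0 s : R) :
  z s0 = 0 -> (forall r : R, is_derive r 1 z (dz r)) ->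
  (forall r, `|dz r| <= c * K * expR (K * `|r - s0|)) -> 0 <= c ->
  `|z s| <= c * expR (K * `|s - s0|).
Proof.
move=> z0 Hz Hd c0.
have dE (e k r : R) : is_derive r 1 (fun r => e * expR (k * (r - s0)))
    (e * k * expR (k * (r - s0))).
  have dl := derZ k (derB (der_id r) (der_cst s0 r)).
  by apply: der_eq (derZ e (der_comp dl (is_derive_expR _))) _; ring.
have [ss0|/ltW ss0] := leP s0 s.
  have := @der_norm_le_diff R z dz _ _ s0 s ss0 (fun r _ => Hz r) (fun r _ => dE c K r).
  rewrite z0 subr0 subrr mulr0 expR0 (ger0_norm (_ : 0 <= s - s0)) ?subr_ge0// => h.
  apply: le_trans (h _) _; last by lra.
  by move=> r /andP[r0 _]; have := Hd r; rewrite (ger0_norm (_ : 0 <= r - s0)) ?subr_ge0.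
have := @der_norm_le_diff R z dz _ _ s s0 ss0 (fun r _ => Hz r) (fun r _ => dE (- c) (- K) r).
rewrite z0 sub0r normrN subrr mulr0 expR0 (ler0_norm (_ : s - s0 <= 0)) ?subr_le0// => h.
apply: le_trans (h _) _; last by rewrite !mulNr mulrN; lra.
move=> r /andP[_ r0]; have := Hd r.
by rewrite (ler0_norm (_ : r - s0 <= 0)) ?subr_le0// mulrNN mulNr -mulrN.
Qed.

Lemma lipschitz_continuous_R (f : R -> R) (L : R) :
  (forall s t, `|f s - f t| <= L * `|s - t|) -> continuous f.
Proof.
move=> H s.
have L0 : 0 <= L.
  by have := H (s + 1) s; rewrite addrAC subrr add0r normr1 mulr1; exact: le_trans.
apply/cvgrPdist_le => e e0; near=> t.
apply: le_trans (H _ _) _.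
have : `|s - t| < e / (L + 1).
  near: t; apply: (@nbhsx_ballx _ R^o).
  by rewrite divr_gt0// ltr_wpDl.
rewrite ltr_pdivlMr ?ltr_wpDl//.
by have := normr_ge0 (s - t); nra.
Unshelve. all: by end_near. Qed.

Lemma bounded_lipschitz_comp_continuous (L M : R) a (w : R -> R) (K : R) :
  bounded_lipschitz L M a -> (forall s t, `|w s - w t| <= K * `|s - t|) ->
  continuous (fun s => a s (w s)).
Proof.
move=> [_ La] Kw; apply: (@lipschitz_continuous_R _ (`|L| * (1 + `|K|))) => s t.
apply: le_trans (La _ _ _ _) _.
apply: le_trans (_ : `|L| * (`|s - t| + `|w s - w t|) <= _).
  by rewrite ler_wpM2r ?addr_ge0// ler_norm.
rewrite -mulrA ler_wpM2l// mulrDl mul1r lerD2l; apply: le_trans (Kw _ _) _.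
by rewrite ler_wpM2r// ler_norm.
Qed.

(** Picard iteration from the constant curves contracts by 1/2 for the weight
    exp (2 L |s - s0|), hence converges on the whole line. The iterates are
    M-Lipschitz, so the limit is continuous and a fixed point of the Picard step. *)
Theorem picard_existence (L M : R) a b (s0 x0 v0 : R) : 0 < L ->
  bounded_lipschitz L M a -> bounded_lipschitz L M b ->
  exists x v, [/\ solves a b x v, x s0 = x0 & v s0 = v0].
Proof.
move=> L0 Ha Hb.
have M0 : 0 <= M by apply: le_trans (Ha.1 0 0).
have [I IP] : exists I : (R -> R) -> R -> R, forall f, continuous f ->
    I f s0 = 0 /\ forall t : R, is_derive t 1 (I f) (f t).
  suff /choice [I IP] : forall f : R -> R, exists F : R -> R, continuous f ->
    F s0 = 0 /\ forall t : R, is_derive t 1 F (f t) by exists I.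
  move=> f; have [cf|ncf] := pselect (continuous f); last by exists (cst 0).
  by have [F FP] := continuous_antiderivative s0 cf; exists F.
pose step (p : (R -> R) * (R -> R)) : (R -> R) * (R -> R) :=
  (fun s => x0 + I (fun r => a r (p.2 r)) s, fun s => v0 + I (fun r => b r (p.1 r)) s).
pose p n := iter n step (fun=> x0, fun=> v0).
pose lipM (f : R -> R) := forall s t, `|f s - f t| <= M * `|s - t|.
have stepP (q : (R -> R) * (R -> R)) : lipM q.1 -> lipM q.2 ->
   [/\ forall s : R, is_derive s 1 (step q).1 (a s (q.2 s)),
       forall s : R, is_derive s 1 (step q).2 (b s (q.1 s)),
       (step q).1 s0 = x0, (step q).2 s0 = v0 & lipM (step q).1 /\ lipM (step q).2].
  move=> l1 l2.
  have [Ia dIa] := IP _ (bounded_lipschitz_comp_continuous Ha l2).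
  have [Ib dIb] := IP _ (bounded_lipschitz_comp_continuous Hb l1).
  have d1 (s : R) : is_derive s 1 (step q).1 (a s (q.2 s)).
    by apply: der_eq (derD (der_cst x0 s) (dIa s)) _; rewrite add0r.
  have d2 (s : R) : is_derive s 1 (step q).2 (b s (q.1 s)).
    by apply: der_eq (derD (der_cst v0 s) (dIb s)) _; rewrite add0r.
  split=> //; rewrite /= ?Ia ?Ib ?addr0//.
  split=> s t.
    by apply: (@der_lipschitz _ (step q).1 (fun s => a s (q.2 s)) M t s _ (fun r _ => Ha.1 _ _)).
  by apply: (@der_lipschitz _ (step q).2 (fun s => b s (q.1 s)) M t s _ (fun r _ => Hb.1 _ _)).
have plip n : lipM (p n).1 /\ lipM (p n).2.
  elim: n => [|n [h1 h2]]; last by have [] := stepP _ h1 h2.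
  by split=> s t; rewrite /= subrr normr0 mulr_ge0.
(* the weight 2 L makes each step gain L / K = 1 / 2 *)
pose K := 2 * L; have K0 : 0 < K by rewrite mulr_gt0.
pose C := M / K; have C0 : 0 <= C by rewrite divr_ge0// ltW.
pose wt s := expR (K * `|s - s0|).
have wt1 s : 1 <= wt s by rewrite -[leLHS]expR0 ler_expR mulr_ge0 ?normr_ge0 ?(ltW K0).
have pS n : p n.+1 = step (p n) by [].
have start (c : R -> R -> R) (X w : R -> R) s : bounded_lipschitz L M c ->
    (forall r : R, is_derive r 1 X (c r (w r))) -> `|X s - X s0| <= C * wt s.
  move=> [Mc _] dX; have CK : C * K = M by rewrite divfK// gt_eqF.
  apply: (@exp_weight_bound (fun s => X s - X s0) (fun r => c r (w r))) => //.
  - by rewrite subrr.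
  - by move=> r; apply: der_eq (derB (dX r) (der_cst _ _)) _; rewrite subr0.
  - by move=> r; rewrite CK; apply: le_trans (Mc _ _) _; exact: ler_peMr (wt1 r).
have contract (c : R -> R -> R) (X Y w y : R -> R) (k : R) s : bounded_lipschitz L M c ->
    0 <= k -> (forall r : R, is_derive r 1 X (c r (w r))) ->
    (forall r : R, is_derive r 1 Y (c r (y r))) -> X s0 = Y s0 ->
    (forall r, `|w r - y r| <= 2 * k * wt r) -> `|X s - Y s| <= k * wt s.
  move=> [_ Lc] k0 dX dY XY wy.
  apply: (@exp_weight_bound (fun s => X s - Y s) (fun r => c r (w r) - c r (y r)) k K s0 s
    _ (fun r => derB (dX r) (dY r))) => //; first by rewrite XY subrr.
  move=> r; apply: le_trans (Lc _ _ _ _) _; rewrite subrr normr0 add0r.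
  have -> : k * K * expR (K * `|r - s0|) = L * (2 * k * wt r) by rewrite /K /wt; ring.
  by rewrite ler_wpM2l// ltW.
have half n : C / 2 ^+ n = 2 * (C / 2 ^+ n.+1).
  by rewrite exprS; field; rewrite expf_neq0.
have Cn n : 0 <= C / 2 ^+ n by rewrite divr_ge0// exprn_ge0.
have Hn n s : `|(p n.+1).1 s - (p n).1 s| <= C / 2 ^+ n * wt s /\
    `|(p n.+1).2 s - (p n).2 s| <= C / 2 ^+ n * wt s.
  elim: n s => [|n IH] s; rewrite pS.
    rewrite expr0 divr1; have [l1 l2] := plip 0%N.
    have [d1 d2 i1 i2 _] := stepP _ l1 l2.
    have h1 := start _ _ _ s Ha d1; have h2 := start _ _ _ s Hb d2.
    by rewrite i1 in h1; rewrite i2 in h2.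
  have [l1 l2] := plip n; have [d1 d2 i1 i2 [l1' l2']] := stepP _ l1 l2.
  have [d1' d2' i1' i2' _] := stepP _ l1' l2'.
  split; [apply: (contract _ _ _ _ _ _ _ Ha _ d1' d1)|
          apply: (contract _ _ _ _ _ _ _ Hb _ d2' d2)]; rewrite ?i1 ?i1' ?i2 ?i2'//.
    by move=> r; rewrite -half; exact: (IH r).2.
  by move=> r; rewrite -half; exact: (IH r).1.
have /choice[x xP] : forall s, exists l, forall n, `|(p n).1 s - l| <= 2 * (C * wt s) / 2 ^+ n.
  move=> s.
  by apply: half_pow_cauchy => n; rewrite mulrAC; exact: (Hn n s).1.
have /choice[v vP] : forall s, exists l, forall n, `|(p n).2 s - l| <= 2 * (C * wt s) / 2 ^+ n.
  move=> s.
  by apply: half_pow_cauchy => n; rewrite mulrAC; exact: (Hn n s).2.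
have limlip (u : nat -> R -> R) (l : R -> R) : (forall n, lipM (u n)) ->
   (forall s n, `|u n s - l s| <= 2 * (C * wt s) / 2 ^+ n) -> lipM l.
  move=> ul Hl s t.
  rewrite leNgt; apply/negP; rewrite -subr_gt0 => h.
  suff h0 : `|l s - l t| - M * `|s - t| = 0 by rewrite h0 ltxx in h.
  apply: (@half_pow_small _ (2 * (C * wt s) + 2 * (C * wt t))) => n.
  rewrite gtr0_norm// mulrDl.
  have := Hl s n; have := Hl t n; have := ul n s t.
  have : `|l s - l t| <= `|l s - u n s| + `|u n s - u n t| + `|u n t - l t|.
    rewrite -addrA; apply: le_trans (ler_distD (u n s) _ _) _.
    by rewrite lerD2l; exact: ler_distD.
  by rewrite (distrC (l s) (u n s)); lra.
have xlip : lipM x by apply: (limlip (fun n => (p n).1)) => // n; exact: (plip n).1.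
have vlip : lipM v by apply: (limlip (fun n => (p n).2)) => // n; exact: (plip n).2.
have [dx dv ix iv _] := stepP (x, v) xlip vlip.
have fixed (c : R -> R -> R) (X l w : R -> R) (u y : nat -> R -> R) : bounded_lipschitz L M c ->
    (forall r : R, is_derive r 1 X (c r (w r))) ->
    (forall n (r : R), is_derive r 1 (u n.+1) (c r (y n r))) -> (forall n, X s0 = u n.+1 s0) ->
    (forall s n, `|y n s - w s| <= 2 * (C * wt s) / 2 ^+ n) ->
    (forall s n, `|u n s - l s| <= 2 * (C * wt s) / 2 ^+ n) -> X = l.
  move=> Hc dX du Xu yw ul; apply/funext => s; apply/eqP; rewrite -subr_eq0; apply/eqP.
  apply: (@half_pow_small _ (2 * (C * wt s))) => n.
  have e r : 2 * (C * wt r) / 2 ^+ n = 2 * (C / 2 ^+ n) * wt r by ring.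
  have h : `|X s - u n.+1 s| <= C / 2 ^+ n * wt s.
    apply: (contract _ _ _ _ _ _ _ Hc _ dX (du n)) => // r.
    by rewrite distrC -e.
  have := ul s n.+1; have := ler_distD (u n.+1 s) (X s) (l s).
  have -> : 2 * (C * wt s) / 2 ^+ n.+1 = C / 2 ^+ n * wt s by rewrite (half n); ring.
  by rewrite e; lra.
have pP n : [/\ forall s : R, is_derive s 1 (p n.+1).1 (a s ((p n).2 s)),
    forall s : R, is_derive s 1 (p n.+1).2 (b s ((p n).1 s)),
    (p n.+1).1 s0 = x0 & (p n.+1).2 s0 = v0].
  by have [l1 l2] := plip n; have [] := stepP _ l1 l2.
have xE : (step (x, v)).1 = x.
  apply: (fixed a _ _ _ (fun n => (p n).1) (fun n => (p n).2) Ha dx _ _ vP xP) => n.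
    by have [] := pP n.
  by rewrite ix; have [] := pP n.
have vE : (step (x, v)).2 = v.
  apply: (fixed b _ _ _ (fun n => (p n).2) (fun n => (p n).1) Hb dv _ _ xP vP) => n.
    by have [] := pP n.
  by rewrite iv; have [] := pP n.
rewrite xE in dx ix; rewrite vE in dv iv.
by exists x, v; split.
Qed.

End planar_systems.

(** * Measure preserving maps and Lebesgue measure on the plane *)

Section measure_preserving_maps.
Context {R : realType}.
Local Open Scope ereal_scope.

Definition measure_preserving d (T : measurableType d) (m : set T -> \bar R)
    (F : T -> T) :=
  measurable_fun setT F /\ forall A, measurable A -> m (F @^-1` A) = m A.

Lemma measurable_preimage d1 d2 (T1 : measurableType d1) (T2 : measurableType d2)
    (F : T1 -> T2) A :
  measurable_fun setT F -> measurable A -> measurable (F @^-1` A).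
Proof. by move=> mF mA; rewrite -[_ @^-1` _]setTI; exact: mF. Qed.

Lemma measure_preserving_comp d (T : measurableType d) (m : set T -> \bar R)
    (F G : T -> T) :
  measure_preserving m F -> measure_preserving m G -> measure_preserving m (F \o G).
Proof.
move=> [mF pF] [mG pG]; split; first exact: measurableT_comp.
by move=> A mA; rewrite comp_preimage pG ?pF//; exact: measurable_preimage.
Qed.

Lemma measure_preserving_iter d (T : measurableType d) (m : set T -> \bar R)
    (F : T -> T) n : measure_preserving m F -> measure_preserving m (iter n F).
Proof.
move=> mF; elim: n => [|n IH]; first by split=> //; exact: measurable_id.
exact: (measure_preserving_comp mF IH).
Qed.

(** The measure of a preimage is the integral of the measures of its fibres. The
    fibre over x is the preimage under s x of a fibre over r x, and has its measure;
    integrating over x, the first factor is transported by r. *)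
Lemma skew_product_preserving d1 d2 (T1 : measurableType d1) (T2 : measurableType d2)
    (m1 : {measure set T1 -> \bar R}) (m2 : {sigma_finite_measure set T2 -> \bar R})
    (r : T1 -> T1) (s : T1 -> T2 -> T2) :
  measure_preserving m1 r ->
  measurable_fun setT (fun z : T1 * T2 => (r z.1, s z.1 z.2)) ->
  (forall x B, measurable B -> m2 (s x @^-1` B) = m2 B) ->
  measure_preserving (m1 \x m2) (fun z : T1 * T2 => (r z.1, s z.1 z.2)).
Proof.
move=> [mr pr] mF ps; split=> // A mA.
have mfA := measurable_fun_xsection m2 mA.
transitivity (\int[m1]_x ((m2 \o xsection A) \o r) x).
  apply: eq_integral => x _ /=; rewrite -(ps x _ (measurable_xsection _ mA)).
  by congr (m2 _); apply/seteqP; split=> y; rewrite /xsection/= !inE.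
transitivity (\int[pushforward m1 r]_(x in setT) (m2 \o xsection A) x).
  by rewrite ge0_integral_pushforward// => x _; exact: measure_ge0.
by apply: eq_measure_integral => B mB _; exact: pr.
Qed.

End measure_preserving_maps.

Section lebesgue_plane.
Context {R : realType}.
Local Notation T := (measurableTypeR R).
Local Notation leb := (@lebesgue_measure R).
Local Notation leb2 := (leb \x leb)%E.
Local Open Scope ereal_scope.

Lemma lebesgue_ocitv (a b : R) : (a <= b)%R -> leb `]a, b]%classic = (b - a)%:E.
Proof.
rewrite le_eqVlt => /predU1P[->|ab].
  by rewrite set_itv_ge ?bnd_simp ?ltxx// measure0 subrr.
by rewrite lebesgue_measure_itv/= lte_fin ab EFinB.
Qed.

Lemma continuous_measurable (f : R -> R) : continuous f ->
  measurable_fun (setT : set T) (f : T -> T).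
Proof. by move=> cf; exact: continuous_measurable_fun. Qed.

Lemma lebesgue_translation (c : R) A : measurable (A : set T) ->
  leb ((fun x : R => (x + c)%R) @^-1` A) = leb A.
Proof.
have mt : measurable_fun (setT : set T) ((fun x : R => (x + c)%R) : T -> T).
  by apply: continuous_measurable => x; apply: cvgD; [exact: cvg_id|exact: cvg_cst].
move=> mA; symmetry.
apply: (@lebesgue_measure_unique R (pushforward leb _) _ A mA) => X.
move=> /ocitvP[->|[[a b] /= ab ->]]; first by rewrite !measure0.
rewrite /pushforward (_ : _ @^-1` _ = `](a - c)%R, (b - c)%R]%classic).
  by rewrite !lebesgue_ocitv ?lerB// ?ltW//; congr (_%:E); ring.
by apply/seteqP; split=> x/=; rewrite !in_itv/= ltrBlDr lerBrDr.
Qed.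

Definition rectangle (a b c d : R) : set (T * T) := `]a, b]%classic `*` `]c, d]%classic.

Lemma rectangleP (a b c d : R) (z : R * R) :
  rectangle a b c d z <-> (a < z.1 <= b /\ c < z.2 <= d)%R.
Proof. by rewrite /rectangle/= !in_itv. Qed.

Lemma measurable_rectangle a b c d : measurable (rectangle a b c d).
Proof. by apply: measurableX; exact: measurable_itv. Qed.

Lemma lebesgue2_rectangle (a b c d : R) : (a <= b)%R -> (c <= d)%R ->
  leb2 (rectangle a b c d) = ((b - a) * (d - c))%:E.
Proof.
move=> ab cd; rewrite product_measure1E//; try exact: measurable_itv.
by rewrite EFinM -!lebesgue_ocitv.
Qed.

Lemma squares_cover :
  \bigcup_n rectangle (- n%:R)%R n%:R%R (- n%:R)%R n%:R%R = [set: T * T].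
Proof.
apply/seteqP; split=> // -[x y] _.
exists (Num.truncn (`|x : R| + `|y : R|)%R).+1 => //.
have := truncnS_gt (`|x : R| + `|y : R|)%R.
have := normr_ge0 (x : R); have := normr_ge0 (y : R).
have := ler_norm (x : R); have := ler_norm (y : R).
have := ler_norm (- (x : R)); have := ler_norm (- (y : R)); rewrite !normrN.
by move=> *; split; rewrite /= in_itv/=; apply/andP; split; lra.
Qed.

Lemma square_finite (n : nat) :
  leb2 (rectangle (- n%:R)%R n%:R%R (- n%:R)%R n%:R%R) < +oo.
Proof.
have nn : (- n%:R <= n%:R :> R)%R by rewrite -subr_ge0 opprK addr_ge0.
by apply: le_lt_trans (ltry _); rewrite le_eqVlt; apply/orP; left;
  apply/eqP; exact: (lebesgue2_rectangle nn nn).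
Qed.

(** Preimages of intervals under the two projections are strips, and a strip is a
    countable union of rectangles. *)
Lemma measurable_plane_rectangles : (measurable : set (set (T * T))) =
  <<s [set rectangle p.1 p.2 q.1 q.2 | p in [set: R * R] & q in [set: R * R]] >>.
Proof.
set G := (X in <<s X >>).
rewrite eqEsubset; split; last first.
  apply: smallest_sub; first exact: sigma_algebra_measurable.
  by move=> _ [p _ [q _ <-]]; exact: measurable_rectangle.
apply: smallest_sub; first exact: smallest_sigma_algebra.
have UT (a b : R) : `]a, b]%classic `*` [set: T] =
    \bigcup_n rectangle a b (- n%:R)%R n%:R%R :> set (T * T).
  apply/seteqP; split=> [[x y] [/= xab _]|[x y] [n _ [/= xab _]]]; last by split.
  exists (Num.truncn `|y : R|).+1 => //; split=> //=.
  have := truncnS_gt `|y : R|; rewrite in_itv/= ltr_norml => /andP[-> /ltW].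
  by [].
have UT' (a b : R) : [set: T] `*` `]a, b]%classic =
    \bigcup_n rectangle (- n%:R)%R n%:R%R a b :> set (T * T).
  apply/seteqP; split=> [[x y] [/= _ xab]|[x y] [n _ [/= _ xab]]]; last by split.
  exists (Num.truncn `|x : R|).+1 => //; split=> //=.
  have := truncnS_gt `|x : R|; rewrite in_itv/= ltr_norml => /andP[-> /ltW].
  by [].
rewrite subUset; split.
  rewrite -g_sigma_preimageE; apply: smallest_sub; first exact: smallest_sigma_algebra.
  move=> _ [_ [[a b] _ <-] <-]; rewrite setTI (_ : _ @^-1` _ = \bigcup_n rectangle a b (- n%:R)%R n%:R%R); last first.
    by rewrite -UT; apply/seteqP; split=> -[x y]//= [].
  apply: sigma_algebra_bigcup => n; apply: sub_sigma_algebra.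
  by exists (a, b) => //; exists ((- n%:R)%R : R, n%:R%R : R).
rewrite -g_sigma_preimageE; apply: smallest_sub; first exact: smallest_sigma_algebra.
move=> _ [_ [[a b] _ <-] <-]; rewrite setTI (_ : _ @^-1` _ = \bigcup_n rectangle (- n%:R)%R n%:R%R a b); last first.
  by rewrite -UT'; apply/seteqP; split=> -[x y]//= [].
apply: sigma_algebra_bigcup => n; apply: sub_sigma_algebra.
by exists ((- n%:R)%R : R, n%:R%R : R) => //; exists (a, b).
Qed.

(** The half-open rectangles are stable under intersection, generate the Borel
    sets, and countably many of finite measure cover the plane. *)
Lemma lebesgue2_unique (m : {measure set (T * T) -> \bar R}) :
  (forall a b c d : R, (a < b)%R -> (c < d)%R ->
     m (rectangle a b c d) = ((b - a) * (d - c))%:E) ->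
  forall A, measurable A -> m A = leb2 A.
Proof.
move=> H A mA; symmetry.
have H' (a b c d : R) : leb2 (rectangle a b c d) = m (rectangle a b c d).
  have [ab|ba] := ltP a b; last first.
    rewrite (_ : rectangle _ _ _ _ = set0) ?measure0//.
    rewrite /rectangle (_ : `]a, b]%classic = set0) ?set0X//.
    by rewrite set_itv_ge// bnd_simp -leNgt.
  have [cd|dc] := ltP c d; last first.
    rewrite (_ : rectangle _ _ _ _ = set0) ?measure0//.
    rewrite /rectangle (_ : `]c, d]%classic = set0) ?setX0//.
    by rewrite set_itv_ge// bnd_simp -leNgt.
  by rewrite H// lebesgue2_rectangle// ltW.
apply: (@measure_unique _ R _ _ (fun n : nat => rectangle (- n%:R)%R n%:R%R (- n%:R)%R n%:R%R)
  measurable_plane_rectangles) => //.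
- move=> _ _ [[a b] _ [[c d] _ <-]] [[a' b'] _ [[c' d'] _ <-]].
  exists (Num.max a a', Num.min b b') => //.
  exists (Num.max c c', Num.min d d') => //=.
  apply/seteqP; split=> -[x y]; rewrite /rectangle/= !in_itv/= !gt_max !le_min.
    by move=> [/andP[/andP[-> ->] /andP[-> ->]] /andP[/andP[-> ->] /andP[-> ->]]].
  by move=> [[/andP[-> ->] /andP[-> ->]] [/andP[-> ->] /andP[-> ->]]].
- by move=> n; exists ((- n%:R)%R : R, n%:R%R : R) => //; exists ((- n%:R)%R : R, n%:R%R : R).
- exact: squares_cover.
- by move=> _ [[a b] _ [[c d] _ <-]]; exact: H'.
- exact: square_finite.
Qed.

(** With these instances the plane can in turn be a factor of a product measure. *)
HB.instance Definition _ := Measure.copy (@lebesgue2 R) leb2.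
Lemma lebesgue2_sigma_finite : sigma_finite [set: T * T] (@lebesgue2 R).
Proof.
exists (fun n : nat => rectangle (- n%:R)%R n%:R%R (- n%:R)%R n%:R%R).
  by rewrite squares_cover.
by move=> n; split; [exact: measurable_rectangle|exact: square_finite].
Qed.
HB.instance Definition _ := @Measure_isSigmaFinite.Build _ _ _ (@lebesgue2 R) lebesgue2_sigma_finite.

End lebesgue_plane.

(** * The symplectic Euler scheme *)

Section euler_scheme.
Context {R : realType}.
Local Notation T := (measurableTypeR R).
Local Notation leb := (@lebesgue_measure R).
Local Notation leb2 := (leb \x leb)%E.

(** The second coordinate is updated with the new value of the first one, so that a
    step is a composition of two shears and preserves area exactly. *)
Fixpoint euler (A B : nat -> R -> R) (h : R) (k : nat) (z : R * R) : R * R :=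
  if k is k'.+1 then
    let p := euler A B h k' z in
    let x := p.1 + h * A k' p.2 in (x, p.2 + h * B k' x)
  else z.

Lemma measurable_euler d (Y : measurableType d) (A B : Y -> nat -> R -> R)
    (h : Y -> R) (z : Y -> R * R) k :
  (forall k, measurable_fun setT (fun yw : Y * R => A yw.1 k yw.2)) ->
  (forall k, measurable_fun setT (fun yw : Y * R => B yw.1 k yw.2)) ->
  measurable_fun setT h ->
  measurable_fun setT (fun y => (z y).1) -> measurable_fun setT (fun y => (z y).2) ->
  measurable_fun setT (fun y => (euler (A y) (B y) (h y) k (z y)).1) /\
  measurable_fun setT (fun y => (euler (A y) (B y) (h y) k (z y)).2).
Proof.
move=> mA mB mh m1 m2; elim: k => [//|k [IH1 IH2]] /=.
have mx : measurable_fun setT (fun y => (euler (A y) (B y) (h y) k (z y)).1 +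
    h y * A y k (euler (A y) (B y) (h y) k (z y)).2).
  apply: measurable_funD => //; apply: measurable_funM => //.
  exact: (measurableT_comp (mA k) (measurable_fun_pair (@measurable_id _ Y setT) IH2)).
split=> //.
apply: measurable_funD => //; apply: measurable_funM => //.
exact: (measurableT_comp (mB k) (measurable_fun_pair (@measurable_id _ Y setT) mx)).
Qed.

Lemma shear_snd_preserving (f : R -> R) : continuous f ->
  measure_preserving leb2 (fun z : T * T => (z.1, (z.2 + f z.1 : R))).
Proof.
move=> cf.
apply: (@skew_product_preserving R _ _ T T leb leb id (fun x y => (y + f x : R))).
- by split=> //; exact: measurable_id.
- have m1 : measurable_fun (setT : set (T * T)) (fun z => f z.1 : R).
    exact: (measurableT_comp (continuous_measurable_fun cf) (@measurable_fst _ _ T T)).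
  have m2 : measurable_fun (setT : set (T * T)) (fun z => (z.2 : R)).
    exact: (@measurable_snd _ _ T T).
  exact: (measurable_fun_pair (@measurable_fst _ _ T T) (measurable_funD m2 m1)).
- by move=> x B mB; exact: lebesgue_translation.
Qed.

Lemma swap_preserving (A : set (T * T)) : measurable A ->
  leb2 ((fun z => (z.2, z.1)) @^-1` A) = leb2 A.
Proof.
move=> mA.
have ms : measurable_fun setT (fun z : T * T => (z.2, z.1)) by exact: measurable_fun_pair.
apply: (@lebesgue2_unique R (pushforward leb2 (fun z : T * T => (z.2, z.1)))) => //.
move=> a b c d ab cd.
have e : rectangle c d a b = (fun z : T * T => (z.2, z.1)) @^-1` rectangle a b c d.
  by apply/seteqP; split=> -[x y] /= []; split.
by have := lebesgue2_rectangle (ltW cd) (ltW ab); rewrite e mulrC.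
Qed.

Lemma shear_fst_preserving (f : R -> R) : continuous f ->
  measure_preserving leb2 (fun z : T * T => ((z.1 + f z.2 : R), z.2)).
Proof.
move=> cf; pose sw (z : T * T) := (z.2, z.1).
have psw : measure_preserving leb2 sw.
  by split; [exact: measurable_fun_pair|exact: swap_preserving].
exact: (measure_preserving_comp psw
  (measure_preserving_comp (shear_snd_preserving cf) psw)).
Qed.

Lemma euler_preserving (A B : nat -> R -> R) (h : R) k :
  (forall k, continuous (A k)) -> (forall k, continuous (B k)) ->
  measure_preserving leb2 (euler A B h k : T * T -> T * T).
Proof.
move=> cA cB; elim: k => [|k IH]; first by split=> //; exact: measurable_id.
have chA : continuous (fun w : R => h * A k w).
  by move=> w; apply: cvgM; [exact: cvg_cst|exact: cA].
have chB : continuous (fun w : R => h * B k w).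
  by move=> w; apply: cvgM; [exact: cvg_cst|exact: cB].
exact: (measure_preserving_comp (shear_snd_preserving chB)
  (measure_preserving_comp (shear_fst_preserving chA) IH)).
Qed.

(** During a step the velocities vary by O(h), which gives a local error of order
    h ^ 2; an error in the data is amplified by at most 1 + 2 L |h|. *)
Lemma euler_one_step (L M : R) (a b : R -> R -> R) (x v : R -> R) (s h X V x1 : R) :
  0 <= L -> bounded_lipschitz L M a -> bounded_lipschitz L M b -> solves a b x v ->
  L * `|h| <= 1 -> x1 = X + h * a s V ->
  `|x (s + h) - x1| + `|v (s + h) - (V + h * b s x1)| <=
  (1 + 2 * L * `|h|) * (`|x s - X| + `|v s - V|) + L * (2 + 3 * M) * h ^+ 2.
Proof.
move=> L0 [Ma La] [Mb Lb] sol Lh x1E.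
have M0 : 0 <= M by exact: le_trans (Ma 0 0).
have hh : h ^+ 2 = `|h| * `|h| by rewrite -expr2 real_normK ?num_real.
have inS r : Num.min s (s + h) <= r <= Num.max s (s + h) -> `|r - s| <= `|h|.
  have := ler_norm h; have := ler_norm (- h); rewrite normrN ler_norml.
  by have [h0|h0] := leP s (s + h); lra.
have xr r : `|x r - x s| <= M * `|r - s|.
  by apply: (@der_lipschitz _ x (fun r => a r (v r))) => // t _; exact: (sol t).1.
have vr r : `|v r - v s| <= M * `|r - s|.
  by apply: (@der_lipschitz _ v (fun r => b r (x r))) => // t _; exact: (sol t).2.
have e1 : `|x (s + h) - x s - h * a s (v s)| <= L * (1 + M) * `|h| * `|h|.
  have := @der_lipschitz R (fun r => x r - a s (v s) * r)
    (fun r => a r (v r) - a s (v s)) (L * (1 + M) * `|h|) s (s + h).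
  rewrite (_ : s + h - s = h); last by ring.
  rewrite (_ : x (s + h) - _ - _ = x (s + h) - x s - h * a s (v s)); last by ring.
  apply=> r /inS rs.
    apply: der_eq (derB (sol r).1 (derZ (a s (v s)) (der_id r))) _.
    by rewrite mulr1.
  apply: le_trans (La _ _ _ _) _; rewrite -!mulrA ler_wpM2l// mulrDl mul1r lerD//.
  by apply: le_trans (vr r) _; rewrite ler_wpM2l.
pose y1 := x s + h * a s (v s).
have e2 : `|v (s + h) - v s - h * b s y1| <= L * (1 + 2 * M) * `|h| * `|h|.
  have := @der_lipschitz R (fun r => v r - b s y1 * r)
    (fun r => b r (x r) - b s y1) (L * (1 + 2 * M) * `|h|) s (s + h).
  rewrite (_ : s + h - s = h); last by ring.
  rewrite (_ : v (s + h) - _ - _ = v (s + h) - v s - h * b s y1); last by ring.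
  apply=> r /inS rs.
    apply: der_eq (derB (sol r).2 (derZ (b s y1) (der_id r))) _.
    by rewrite mulr1.
  apply: le_trans (Lb _ _ _ _) _; rewrite -!mulrA ler_wpM2l// mulrDl mul1r lerD//.
  have -> : x r - y1 = (x r - x s) - h * a s (v s) by rewrite /y1; ring.
  apply: le_trans (ler_normB _ _) _; rewrite normrM.
  have := xr r; have := Ma s (v s); have := normr_ge0 h; nra.
have e3 : `|a s (v s) - a s V| <= L * `|v s - V|.
  by apply: le_trans (La _ _ _ _) _; rewrite subrr normr0 add0r.
have e4 : `|b s y1 - b s x1| <= L * `|y1 - x1|.
  by apply: le_trans (Lb _ _ _ _) _; rewrite subrr normr0 add0r.
have e5 : `|y1 - x1| <= `|x s - X| + `|h| * (L * `|v s - V|).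
  have -> : y1 - x1 = (x s - X) + h * (a s (v s) - a s V) by rewrite /y1 x1E; ring.
  by apply: le_trans (ler_normD _ _) _; rewrite lerD2l normrM ler_wpM2l.
have f1 : `|x (s + h) - x1| <= L * (1 + M) * `|h| * `|h| + `|y1 - x1|.
  have -> : x (s + h) - x1 = (x (s + h) - x s - h * a s (v s)) + (y1 - x1).
    by rewrite /y1; ring.
  by apply: le_trans (ler_normD _ _) _; rewrite lerD2r.
have f2 : `|v (s + h) - (V + h * b s x1)| <=
    L * (1 + 2 * M) * `|h| * `|h| + `|v s - V| + `|h| * (L * `|y1 - x1|).
  have -> : v (s + h) - (V + h * b s x1) =
    (v (s + h) - v s - h * b s y1) + (v s - V) + h * (b s y1 - b s x1) by ring.
  apply: le_trans (ler_normD _ _) _; apply: lerD.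
    by apply: le_trans (ler_normD _ _) _; rewrite lerD2r.
  by rewrite normrM ler_wpM2l.
rewrite hh; have h0 := normr_ge0 h; have p0 := normr_ge0 (x s - X).
have q0 := normr_ge0 (v s - V).
move: f1 f2 e5 Lh; clear -L0 M0 h0 p0 q0.
move: `|x (s + h) - x1| `|v (s + h) - _| `|y1 - x1| `|h| `|x s - X| `|v s - V| h0 p0 q0.
move=> A B D H p q h0 p0 q0 f1 f2 e5 Lh.
have g1 : H * (L * D) <= H * (L * (p + H * (L * q))).
  by rewrite ler_wpM2l// ler_wpM2l.
have g2 : H * (L * (H * (L * q))) <= H * (L * q).
  do 2 rewrite ler_wpM2l//.
  have : 0 <= (1 - L * H) * q by rewrite mulr_ge0// subr_ge0.
  by lra.
have g3 : 0 <= H * (L * p) by rewrite !mulr_ge0.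
by move: g1; rewrite mulrDr mulrDr; move: g2 e5 f1 f2; lra.
Qed.

(** After k steps the local errors, k in number, have each been amplified by at most
    exp (2 L |h| k). *)
Lemma euler_error (L M : R) (a b : R -> R -> R) (x v : R -> R) (s h : R) k p :
  0 <= L -> bounded_lipschitz L M a -> bounded_lipschitz L M b -> solves a b x v ->
  L * `|h| <= 1 ->
  p = euler (fun k => a (s + k%:R * h)) (fun k => b (s + k%:R * h)) h k (x s, v s) ->
  `|x (s + k%:R * h) - p.1| + `|v (s + k%:R * h) - p.2| <=
  k%:R * (L * (2 + 3 * M) * h ^+ 2) * expR (2 * L * `|h| * k%:R).
Proof.
move=> L0 Ha Hb sol Lh; elim: k p => [|k IH] _ -> /=.
  by rewrite !mul0r addr0 !subrr normr0 addr0.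
have M0 : 0 <= M by exact: le_trans (Ha.1 0 0).
set p := euler _ _ _ k _ in IH *.
have -> : s + k.+1%:R * h = s + k%:R * h + h by rewrite -natr1; ring.
have := @euler_one_step L M a b x v (s + k%:R * h) h p.1 p.2 _ L0 Ha Hb sol Lh erefl.
move/le_trans; apply.
have {IH} := IH p erefl.
set c := L * (2 + 3 * M) * h ^+ 2; set D := _ + _.
set u := 2 * L * `|h|.
have c0 : 0 <= c by rewrite mulr_ge0 ?sqr_ge0// mulr_ge0// addr_ge0// mulr_ge0.
have u0 : 0 <= u by rewrite !mulr_ge0.
move=> IH.
have e1 : expR (u * k.+1%:R) = expR (u * k%:R) * expR u.
  by rewrite -natr1 mulrDr mulr1 expRD.
have e2 : 1 + u <= expR u by exact: expR_ge1Dx.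
have e3 : 1 <= expR (u * k.+1%:R) by rewrite -[leLHS]expR0 ler_expR mulr_ge0.
have e4 : 0 <= expR (u * k%:R) by exact: expR_ge0.
have e5 : (1 + u) * D <= expR u * (k%:R * c * expR (u * k%:R)).
  by apply: ler_pM => //; rewrite addr_ge0.
have e6 : c <= c * expR (u * k.+1%:R) by rewrite ler_peMr.
rewrite -[X in X * c]natr1 (_ : (k%:R + 1) * c * expR (u * k.+1%:R) =
  expR u * (k%:R * c * expR (u * k%:R)) + c * expR (u * k.+1%:R)); first exact: lerD.
by rewrite e1; ring.
Qed.

End euler_scheme.

(** * Flows of separable systems preserve area *)

Section flow_maps.
Context {R : realType}.
Local Notation T := (measurableTypeR R).
Local Notation leb := (@lebesgue_measure R).
Local Notation leb2 := (leb \x leb)%E.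

Definition euler_flow (a b : R -> R -> R) (s0 s1 : R) (n : nat) : R * R -> R * R :=
  let h := (s1 - s0) / n.+1%:R in
  euler (fun k => a (s0 + k%:R * h)) (fun k => b (s0 + k%:R * h)) h n.+1.

Arguments euler_flow : simpl never.

(** There are n + 1 local errors of order 1 / (n + 1) ^ 2. *)
Lemma euler_flow_error (L M : R) (a b : R -> R -> R) (s0 s1 : R) :
  0 <= L -> bounded_lipschitz L M a -> bounded_lipschitz L M b ->
  exists C : R, forall (x v : R -> R) n, solves a b x v -> L * `|s1 - s0| <= n.+1%:R ->
  `|x s1 - (euler_flow a b s0 s1 n (x s0, v s0)).1| +
  `|v s1 - (euler_flow a b s0 s1 n (x s0, v s0)).2| <= C / n.+1%:R.
Proof.
move=> L0 Ha Hb; set t := `|s1 - s0|.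
exists (L * (2 + 3 * M) * t ^+ 2 * expR (2 * L * t)) => x v n sol Ln.
set p := euler_flow _ _ _ _ _ _.
pose h := (s1 - s0) / n.+1%:R.
have hn : `|h| = t / n.+1%:R by rewrite normrM normfV (ger0_norm (ler0n _ _)).
have Lh : L * `|h| <= 1 by rewrite hn mulrA ler_pdivrMr ?ltr0n// mul1r.
have := @euler_error R L M a b x v s0 h n.+1 p L0 Ha Hb sol Lh erefl.
have -> : s0 + n.+1%:R * h = s1 by rewrite /h; field.
move/le_trans; apply.
have -> : h ^+ 2 = t ^+ 2 / n.+1%:R ^+ 2.
  by rewrite -(real_normK (num_real h)) hn expr_div_n.
rewrite hn le_eqVlt; apply/orP; left; apply/eqP.
have -> : 2 * L * (t / n.+1%:R) * n.+1%:R = 2 * L * t by field.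
by field.
Qed.

Lemma cvg_of_rate (u : nat -> R) (l C N : R) :
  (forall n : nat, N <= n.+1%:R -> `|l - u n| <= C / n.+1%:R) -> u @ \oo --> l.
Proof.
move=> H; apply/cvgrPdist_le => e e0.
have C0 : 0 <= `|C| by [].
pose m := (Num.truncn (`|N| + `|C| / e)).+1.
have mP : `|N| + `|C| / e < m%:R by exact: truncnS_gt.
have Ce0 : 0 <= `|C| / e by rewrite divr_ge0// ltW.
exists m => // n /= mn.
have nm : m%:R <= n.+1%:R :> R by rewrite ler_nat leqW.
have := ler_norm N; have := normr_ge0 N => N0 NN.
apply: le_trans (H n _) _; first by lra.
rewrite ler_pdivrMr ?ltr0n//; apply: le_trans (ler_norm _) _.
have : `|C| / e <= n.+1%:R by lra.
by rewrite ler_pdivrMr// mulrC.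
Qed.

(** Replace r by its discretisation with step 1 / (n + 1): it takes countably many
    values, and on each of its level sets the function is some F s. Continuity in the
    first argument lets n tend to infinity. *)
Lemma measurable_caratheodory d (Y : measurableType d) (F : R -> Y -> R) (r : Y -> R) :
  (forall s, measurable_fun setT (F s)) -> (forall y, continuous (F ^~ y)) ->
  measurable_fun setT r -> measurable_fun setT (fun y => F (r y) y).
Proof.
move=> mF cF mr.
pose q (n : nat) y := (Num.floor (n.+1%:R * r y))%:~R / n.+1%:R : R.
apply: (@measurable_fun_cvg _ Y R setT (fun n y => F (q n y) y)).
  move=> n _ B mB; rewrite setTI.
  have -> : (fun y => F (q n y) y) @^-1` B = \bigcup_(k in [set: int])
      (((fun y => n.+1%:R * r y) @^-1` `[k%:~R, (k + 1)%:~R[%classic)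
      `&` (F (k%:~R / n.+1%:R) @^-1` B)).
    apply/seteqP; split=> [y /= By|y [k _ [/= kr Bk]]].
      exists (Num.floor (n.+1%:R * r y)) => //; split=> //=.
      by rewrite in_itv/= floor_le floorD1_gt.
    rewrite /q (_ : Num.floor _ = k)//.
    by apply/floor_def; move: kr; rewrite in_itv.
  apply: countable_bigcupT_measurable => // k; apply: measurableI.
    apply: measurable_preimage; last exact: measurable_itv.
    by apply: measurable_funM => //; exact: measurable_cst.
  exact: measurable_preimage.
move=> y _; apply: (@cvg_comp _ _ _ (q ^~ y) (F ^~ y) _ (nbhs (r y))); last exact: cF.
apply: (@cvg_of_rate _ _ 1 0) => n _; rewrite /q ler_pdivlMr ?ltr0n//.
rewrite -[X in _ * X](ger0_norm (ler0n R n.+1)) -normrM mulrBl divfK ?pnatr_eq0//.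
have := floor_le (n.+1%:R * r y); have := floorD1_gt (n.+1%:R * r y).
by rewrite intrD [r y * _]mulrC ler_norml; lra.
Qed.

Lemma bounded_lipschitz_measurable d (Y : measurableType d) (L M : R) (a : R -> R -> R)
    (r w : Y -> R) : bounded_lipschitz L M a ->
  measurable_fun setT r -> measurable_fun setT w ->
  measurable_fun setT (fun y => a (r y) (w y)).
Proof.
move=> [_ La] mr mw.
apply: (@measurable_caratheodory _ Y (fun s y => a s (w y)) r) => //.
  move=> s; apply: (@measurableT_comp _ _ _ _ _ _ (a s)) => //.
  apply: continuous_measurable_fun; apply: (@lipschitz_continuous_R _ _ L) => z z'.
  by apply: le_trans (La _ _ _ _) _; rewrite subrr normr0 add0r.
move=> y; apply: (@lipschitz_continuous_R _ _ L) => z z'.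
by apply: le_trans (La _ _ _ _) _; rewrite subrr normr0 addr0.
Qed.

(** A solution is the limit of its Euler schemes, which are compositions of
    measurable maps. *)
Lemma measurable_flow d (Y : measurableType d) (L M : R) (a b : Y -> R -> R -> R)
    (s0 s1 : Y -> R) (z S : Y -> R * R) :
  0 <= L ->
  (forall y, bounded_lipschitz L M (a y)) -> (forall y, bounded_lipschitz L M (b y)) ->
  (forall y, exists x v, [/\ solves (a y) (b y) x v,
     z y = (x (s0 y), v (s0 y)) & S y = (x (s1 y), v (s1 y))]) ->
  (forall r : Y -> R, measurable_fun setT r ->
     measurable_fun setT (fun yw : Y * R => a yw.1 (r yw.1) yw.2)) ->
  (forall r : Y -> R, measurable_fun setT r ->
     measurable_fun setT (fun yw : Y * R => b yw.1 (r yw.1) yw.2)) ->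
  measurable_fun setT s0 -> measurable_fun setT s1 ->
  measurable_fun setT (fun y => (z y).1) -> measurable_fun setT (fun y => (z y).2) ->
  measurable_fun setT (fun y => (S y).1) /\ measurable_fun setT (fun y => (S y).2).
Proof.
move=> L0 Ha Hb sol ma mb ms0 ms1 mz1 mz2.
have mE n : measurable_fun setT (fun y => (euler_flow (a y) (b y) (s0 y) (s1 y) n (z y)).1) /\
   measurable_fun setT (fun y => (euler_flow (a y) (b y) (s0 y) (s1 y) n (z y)).2).
  have mh : measurable_fun setT (fun y => (s1 y - s0 y) / n.+1%:R).
    by apply: measurable_funM; [exact: measurable_funB|exact: measurable_cst].
  have mr (k : nat) : measurable_fun setT
      (fun y => s0 y + k%:R * ((s1 y - s0 y) / n.+1%:R)).
    by apply: measurable_funD => //; apply: measurable_funM => //; exact: measurable_cst.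
  apply: (@measurable_euler R _ Y
    (fun y k => a y (s0 y + k%:R * ((s1 y - s0 y) / n.+1%:R)))
    (fun y k => b y (s0 y + k%:R * ((s1 y - s0 y) / n.+1%:R)))) => // k.
    exact: ma _ (mr k).
  exact: mb _ (mr k).
split.
  apply: (@measurable_fun_cvg _ Y R setT
    (fun n y => (euler_flow (a y) (b y) (s0 y) (s1 y) n (z y)).1)).
    by move=> n; exact: (mE n).1.
  move=> y _; have [x [v [xv -> ->]]] := sol y.
  have [C CP] := euler_flow_error (s0 y) (s1 y) L0 (Ha y) (Hb y).
  apply: (@cvg_of_rate _ _ C (L * `|s1 y - s0 y|)) => n Hn.
  by apply: le_trans (CP x v n xv Hn); rewrite lerDl.
apply: (@measurable_fun_cvg _ Y R setT
    (fun n y => (euler_flow (a y) (b y) (s0 y) (s1 y) n (z y)).2)).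
  by move=> n; exact: (mE n).2.
move=> y _; have [x [v [xv -> ->]]] := sol y.
have [C CP] := euler_flow_error (s0 y) (s1 y) L0 (Ha y) (Hb y).
apply: (@cvg_of_rate _ _ C (L * `|s1 y - s0 y|)) => n Hn.
by apply: le_trans (CP x v n xv Hn); rewrite lerDr.
Qed.

Lemma bounded_lipschitz_continuous (L M : R) (a : R -> R -> R) s :
  bounded_lipschitz L M a -> continuous (a s).
Proof.
move=> [_ La]; apply: (@lipschitz_continuous_R _ _ L) => z z'.
by apply: le_trans (La _ _ _ _) _; rewrite subrr normr0 add0r.
Qed.

Lemma measurable_planeP (S : T * T -> R * R) :
  measurable_fun setT (fun z : T * T => (S z).1 : R) ->
  measurable_fun setT (fun z : T * T => (S z).2 : R) ->
  measurable_fun setT (S : T * T -> T * T).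
Proof.
by move=> m1 m2; apply/measurable_fun_pairP; split.
Qed.

Lemma rectangle_squeeze (m p q : R) : 0 < p -> 0 < q ->
  (forall e, 0 < e -> 2 * e <= p -> 2 * e <= q ->
    (p - 2 * e) * (q - 2 * e) <= m <= (p + 2 * e) * (q + 2 * e)) -> m = p * q.
Proof.
move=> p0 q0 H; apply/eqP; rewrite eq_le; apply/andP.
have H' e : 0 < e -> e <= 1 -> 2 * e <= p -> 2 * e <= q -> `|m - p * q| <= (2 * p + 2 * q + 4) * e.
  move=> e0 e1 ep eq_; have /andP[h1 h2] := H e e0 ep eq_.
  by rewrite ler_norml; apply/andP; split; nra.
suff : `|m - p * q| <= 0.
  by rewrite normr_le0 subr_eq0 => /eqP ->; rewrite lexx.
rewrite leNgt; apply/negP => d0.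
pose c := 2 * p + 2 * q + 4; have c0 : 0 < c by rewrite /c; lra.
pose e := Num.min (Num.min 1 (p / 2)) (Num.min (q / 2) (`|m - p * q| / (2 * c))).
have e0 : 0 < e.
  by rewrite !lt_min ltr01 !divr_gt0// mulr_gt0.
have : e <= e by []. rewrite {2}/e !le_min => /andP[/andP[e1 ep] /andP[eq_ em]].
have h : `|m - p * q| <= c * e by apply: H' => //; lra.
move: em; rewrite ler_pdivlMr ?mulr_gt0//; lra.
Qed.

(** Euler maps preserve area and converge to S uniformly on the whole plane. Hence
    the preimage of a rectangle under S lies between the preimages, under an Euler
    map, of a slightly smaller and of a slightly larger rectangle, and has the area
    of the rectangle; areas of rectangles determine the measure. *)
Theorem flow_preserving (L M : R) (a b : R -> R -> R) (s0 s1 : R) (S : R * R -> R * R) :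
  0 <= L -> bounded_lipschitz L M a -> bounded_lipschitz L M b ->
  (forall z, exists x v, [/\ solves a b x v,
     z = (x s0, v s0) & S z = (x s1, v s1)]) ->
  measure_preserving leb2 (S : T * T -> T * T).
Proof.
move=> L0 Ha Hb sol.
have mS : measurable_fun setT (S : T * T -> T * T).
  have [m1 m2] : measurable_fun setT (fun y : T * T => (S y).1 : R) /\
      measurable_fun setT (fun y : T * T => (S y).2 : R).
    apply: (@measurable_flow _ (T * T)%type L M (fun=> a) (fun=> b) (fun=> s0) (fun=> s1) id S) => //.
    - by move=> r mr; apply: (bounded_lipschitz_measurable Ha) => //;
        exact: (measurableT_comp mr).
    - by move=> r mr; apply: (bounded_lipschitz_measurable Hb) => //;
        exact: (measurableT_comp mr).
    - exact: (@measurable_fst _ _ T T).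
    - exact: (@measurable_snd _ _ T T).
  exact: (measurable_planeP m1 m2).
split=> // A mA.
apply: (@lebesgue2_unique R (pushforward leb2 (S : T * T -> T * T))) => //.
move=> a1 b1 c1 d1 ab cd.
have [C CP] := euler_flow_error s0 s1 L0 Ha Hb.
have mQ : measurable ((S : T * T -> T * T) @^-1` rectangle a1 b1 c1 d1).
  by apply: measurable_preimage => //; exact: measurable_rectangle.

have close (e : R) : 0 < e -> exists n, forall z : R * R,
    `|(S z).1 - (euler_flow a b s0 s1 n z).1| <= e /\
    `|(S z).2 - (euler_flow a b s0 s1 n z).2| <= e.
  move=> e0; pose n := Num.truncn (L * `|s1 - s0| + `|C| / e).
  have nP : L * `|s1 - s0| + `|C| / e < n.+1%:R by exact: truncnS_gt.
  have c0 : 0 <= `|C| / e by rewrite divr_ge0// ltW.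
  have l0 : 0 <= L * `|s1 - s0| by rewrite mulr_ge0.
  exists n => z; have [x [v [xv zE SE]]] := sol z.
  have [-> ->] : (S z).1 = x s1 /\ (S z).2 = v s1 by rewrite SE.
  rewrite zE.
  have : C / n.+1%:R <= e.
    rewrite ler_pdivrMr ?ltr0n//; apply: le_trans (ler_norm _) _.
    by rewrite mulrC -ler_pdivrMr//; lra.
  have : L * `|s1 - s0| <= n.+1%:R by lra.
  move=> /(CP x v n xv); move: (normr_ge0 (x s1 - (euler_flow a b s0 s1 n (x s0, v s0)).1)).
  move: (normr_ge0 (v s1 - (euler_flow a b s0 s1 n (x s0, v s0)).2)).
  move=> P1 P2 P3 P4; split; apply: (le_trans _ P4); apply: (le_trans _ P3).
    by rewrite lerDl.
  by rewrite lerDr.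
have pE n : measure_preserving leb2 (euler_flow a b s0 s1 n : T * T -> T * T).
  by apply: euler_preserving => k; apply: bounded_lipschitz_continuous; [exact: Ha|exact: Hb].
have bnd (e : R) : 0 < e -> 2 * e <= b1 - a1 -> 2 * e <= d1 - c1 ->
  (((b1 - a1 - 2 * e) * (d1 - c1 - 2 * e))%:E <= leb2 (S @^-1` rectangle a1 b1 c1 d1))%E /\
  (leb2 (S @^-1` rectangle a1 b1 c1 d1) <= ((b1 - a1 + 2 * e) * (d1 - c1 + 2 * e))%:E)%E.
  move=> e0 ep eq_; have [n nP] := close e e0.
  have [mEn pEn] := pE n.
  split.
    rewrite (_ : (_ * _) = (b1 - e - (a1 + e)) * (d1 - e - (c1 + e))); last by ring.
    rewrite -lebesgue2_rectangle; [|lra|lra].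
    rewrite -(pEn _ (measurable_rectangle _ _ _ _)); apply: le_measure; rewrite ?inE//.
      by apply: measurable_preimage => //; exact: measurable_rectangle.
    move=> z /rectangleP[h3 h4]; apply/rectangleP.
    by have [] := nP z; rewrite !ler_norml; lra.
  rewrite (_ : (_ * _) = (b1 + e - (a1 - e)) * (d1 + e - (c1 - e))); last by ring.
  rewrite -lebesgue2_rectangle; [|lra|lra].
  rewrite -(pEn _ (measurable_rectangle _ _ _ _)); apply: le_measure; rewrite ?inE//.
    by apply: measurable_preimage => //; exact: measurable_rectangle.
  move=> z /rectangleP[h3 h4]; apply/rectangleP.
  by have [] := nP z; rewrite !ler_norml; lra.
rewrite /= -[LHS]/(leb2 (S @^-1` rectangle a1 b1 c1 d1)).
(* finiteness comes from the upper bound, for one admissible e *)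
have fin : leb2 (S @^-1` rectangle a1 b1 c1 d1) \is a fin_num.
  pose e := Num.min ((b1 - a1) / 2) ((d1 - c1) / 2).
  have e0 : 0 < e by rewrite lt_min !divr_gt0 ?subr_gt0.
  have : e <= e by []. rewrite {2}/e le_min => /andP[e1 e2].
  have [_ h] := bnd e e0 ltac:(lra) ltac:(lra).
  by rewrite ge0_fin_numE ?measure_ge0//; apply: le_lt_trans h (ltry _).
rewrite -(fineK fin); congr (_%:E).
apply: rectangle_squeeze; rewrite ?subr_gt0// => e e0 ep eq_.
by have [] := bnd e e0 ep eq_; rewrite -(fineK fin) !lee_fin => -> ->.
Qed.

End flow_maps.

(** * The restoring force, its potential, and clipping *)

Section restoring_force.
Context {R : realType}.
Variable alpha : R.
Hypothesis alpha3 : 3 <= alpha.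

Definition force (x : R) : R := `|x| `^ (alpha - 1) * x.
Definition potential (x : R) : R := force x * x / (alpha + 1).
Definition energy (z : R * R) : R := z.2 ^+ 2 / 2 + potential z.1.

Lemma forceN x : force (- x) = - force x.
Proof. by rewrite /force normrN mulrN. Qed.

Lemma potentialN x : potential (- x) = potential x.
Proof. by rewrite /potential forceN mulrNN. Qed.

Lemma force0 : force 0 = 0. Proof. by rewrite /force mulr0. Qed.

Lemma norm_force x : `|force x| = `|x| `^ alpha.
Proof.
move: (alpha3) => a3.
by rewrite /force normrM ger0_norm ?powR_ge0// mulrC mulr_powRB1//; lra.
Qed.

Lemma force_mul x : force x * x = `|x| `^ (alpha + 1).
Proof.
move: (alpha3) => a3.
have a0 : 0 < alpha by lra.
have a1 : 0 < alpha + 1 by lra.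
have e2 : `|x| * `|x| `^ alpha = `|x| `^ (alpha + 1).
  by rewrite -(mulr_powRB1 (normr_ge0 x) a1) addrK.
rewrite /force -e2 -(mulr_powRB1 (normr_ge0 x) a0) -mulrA -expr2.
by rewrite -(real_normK (num_real x)); ring.
Qed.

Lemma force_mul_ge0 x : 0 <= force x * x.
Proof. by rewrite force_mul powR_ge0. Qed.

Lemma potential_ge0 x : 0 <= potential x.
Proof. by move: (alpha3) => a3; rewrite divr_ge0 ?force_mul_ge0//; lra. Qed.

Lemma der_force (x : R) : is_derive x 1 force (alpha * `|x| `^ (alpha - 1)).
Proof.
move: (alpha3) => a3.
have pos (y : R) : 0 < y -> is_derive y 1 force (alpha * `|y| `^ (alpha - 1)).
  move=> y0.
  have d1 := derM (is_derive1_powR (alpha - 1) y0) (der_id y).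
  have : is_derive y 1 (fun s : R => s `^ (alpha - 1) * s) (alpha * `|y| `^ (alpha - 1)).
    apply: der_eq d1 _; rewrite (gtr0_norm y0) mulr1 -mulrA [_ * y]mulrC.
    by rewrite mulr_powRB1 ?(ltW y0)//; [ring|lra].
  move=> d; apply: der_near d _; near=> s; rewrite /force gtr0_norm//.
  by near: s; exact: lt_nbhsr.
have [x0|x0|<-] := ltgtP 0 x; first exact: pos.
  have nx0 : 0 < - x by rewrite oppr_gt0.
  have d := derN (der_opp (pos _ nx0)).
  rewrite opprK normrN in d.
  apply: der_near d _; near=> s.
  by rewrite forceN opprK.
rewrite normr0 powR0 ?mulr0; last by rewrite subr_eq0 gt_eqF//; lra.
apply/is_derive1_caratheodory; exists (fun z => `|z| `^ (alpha - 1)); split.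
- by move=> z; rewrite force0 !subr0.
- apply/cvgrPdist_le => e e0; near=> z.
  rewrite normr0 powR0; last by rewrite subr_eq0 gt_eqF//; lra.
  rewrite sub0r normrN ger0_norm ?powR_ge0//.
  have z1 : `|z| <= Num.min 1 e.
    have : `|0 - z| < Num.min 1 e.
      by near: z; apply: (@nbhsx_ballx _ R^o); rewrite lt_min ltr01.
    by rewrite sub0r normrN => /ltW.
  have [->|z0] := eqVneq z 0.
    by rewrite normr0 powR0 ?(ltW e0)// subr_eq0 gt_eqF//; lra.
  move: z1; rewrite le_min => /andP[z1 ze].
  by apply: le_trans ze; apply: ge1r_powR; [rewrite normr_gt0 z0|lra].
- by rewrite normr0 powR0// subr_eq0 gt_eqF//; lra.
Unshelve. all: by end_near. Qed.

Lemma continuous_force : continuous force.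
Proof. by move=> x; exact: der_continuous (der_force x). Qed.

Lemma der_potential (x : R) : is_derive x 1 potential (force x).
Proof.
move: (alpha3) => a3.
have d := derZ (alpha + 1)^-1 (derM (der_force x) (der_id x)).
have -> : potential = (fun s => (alpha + 1)^-1 * (force s * s)).
  by apply/funext => s; rewrite /potential mulrC.
apply: der_eq d _; rewrite -mulrA -/(force x) mulr1.
have : alpha + 1 != 0 by rewrite gt_eqF//; lra.
by move=> h; field.
Qed.

Lemma force_lipschitz (K x y : R) : `|x| <= K -> `|y| <= K ->
  `|force x - force y| <= alpha * K `^ (alpha - 1) * `|x - y|.
Proof.
move: (alpha3) => a3.
move=> xK yK; apply: (@der_lipschitz _ force (fun x => alpha * `|x| `^ (alpha - 1))).
  by move=> t _; exact: der_force.
move=> t tyx; have tK : `|t| <= K.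
  by move: xK yK tyx; rewrite !ler_norml; have [] := leP y x; lra.
rewrite normrM ger0_norm; last by lra.
rewrite ger0_norm ?powR_ge0// ler_wpM2l//; first by lra.
rewrite ge0_ler_powR ?nnegrE//; first by lra.
exact: le_trans tK.
Qed.

Lemma potential_large (x : R) : 1 <= `|x| -> `|x| / (alpha + 1) <= potential x.
Proof.
move: (alpha3) => a3.
move=> x1; rewrite /potential force_mul ler_pM2r ?invr_gt0; last by lra.
by apply: le1r_powR => //; lra.
Qed.

Lemma potential_mono (x y : R) : `|x| <= `|y| -> potential x <= potential y.
Proof.
move: (alpha3) => a3.
move=> xy; rewrite /potential !force_mul ler_pM2r ?invr_gt0; last by lra.
by rewrite ge0_ler_powR ?nnegrE//; lra.
Qed.

Lemma energy_ge0 z : 0 <= energy z.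
Proof. by rewrite addr_ge0 ?potential_ge0// divr_ge0// sqr_ge0. Qed.

(** Where |x| >= 1 the potential is at least |x| / (alpha + 1). *)
Lemma energy_box (B K : R) (z : R * R) : 0 <= B -> (alpha + 1) * (B + 1) <= K ->
  energy z <= B -> `|z.1| < K /\ `|z.2| < K.
Proof.
move: (alpha3) => a3.
move=> B0 BK; rewrite /energy => zB.
have K1 : 1 <= K by apply: le_trans BK; nra.
have a0 : 0 < alpha + 1 by lra.
split; rewrite ltNge; apply/negP => zK.
  have := potential_large (le_trans K1 zK); rewrite ler_pdivrMr//.
  by have := sqr_ge0 z.2; nra.
have : K ^+ 2 <= z.2 ^+ 2 by rewrite -(real_normK (num_real z.2)) lerXn2r ?nnegrE//; lra.
have := potential_ge0 z.1; nra.
Qed.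

Definition clip (K x : R) : R := Num.max (- K) (Num.min K x).

Lemma clip_id (K x : R) : `|x| <= K -> clip K x = x.
Proof.
by rewrite ler_norml /clip => /andP[xK Kx]; rewrite min_r// max_r.
Qed.

Lemma clip_norm (K x : R) : 0 <= K -> `|clip K x| <= K.
Proof.
move=> K0; rewrite ler_norml /clip le_max lexx/= ge_max ge_min lexx/= andbT.
by lra.
Qed.

Lemma clip_lipschitz (K x y : R) : 0 <= K -> `|clip K x - clip K y| <= `|x - y|.
Proof.
move=> K0; have := ler_norm (x - y); have := ler_norm (- (x - y)); rewrite normrN.
rewrite ler_norml /clip; have [] := leP K x; have [] := leP K y;
  by have [] := leP (- K) x; have [] := leP (- K) y; have [] := leP (- K) K; lra.
Qed.

Lemma clip_large (K x : R) : 0 <= K -> K <= `|x| -> `|clip K x| = K.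
Proof.
move=> K0; rewrite /clip; have [x0|x0] := leP 0 x.
  rewrite ger0_norm// => Kx; rewrite min_l// max_r ?ger0_norm//; lra.
rewrite ltr0_norm// => Kx; rewrite min_r; last lra.
by rewrite max_l ?normrN ?ger0_norm//; lra.
Qed.

(** The antiderivative of q composed with clip continues Q by straight lines outside
    [-K, K]; as q has the sign of its argument, these lines do not decrease outwards. *)
Lemma clipped_antiderivative (q Q : R -> R) (K : R) : 0 < K -> continuous q ->
  (forall z, 0 <= q z * z) -> (forall z : R, is_derive z 1 Q (q z)) ->
  exists Qk : R -> R, [/\ forall z : R, is_derive z 1 Qk (q (clip K z)),
    forall z, `|z| <= K -> Qk z = Q z & forall z, Q (clip K z) <= Qk z].
Proof.
move=> Kp cq qs dQ; have K0 := ltW Kp.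
have cc : continuous (fun z => q (clip K z)).
  move=> z; apply: continuous_comp; last exact: cq.
  by apply: (@lipschitz_continuous_R _ _ 1) => s t; rewrite mul1r; exact: clip_lipschitz.
have [F [F0 dF]] := continuous_antiderivative 0 cc.
have dFQ (z : R) : is_derive z 1 (fun s => F s + Q 0) (q (clip K z)).
  by apply: der_eq (derD (dF z) (der_cst _ _)) _; rewrite addr0.
have FQ z : `|z| <= K -> F z + Q 0 = Q z.
  move=> zK; apply/eqP; rewrite -subr_eq0 -normr_le0.
  have := @der_lipschitz R (fun s => F s + Q 0 - Q s) (fun s => q (clip K s) - q s) 0 0 z
    (fun t _ => derB (dFQ t) (dQ t)).
  rewrite mul0r F0 add0r subrr subr0; apply => t tz.
  rewrite clip_id ?subrr ?normr0//.
  by move: zK tz; rewrite !ler_norml; have [] := leP 0 z; lra.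
exists (fun s => F s + Q 0); split=> // z.
have [zK|Kz] := leP `|z| K; first by rewrite clip_id ?FQ.
have cE : `|clip K z| <= K by exact: clip_norm.
rewrite -(FQ _ cE).
have [z0|z0] := leP 0 z.
  move: Kz; rewrite ger0_norm// => Kz.
  have -> : clip K z = K by rewrite /clip min_l ?max_r//; lra.
  apply: (@der_ge0_le _ (fun s => F s + Q 0) (fun s => q (clip K s)) _ _ (ltW Kz) (fun t _ => dFQ t)) => t /andP[Kt _].
  have -> : clip K t = K by rewrite /clip min_l ?max_r//; lra.
  by have := qs K; rewrite pmulr_lge0.
move: Kz; rewrite ltr0_norm// => Kz.
have ck t : t <= - K -> clip K t = - K by move=> tK; rewrite /clip min_r ?max_l//; lra.
rewrite (ck z); last by lra.
rewrite -lerN2.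
apply: (@der_ge0_le _ (fun s => - (F s + Q 0)) (fun s => - q (clip K s)) z (- K) _
  (fun t _ => derN (dFQ t))); first lra.
move=> t /andP[_ tK]; rewrite ck// oppr_ge0.
by have := qs (- K); rewrite nmulr_lge0// oppr_lt0.
Qed.

End restoring_force.

(** * Global solutions of the Duffing equation *)

Section duffing_dynamics.
Context {R : realType}.
Variable alpha : R.
Hypothesis alpha3 : 3 <= alpha.
Implicit Types (f x v y w : R -> R) (s t P L K B : R).

(** All constants below depend on the forcing through P and L only; for the
    quasi-periodic forcing this makes them uniform in the phase. *)
Definition tame (P L : R) f :=
  (forall t, `|f t| <= P) /\ (forall s t, `|f s - f t| <= L * `|s - t|).

Definition dsol f x v := forall t : R,
  is_derive t 1 x (v t) /\ is_derive t 1 v (f t - force alpha (x t)).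

Lemma tame_bound_ge0 P L f : tame P L f -> 0 <= P.
Proof. by move=> [h _]; exact: le_trans (h 0). Qed.

Lemma tame_lipschitz_ge0 P L f : tame P L f -> 0 <= L.
Proof.
move=> [_ h]; have := h 1 0; rewrite subr0 normr1 mulr1; exact: le_trans.
Qed.

Lemma energy_gronwall P (u du : R -> R) (s t : R) :
  (forall r, Num.min s t <= r <= Num.max s t -> is_derive r 1 u (du r)) ->
  (forall r, Num.min s t <= r <= Num.max s t -> `|du r| <= u r + P ^+ 2 / 2) ->
  u t + P ^+ 2 / 2 <= (u s + P ^+ 2 / 2) * expR `|t - s|.
Proof.
move=> hd hu; rewrite -[X in expR X]mul1r.
apply: (@gronwall R (fun r => u r + P ^+ 2 / 2) du) => r rst.
  by apply: der_eq (derD (hd r rst) (der_cst _ _)) _; rewrite addr0.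
by rewrite mul1r; exact: hu.
Qed.

Lemma power_bound (p q P : R) : `|p| <= P -> `|q * p| <= q ^+ 2 / 2 + P ^+ 2 / 2.
Proof.
move=> pP; rewrite normrM -(real_normK (num_real q)).
have := sqr_ge0 (`|q| - P); have := normr_ge0 q; have := normr_ge0 p; nra.
Qed.

(** The derivative of the energy E is v f, which is at most E + P ^ 2 / 2 in absolute
    value. *)
Lemma dsol_energy P L f x v s t : tame P L f -> dsol f x v ->
  energy alpha (x t, v t) + P ^+ 2 / 2 <=
  (energy alpha (x s, v s) + P ^+ 2 / 2) * expR `|t - s|.
Proof.
move=> [fP _] xv.
apply: (@energy_gronwall P (fun r => energy alpha (x r, v r)) (fun r => v r * f r)) => r _.
  have [dx dv] := xv r.
  have d1 := derZ 2^-1 (der_sqr dv).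
  have d2 := der_comp dx (der_potential alpha3 (x r)).
  have -> : (fun r => energy alpha (x r, v r)) =
      (fun r => 2^-1 * v r ^+ 2 + potential alpha (x r)).
    by apply/funext => r'; rewrite /energy/= mulrC.
  by apply: der_eq (derD d1 d2) _; field.
apply: le_trans (power_bound _ (fP r)) _.
by rewrite lerD2r /energy/= lerDl; exact: potential_ge0.
Qed.

(** Clipping velocity and position at K turns the equation into a system with
    bounded Lipschitz fields, unchanged inside the square of size K. *)
Definition clipped_velocity (K : R) : R -> R -> R := fun _ z => clip K z.
Definition clipped_force f (K : R) : R -> R -> R :=
  fun s z => f s - force alpha (clip K z).

Definition clip_lip (L K : R) := 1 + L + alpha * K `^ (alpha - 1).
Definition clip_bound (P K : R) := K + P + alpha * K `^ (alpha - 1) * K.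

Lemma clip_lip_gt0 L K : 0 <= L -> 0 < clip_lip L K.
Proof.
move: (alpha3) => a3 L0; rewrite /clip_lip.
have : 0 <= alpha * K `^ (alpha - 1) by rewrite mulr_ge0 ?powR_ge0//; lra.
by lra.
Qed.

Lemma clipped_velocity_lipschitz P L f K : tame P L f -> 0 <= K ->
  bounded_lipschitz (clip_lip L K) (clip_bound P K) (clipped_velocity K).
Proof.
move: (alpha3) => a3 tf K0; have P0 := tame_bound_ge0 tf; have L0 := tame_lipschitz_ge0 tf.
have c0 : 0 <= alpha * K `^ (alpha - 1) by rewrite mulr_ge0 ?powR_ge0//; lra.
split=> [s z|s s' z z'].
  apply: le_trans (clip_norm _ K0) _; rewrite /clip_bound.
  have : 0 <= alpha * K `^ (alpha - 1) * K by rewrite mulr_ge0.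
  by lra.
apply: le_trans (clip_lipschitz _ _ K0) _; rewrite /clip_lip.
have := normr_ge0 (s - s'); have := normr_ge0 (z - z'); nra.
Qed.

Lemma clipped_force_lipschitz P L f K : tame P L f -> 0 <= K ->
  bounded_lipschitz (clip_lip L K) (clip_bound P K) (clipped_force f K).
Proof.
move: (alpha3) => a3 tf K0; have P0 := tame_bound_ge0 tf; have L0 := tame_lipschitz_ge0 tf.
have [fP fL] := tf.
have c0 : 0 <= alpha * K `^ (alpha - 1) by rewrite mulr_ge0 ?powR_ge0//; lra.
have fo (p q : R) : `|force alpha (clip K p) - force alpha (clip K q)| <=
    alpha * K `^ (alpha - 1) * `|clip K p - clip K q|.
  by apply: force_lipschitz => //; exact: clip_norm.
split=> [s z|s s' z z'].
  apply: le_trans (ler_normB _ _) _; rewrite /clip_bound.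
  have := fo z 0; rewrite (_ : clip K 0 = 0); last by rewrite clip_id ?normr0.
  rewrite force0 !subr0; have := clip_norm z K0; have := fP s.
  move: (`|f s|) (`|clip K z|) (`|force _ _|) (alpha * _) c0 => a b c e e0.
  by nra.
have -> : clipped_force f K s z - clipped_force f K s' z' =
    (f s - f s') - (force alpha (clip K z) - force alpha (clip K z')).
  by rewrite /clipped_force; ring.
apply: le_trans (ler_normB _ _) _; rewrite /clip_lip.
have := fL s s'; have := fo z z'; have := clip_lipschitz z z' K0.
have := normr_ge0 (s - s'); have := normr_ge0 (z - z').
move: (`|f s - _|) (`|clip K z - _|) (`|force _ _ - _|) (`|s - s'|) (`|z - z'|) (alpha * _) c0.
move=> a b c d e g g0 e0 d0 be cb ad.
have : g * b <= g * e by rewrite ler_wpM2l.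
by nra.
Qed.

(** The clipped system has an energy of its own, made of the antiderivatives of the
    clipped terms, which grows at most exponentially like that of the equation. It
    coincides with the energy inside the square and everywhere dominates the energy
    of the clipped state. *)
Lemma clipped_energy P L f K x v s t : tame P L f -> 0 < K ->
  solves (clipped_velocity K) (clipped_force f K) x v ->
  `|x s| <= K -> `|v s| <= K ->
  energy alpha (clip K (x t), clip K (v t)) + P ^+ 2 / 2 <=
  (energy alpha (x s, v s) + P ^+ 2 / 2) * expR `|t - s|.
Proof.
move=> [fP _] K0 xv xs vs.
have [||A [dA Aeq Age]] := @clipped_antiderivative R id (fun z => 2^-1 * z ^+ 2) K K0 (fun z => cvg_id).
- by move=> z; rewrite -expr2 sqr_ge0.
- by move=> z; apply: der_eq (derZ 2^-1 (der_sqr (der_id z))) _; field.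
have [V [dV Veq Vge]] := @clipped_antiderivative R _ _ K K0
  (continuous_force alpha3) (force_mul_ge0 alpha3) (der_potential alpha3).
have := @energy_gronwall P (fun r => A (v r) + V (x r)) (fun r => clip K (v r) * f r) s t.
rewrite (Aeq _ vs) (Veq _ xs) => h.
have -> : energy alpha (x s, v s) = 2^-1 * v s ^+ 2 + potential alpha (x s).
  by rewrite /energy/= mulrC.
apply: le_trans (h _ _).
- rewrite lerD2r /energy/=; apply: lerD; last exact: Vge.
  by apply: le_trans (Age _); rewrite mulrC.
- move=> r _; have [dx dv] := xv r.
  apply: der_eq (derD (der_comp dv (dA (v r))) (der_comp dx (dV (x r)))) _.
  by rewrite /clipped_force /clipped_velocity; ring.
- move=> r _; apply: le_trans (power_bound _ (fP r)) _.
  rewrite lerD2r; have := Age (v r); have := Vge (x r).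
  by have := potential_ge0 alpha3 (clip K (x r)); lra.
Qed.

(** Outside the square the clipped state lies on its boundary, where the energy is
    above B. *)
Lemma clipped_stays P L f K B x v s t : tame P L f ->
  solves (clipped_velocity K) (clipped_force f K) x v ->
  (energy alpha (x s, v s) + P ^+ 2 / 2) * expR `|t - s| <= B ->
  (alpha + 1) * (B + 1) <= K -> `|x s| <= K -> `|v s| <= K ->
  `|x t| < K /\ `|v t| < K.
Proof.
move: (alpha3) => a3 tf xv EB BK xs vs.
have E0 := energy_ge0 alpha3 (x s, v s).
have B0 : 0 <= B.
  by apply: le_trans EB; rewrite mulr_ge0 ?expR_ge0// addr_ge0// divr_ge0// sqr_ge0.
have K0 : 0 < K by apply: lt_le_trans BK; nra.
have := clipped_energy t tf K0 xv xs vs => h.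
have EcB : energy alpha (clip K (x t), clip K (v t)) <= B.
  apply: le_trans EB; apply: le_trans h.
  by rewrite lerDl divr_ge0// sqr_ge0.
have [/= h1 h2] := energy_box alpha3 B0 BK EcB.
by split; rewrite ltNge; apply/negP => hK; [move: h1|move: h2];
  rewrite clip_large ?ltxx// ltW.
Qed.

Lemma dsol_stays P L f B K x v s t : tame P L f -> dsol f x v ->
  (energy alpha (x s, v s) + P ^+ 2 / 2) * expR `|t - s| <= B ->
  (alpha + 1) * (B + 1) <= K -> `|x t| < K /\ `|v t| < K.
Proof.
move=> tf xv EB BK; have E0 := energy_ge0 alpha3 (x s, v s).
have B0 : 0 <= B.
  by apply: le_trans EB; rewrite mulr_ge0 ?expR_ge0// addr_ge0// divr_ge0// sqr_ge0.
apply: (energy_box (z := (x t, v t)) alpha3 B0 BK).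
apply: le_trans EB; apply: le_trans (dsol_energy s t tf xv).
by rewrite lerDl divr_ge0// sqr_ge0.
Qed.

Lemma duffing_unique_interval f K x v y w s t :
  (forall r, Num.min s t <= r <= Num.max s t ->
    [/\ is_derive r 1 x (v r), is_derive r 1 v (f r - force alpha (x r)) & `|x r| <= K]) ->
  (forall r, Num.min s t <= r <= Num.max s t ->
    [/\ is_derive r 1 y (w r), is_derive r 1 w (f r - force alpha (y r)) & `|y r| <= K]) ->
  x s = y s -> v s = w s -> x t = y t /\ v t = w t.
Proof.
move: (alpha3) => a3 Hx Hy xy vw.
have c0 : 0 <= alpha * K `^ (alpha - 1) by rewrite mulr_ge0 ?powR_ge0//; lra.
pose C := 1 + alpha * K `^ (alpha - 1).
have C0 : 0 <= C by rewrite /C; lra.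
have := @lipschitz_dependence R x v y w v (fun r => f r - force alpha (x r))
  w (fun r => f r - force alpha (y r)) C s t C0.
rewrite xy vw !subrr expr0n/= addr0 mul0r => h.
have : (x t - y t) ^+ 2 + (v t - w t) ^+ 2 <= 0.
  apply: h => r rst; have [? ? xK] := Hx r rst; have [? ? yK] := Hy r rst => //.
  split; first by rewrite ler_peMl// /C; lra.
  rewrite (_ : _ - _ = - (force alpha (x r) - force alpha (y r))); last by ring.
  rewrite normrN; apply: le_trans (force_lipschitz alpha3 xK yK) _.
  by rewrite ler_wpM2r// /C; lra.
have := sqr_ge0 (x t - y t); have := sqr_ge0 (v t - w t) => h1 h2 h3.
have /eqP : (x t - y t) ^+ 2 = 0 by lra.
have /eqP : (v t - w t) ^+ 2 = 0 by lra.
by rewrite !sqrf_eq0 !subr_eq0 => /eqP-> /eqP->.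
Qed.

Lemma between_le s t r : Num.min s t <= r <= Num.max s t -> `|r - s| <= `|t - s|.
Proof.
have := ler_norm (t - s); have := ler_norm (- (t - s)); rewrite normrN ler_norml.
by have [h0|h0] := leP s t; lra.
Qed.

Lemma dsol_unique P L f x v y w s : tame P L f -> dsol f x v -> dsol f y w ->
  x s = y s -> v s = w s -> x = y /\ v = w.
Proof.
move=> tf xv yw xy vw.
suff H t : x t = y t /\ v t = w t by split; apply/funext => t; case: (H t).
pose B := (energy alpha (x s, v s) + P ^+ 2 / 2) * expR `|t - s|.
have le r : Num.min s t <= r <= Num.max s t ->
    (energy alpha (x s, v s) + P ^+ 2 / 2) * expR `|r - s| <= B.
  move=> /between_le rs; rewrite ler_wpM2l ?ler_expR//.
  by rewrite addr_ge0 ?energy_ge0// divr_ge0// sqr_ge0.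
apply: (@duffing_unique_interval f ((alpha + 1) * (B + 1)) x v y w s t) => // r rst.
  have [? ?] := xv r; have [/ltW ? _] := dsol_stays tf xv (le r rst) (lexx _).
  by split.
have [? ?] := yw r; have := le r rst; rewrite xy vw => ler.
have [/ltW ? _] := dsol_stays tf yw ler (lexx _).
by split.
Qed.

Lemma clipped_dsol f K x v r : solves (clipped_velocity K) (clipped_force f K) x v ->
  `|x r| <= K -> `|v r| <= K ->
  is_derive r 1 x (v r) /\ is_derive r 1 v (f r - force alpha (x r)).
Proof.
move=> xv xK vK; have [dx dv] := xv r; rewrite /clipped_velocity in dx.
by rewrite /clipped_force (clip_id xK) in dv; rewrite (clip_id vK) in dx.
Qed.

(** At distance at most n from the initial time, the solution of the system clipped
    at K n stays in the square and solves the equation. Solutions for different n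
    agree where both solve it, and are glued. *)
Theorem dsol_exists P L f (s x0 v0 : R) : tame P L f ->
  exists x v, [/\ dsol f x v, x s = x0 & v s = v0].
Proof.
move: (alpha3) => a3 tf.
pose B (n : nat) := (energy alpha (x0, v0) + P ^+ 2 / 2) * expR n%:R.
pose K n := (alpha + 1) * (B n + 1).
have E0 : 0 <= energy alpha (x0, v0) + P ^+ 2 / 2.
  by rewrite addr_ge0 ?energy_ge0// divr_ge0// sqr_ge0.
have Bmono m n : (m <= n)%N -> B m <= B n.
  by move=> mn; rewrite ler_wpM2l// ler_expR ler_nat.
have K0 n : 0 <= K n.
  by rewrite /K mulr_ge0//; [lra|]; rewrite addr_ge0// mulr_ge0 ?expR_ge0.
have BE n : energy alpha (x0, v0) <= B n.
  apply: le_trans (_ : B 0%N <= _); last exact: Bmono.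
  by rewrite /B expR0 mulr1 lerDl divr_ge0// sqr_ge0.
have B0 n : 0 <= B n by apply: le_trans (BE n); exact: energy_ge0.
have zK n : `|x0| < K n /\ `|v0| < K n.
  exact: (energy_box alpha3 (z := (x0, v0)) (B0 n) (lexx _) (BE n)).
have /choice[X XP] : forall n, exists xv : (R -> R) * (R -> R),
    [/\ solves (clipped_velocity (K n)) (clipped_force f (K n)) xv.1 xv.2,
      xv.1 s = x0 & xv.2 s = v0].
  move=> n; have [x [v xv]] := @picard_existence R _ _ _ _ s x0 v0
    (clip_lip_gt0 (K n) (tame_lipschitz_ge0 tf))
    (clipped_velocity_lipschitz tf (K0 n)) (clipped_force_lipschitz tf (K0 n)).
  by exists (x, v).
have stay n m t : (n <= m)%N -> `|t - s| < n%:R ->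
    `|(X n).1 t| < K m /\ `|(X n).2 t| < K m.
  move=> nm tn; have [sol xs vs] := XP n.
  have KK : K n <= K m by rewrite /K ler_wpM2l ?lerD2r ?Bmono//; lra.
  have [||||h1 h2] := @clipped_stays P L f (K n) (B n) (X n).1 (X n).2 s t tf sol.
  - by rewrite xs vs /B ler_wpM2l// ler_expR ltW.
  - by [].
  - by rewrite xs ltW//; case: (zK n).
  - by rewrite vs ltW//; case: (zK n).
  - by split; [exact: lt_le_trans h1 KK|exact: lt_le_trans h2 KK].
have ode n t : `|t - s| < n%:R ->
    is_derive t 1 (X n).1 ((X n).2 t) /\
    is_derive t 1 (X n).2 (f t - force alpha ((X n).1 t)).
  move=> tn; have [h1 h2] := stay n n t (leqnn _) tn; have [sol _ _] := XP n.
  by apply: (clipped_dsol sol); exact: ltW.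
have agree n m t : (n <= m)%N -> `|t - s| < n%:R ->
    (X n).1 t = (X m).1 t /\ (X n).2 t = (X m).2 t.
  move=> nm tn; have [_ xs vs] := XP n; have [_ xs' vs'] := XP m.
  have nmR : n%:R <= m%:R :> R by rewrite ler_nat.
  apply: (@duffing_unique_interval f (K m) _ _ _ _ s t); rewrite ?xs ?xs' ?vs ?vs'//.
    move=> r /between_le rs; have rn := le_lt_trans rs tn.
    by have [? ?] := ode n r rn; have [/ltW ? _] := stay n m r nm rn.
  move=> r /between_le rs; have rn := lt_le_trans (le_lt_trans rs tn) nmR.
  by have [? ?] := ode m r rn; have [/ltW ? _] := stay m m r (leqnn _) rn.
have [x xP] := @glue R s (fun n => (X n).1) (fun n m t nm tn => (agree n m t nm tn).1).
have [v vP] := @glue R s (fun n => (X n).2) (fun n m t nm tn => (agree n m t nm tn).2).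
have s1 : `|s - s| < 1%:R by rewrite subrr normr0.
exists x, v; split; last first.
- by rewrite (vP 1%N)//; case: (XP 1%N).
- by rewrite (xP 1%N)//; case: (XP 1%N).
move=> t; pose n := (Num.truncn `|t - s|).+1.
have tn : `|t - s| < n%:R by exact: truncnS_gt.
have [d1 d2] := ode n t tn.
rewrite (xP n)// (vP n)//; split; apply: der_near; first [exact: d1|exact: d2|idtac];
  by apply: filterS (near_ball_nat tn) => r rn; rewrite ?(xP n) ?(vP n).
Qed.

End duffing_dynamics.

(** * The flow of the Duffing equation *)

Section duffing_flow_map.
Context {R : realType}.
Variable alpha : R.
Hypothesis alpha3 : 3 <= alpha.
Variables P L : R.
Local Notation T := (measurableTypeR R).
Local Notation leb := (@lebesgue_measure R).
Local Notation leb2 := (leb \x leb)%E.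
Implicit Types (f x v y w : R -> R) (s t K r : R) (z : R * R).

(** State at time t of the solution whose state at time s is z; the default value of
    xget never occurs for a tame f, by dsol_exists. *)
Definition dflow f s z t : R * R :=
  let xv := xget (cst 0, cst 0)
    [set xv : (R -> R) * (R -> R) | dsol alpha f xv.1 xv.2 /\ z = (xv.1 s, xv.2 s)] in
  (xv.1 t, xv.2 t).

Definition clipped_flow K f s z t : R * R :=
  let xv := xget (cst 0, cst 0)
    [set xv : (R -> R) * (R -> R) |
      solves (clipped_velocity K) (clipped_force alpha f K) xv.1 xv.2 /\
      z = (xv.1 s, xv.2 s)] in
  (xv.1 t, xv.2 t).

Lemma dflow_sol f s z : tame P L f -> exists x v,
  [/\ dsol alpha f x v, z = (x s, v s) & forall t, dflow f s z t = (x t, v t)].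
Proof.
move=> tf; have [x [v [xv xs vs]]] := dsol_exists alpha3 s z.1 z.2 tf.
have ex : [set xv : (R -> R) * (R -> R) | dsol alpha f xv.1 xv.2 /\ z = (xv.1 s, xv.2 s)] (x, v).
  by split=> //=; rewrite xs vs -surjective_pairing.
have [] := @xgetI _ (cst 0, cst 0) _ _ ex.
rewrite -/(dflow f s z); set q := xget _ _ => q1 q2.
by exists q.1, q.2; split.
Qed.

Lemma dflowE f x v s t : tame P L f -> dsol alpha f x v ->
  dflow f s (x s, v s) t = (x t, v t).
Proof.
move=> tf xv; have [y [w [yw [e1 e2] ->]]] := dflow_sol s (x s, v s) tf.
by have [-> ->] := dsol_unique alpha3 tf xv yw e1 e2.
Qed.

Lemma clipped_flow_sol K f s z : tame P L f -> 0 <= K -> exists x v,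
  [/\ solves (clipped_velocity K) (clipped_force alpha f K) x v, z = (x s, v s) &
    forall t, clipped_flow K f s z t = (x t, v t)].
Proof.
move=> tf K0; have [x [v [xv xs vs]]] := picard_existence s z.1 z.2
    (clip_lip_gt0 alpha3 K (tame_lipschitz_ge0 tf))
    (clipped_velocity_lipschitz alpha3 tf K0) (clipped_force_lipschitz alpha3 tf K0).
have ex : [set xv : (R -> R) * (R -> R) |
      solves (clipped_velocity K) (clipped_force alpha f K) xv.1 xv.2 /\
      z = (xv.1 s, xv.2 s)] (x, v).
  by split=> //=; rewrite xs vs -surjective_pairing.
have [] := @xgetI _ (cst 0, cst 0) _ _ ex.
rewrite -/(clipped_flow K f s z); set q := xget _ _ => q1 q2.
by exists q.1, q.2; split.
Qed.

Definition in_box r z := `|z.1| <= r /\ `|z.2| <= r.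

(** Trajectories that meet the box of size r stay for a time t within the box of this
    size, by the exponential bound on the energy and energy_box. *)
Definition reach (t r : R) : R :=
  (alpha + 1) * ((r ^+ 2 / 2 + potential alpha r + P ^+ 2 / 2) * expR t + 1).

Lemma energy_in_box r z : in_box r z -> energy alpha z <= r ^+ 2 / 2 + potential alpha r.
Proof.
move=> [z1 z2]; have r0 : 0 <= r by exact: le_trans z1.
rewrite /energy; apply: lerD; last by apply: potential_mono => //; rewrite (ger0_norm r0).
rewrite ler_pM2r ?invr_gt0// -(real_normK (num_real z.2)).
by rewrite lerXn2r ?nnegrE.
Qed.

Lemma energy_reach (u r s t : R) z : in_box r z -> `|t - s| <= u ->
  (energy alpha z + P ^+ 2 / 2) * expR `|t - s| <=
  (r ^+ 2 / 2 + potential alpha r + P ^+ 2 / 2) * expR u.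
Proof.
move=> zr tu; apply: ler_pM; rewrite ?expR_ge0 ?ler_expR//.
  by rewrite addr_ge0 ?energy_ge0// divr_ge0// sqr_ge0.
by rewrite lerD2r energy_in_box.
Qed.

Lemma dsol_reach u r f x v s t : tame P L f -> dsol alpha f x v ->
  in_box r (x s, v s) -> `|t - s| <= u -> in_box (reach u r) (x t, v t).
Proof.
move=> tf xv xr tu.
have [] := dsol_stays alpha3 tf xv (energy_reach xr tu) (lexx _).
by move=> /ltW ? /ltW ?.
Qed.

Lemma in_box_reach u r z : 0 <= u -> in_box r z -> in_box (reach u r) z.
Proof.
move=> u0 zr; have zE := energy_in_box zr.
set B := (r ^+ 2 / 2 + potential alpha r + P ^+ 2 / 2) * expR u.
have EB : energy alpha z <= B.
  apply: le_trans (_ : r ^+ 2 / 2 + potential alpha r + P ^+ 2 / 2 <= _).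
    by apply: le_trans zE _; rewrite lerDl divr_ge0// sqr_ge0.
  rewrite ler_peMr//; last by rewrite -[leLHS]expR0 ler_expR.
  by rewrite !addr_ge0 ?potential_ge0// divr_ge0// sqr_ge0.
have [|/ltW ? /ltW ?] := energy_box alpha3 _ (lexx _) EB; last by split.
exact: le_trans (energy_ge0 alpha3 _) EB.
Qed.

Lemma clipped_reach u r K f x v s t : tame P L f -> 0 <= u ->
  solves (clipped_velocity K) (clipped_force alpha f K) x v ->
  reach u r <= K -> in_box r (x s, v s) -> `|t - s| <= u ->
  in_box (reach u r) (x t, v t).
Proof.
move=> tf u0 xv rK xr tu.
have [x1 v1] := in_box_reach u0 xr.
set B := (r ^+ 2 / 2 + potential alpha r + P ^+ 2 / 2) * expR u.
have [h1 h2] := clipped_stays alpha3 tf xv (energy_reach xr tu) rK (le_trans x1 rK) (le_trans v1 rK).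
have K0 : 0 < K by exact: le_lt_trans h1.
have := clipped_energy alpha3 t tf K0 xv (le_trans x1 rK) (le_trans v1 rK).
rewrite (clip_id (ltW h1)) (clip_id (ltW h2)) => hE.
have EB : energy alpha (x t, v t) <= B.
  apply: le_trans (energy_reach xr tu); apply: le_trans hE.
  by rewrite lerDl divr_ge0// sqr_ge0.
have [|/ltW ? /ltW ?] := energy_box alpha3 _ (lexx _) EB; last by split.
exact: le_trans (energy_ge0 alpha3 _) EB.
Qed.

(** A true solution that is small at one end of the time interval stays within the
    clipping box in between, and then solves the clipped system as well. It is enough
    to know that either solution is small at the end time: thus a bounded set has the
    same preimage under the flow and under a clipped flow. *)
Lemma clipped_agree u r K f x v y w s t : tame P L f -> 0 <= u ->
  solves (clipped_velocity K) (clipped_force alpha f K) x v -> dsol alpha f y w ->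
  reach u r <= K -> reach u (reach u r) <= K -> `|t - s| <= u ->
  x s = y s -> v s = w s ->
  in_box r (x s, v s) \/ in_box r (x t, v t) \/ in_box r (y t, w t) ->
  x t = y t /\ v t = w t.
Proof.
move=> tf u0 xv yw rK rrK tu xy vw.
have main : (forall q, Num.min s t <= q <= Num.max s t -> in_box K (y q, w q)) ->
    x t = y t /\ v t = w t.
  move=> yK.
  have K0 : 0 <= K.
    have [|h _] := yK s; last exact: le_trans h.
    by have [] := leP s t; lra.
  have C0 := ltW (clip_lip_gt0 alpha3 K (tame_lipschitz_ge0 tf)).
  have := @lipschitz_dependence R x v y w (fun q => clip K (v q))
    (fun q => clipped_force alpha f K q (x q)) (fun q => clip K (w q))
    (fun q => clipped_force alpha f K q (y q)) _ s t C0.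
  rewrite xy vw !subrr expr0n/= addr0 mul0r => h.
  have : (x t - y t) ^+ 2 + (v t - w t) ^+ 2 <= 0.
    apply: h => q qst.
    - by have [? ?] := xv q.
    - have [d1 d2] := yw q; have [/= h1 h2] := yK q qst.
      by rewrite (clip_id h2) /clipped_force (clip_id h1).
    - split.
        have [_ h] := clipped_velocity_lipschitz alpha3 tf K0.
        by apply: le_trans (h q q _ _) _; rewrite subrr normr0 add0r.
      have [_ h] := clipped_force_lipschitz alpha3 tf K0.
      by apply: le_trans (h q q _ _) _; rewrite subrr normr0 add0r.
  have := sqr_ge0 (x t - y t); have := sqr_ge0 (v t - w t) => h1 h2 h3.
  have /eqP : (x t - y t) ^+ 2 = 0 by lra.
  have /eqP : (v t - w t) ^+ 2 = 0 by lra.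
  by rewrite !sqrf_eq0 !subr_eq0 => /eqP-> /eqP->.
have boxle a b z : a <= b -> in_box a z -> in_box b z.
  by move=> ab [h1 h2]; split; [exact: le_trans h1 ab|exact: le_trans h2 ab].
case=> [xr|[xr|yr]]; apply: main => q qst.
- apply: (boxle _ _ _ rK); apply: (dsol_reach tf yw (s := s)); first by rewrite -xy -vw.
  by apply: le_trans tu; exact: between_le.
- apply: (boxle _ _ _ rrK); apply: (dsol_reach tf yw (s := s)).
    rewrite -xy -vw; apply: (clipped_reach tf u0 xv rK xr).
    by rewrite distrC.
  by apply: le_trans tu; exact: between_le.
- apply: (boxle _ _ _ rK); apply: (dsol_reach tf yw yr).
  by apply: le_trans tu; rewrite [leRHS]distrC; apply: between_le;
    rewrite minC maxC.
Qed.

Lemma clipped_flow_agree u r K f s t z : tame P L f -> 0 <= u ->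
  0 <= K -> reach u r <= K -> reach u (reach u r) <= K -> `|t - s| <= u ->
  in_box r z \/ in_box r (clipped_flow K f s z t) \/ in_box r (dflow f s z t) ->
  clipped_flow K f s z t = dflow f s z t.
Proof.
move=> tf u0 K0 rK rrK tu.
have [x [v [xv zE ->]]] := clipped_flow_sol s z tf K0.
have [y [w [yw zE' ->]]] := dflow_sol s z tf.
have [xy vw] : x s = y s /\ v s = w s by move: zE; rewrite zE' => -[].
rewrite {1}zE => h.
by have [-> ->] := clipped_agree tf u0 xv yw rK rrK tu xy vw h.
Qed.

Lemma large_clip u r : exists N : nat, forall n : nat, (N <= n)%N ->
  reach u r <= n%:R /\ reach u (reach u r) <= n%:R.
Proof.
pose m := Num.max (reach u r) (reach u (reach u r)).
exists (Num.truncn `|m|).+1 => n Nn.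
have : m <= n%:R.
  apply: le_trans (ler_norm _) _; apply/ltW.
  by apply: lt_le_trans (truncnS_gt _) _; rewrite ler_nat.
by rewrite ge_max => /andP[].
Qed.

Lemma in_box_exists z : exists r, 0 <= r /\ in_box r z.
Proof.
by exists (`|z.1| + `|z.2|); rewrite addr_ge0//; split=> //; split; rewrite ?lerDl ?lerDr.
Qed.

(** For each y the clipped flows are eventually equal to the flow, and clipped flows
    are flows of bounded Lipschitz systems. *)
Lemma measurable_dflow d (Y : measurableType d) (F : Y -> R -> R) (s0 s1 : Y -> R)
    (z : Y -> R * R) :
  (forall y : Y, tame P L (F y)) ->
  (forall q : Y -> R, measurable_fun setT q -> measurable_fun setT (fun y : Y => F y (q y))) ->
  measurable_fun setT s0 -> measurable_fun setT s1 ->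
  measurable_fun setT (fun y : Y => (z y).1) -> measurable_fun setT (fun y : Y => (z y).2) ->
  measurable_fun setT (fun y : Y => (dflow (F y) (s0 y) (z y) (s1 y)).1) /\
  measurable_fun setT (fun y : Y => (dflow (F y) (s0 y) (z y) (s1 y)).2).
Proof.
move=> tF mF ms0 ms1 mz1 mz2.
have mc n : measurable_fun setT (fun y : Y => (clipped_flow n%:R (F y) (s0 y) (z y) (s1 y)).1) /\
    measurable_fun setT (fun y : Y => (clipped_flow n%:R (F y) (s0 y) (z y) (s1 y)).2).
  have n0 : 0 <= n%:R :> R by [].
  apply: (@measurable_flow R _ Y (clip_lip alpha L n%:R) (clip_bound alpha P n%:R)
    (fun y : Y => clipped_velocity n%:R) (fun y : Y => clipped_force alpha (F y) n%:R) s0 s1 z) => //.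
  - by apply: ltW; apply: clip_lip_gt0 => //; exact: tame_lipschitz_ge0 (tF point).
  - by move=> y; exact: (clipped_velocity_lipschitz alpha3 (tF y) n0).
  - by move=> y; exact: (clipped_force_lipschitz alpha3 (tF y) n0).
  - move=> y; have [x [v [xv zE E]]] := clipped_flow_sol (s0 y) (z y) (tF y) n0.
    by exists x, v.
  - move=> q mq; apply: (measurableT_comp (f := clip n%:R)) => //.
    by apply: continuous_measurable_fun; apply: (@lipschitz_continuous_R _ _ 1) => p p';
      rewrite mul1r; exact: clip_lipschitz.
  - move=> q mq; apply: measurable_funB.
      exact: (measurableT_comp (mF q mq)).
    apply: (measurableT_comp (f := force alpha \o clip n%:R)) => //.
    apply: continuous_measurable_fun => p; apply: continuous_comp; last exact: continuous_force.
    by apply: (@lipschitz_continuous_R _ _ 1) => p1 p2; rewrite mul1r; exact: clip_lipschitz.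
have ev (y : Y) : \forall n \near \oo, clipped_flow n%:R (F y) (s0 y) (z y) (s1 y) =
    dflow (F y) (s0 y) (z y) (s1 y).
  have [r [r0 zr]] := in_box_exists (z y).
  have [N NP] := large_clip `|s1 y - s0 y| r.
  exists N => // n /= /NP[h1 h2].
  by apply: (clipped_flow_agree (r := r) (u := `|s1 y - s0 y|)) => //; left.
split.
  apply: (@measurable_fun_cvg _ Y R setT
    (fun n (y : Y) => (clipped_flow n%:R (F y) (s0 y) (z y) (s1 y)).1)) => [n|y _].
    exact: (mc n).1.
  by apply: cvg_near_cst; apply: filterS (ev y) => n ->.
apply: (@measurable_fun_cvg _ Y R setT
    (fun n (y : Y) => (clipped_flow n%:R (F y) (s0 y) (z y) (s1 y)).2)) => [n|y _].
  exact: (mc n).2.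
by apply: cvg_near_cst; apply: filterS (ev y) => n ->.
Qed.

(** Clipped flows preserve area, and the preimage of a subset of a box under the flow
    is its preimage under a clipped flow. Boxes exhaust the plane. *)
Theorem dflow_preserving f s t : tame P L f ->
  measure_preserving leb2 (fun z : T * T => dflow f s z t : T * T).
Proof.
move=> tf.
have mS : measurable_fun setT (fun z : T * T => dflow f s z t : T * T).
  have [m1 m2] := @measurable_dflow _ (T * T)%type (fun=> f) (fun=> s) (fun=> t) id
    (fun _ => tf) (fun q mq => measurableT_comp (continuous_measurable_fun
      (lipschitz_continuous_R tf.2)) mq) (measurable_cst _) (measurable_cst _)
    (@measurable_fst _ _ T T) (@measurable_snd _ _ T T).
  exact: (measurable_planeP m1 m2).
split=> // A mA.
pose S z := dflow f s z t.
pose box (n : nat) : set (T * T) := rectangle (- n%:R) n%:R (- n%:R) n%:R.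
have boxP n z : box n z -> in_box n%:R z.
  move=> /rectangleP[/andP[/ltW a1 b1] /andP[/ltW a2 b2]].
  by split; rewrite ler_norml ?a1 ?a2.
have bounded n : leb2 ((S : T * T -> T * T) @^-1` (A `&` box n)) = leb2 (A `&` box n).
  pose u := `|t - s|; have u0 : 0 <= u by exact: normr_ge0.
  have [N NP] := large_clip u n%:R; have [h1 h2] := NP N (leqnn N).
  have N0 : 0 <= N%:R :> R by [].
  have [_ pc] : measure_preserving leb2 ((fun z => clipped_flow N%:R f s z t) : T * T -> T * T).
    apply: (@flow_preserving R (clip_lip alpha L N%:R) (clip_bound alpha P N%:R)
      (clipped_velocity N%:R) (clipped_force alpha f N%:R) s t) => //.
    - by apply: ltW; apply: clip_lip_gt0 => //; exact: tame_lipschitz_ge0 tf.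
    - exact: (clipped_velocity_lipschitz alpha3 tf N0).
    - exact: (clipped_force_lipschitz alpha3 tf N0).
    - move=> z; have [x [v [xv zE E]]] := clipped_flow_sol s z tf N0.
      by exists x, v.
  have mAn : measurable (A `&` box n) by apply: measurableI => //; exact: measurable_rectangle.
  rewrite -(pc _ mAn); congr (leb2 _); apply/seteqP; split=> z /= [Az bz].
    have e : clipped_flow N%:R f s z t = S z.
      by apply: (clipped_flow_agree (r := n%:R) (u := u)) => //; right; right; exact: boxP bz.
    by rewrite e.
  have e : clipped_flow N%:R f s z t = S z.
    by apply: (clipped_flow_agree (r := n%:R) (u := u)) => //; right; left; exact: boxP bz.
  by rewrite -e.
have cover : A = \bigcup_n (A `&` box n).
  rewrite -setI_bigcupr; apply/esym/setIidPl => z0 _; pose z : R * R := z0.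
  have [r [r0 [z1 z2]]] := in_box_exists z.
  exists (Num.truncn r).+1 => //; apply/rectangleP.
  by have := truncnS_gt r; move: z1 z2; rewrite !ler_norml; lra.
have nd : {homo (fun n => A `&` box n) : m n / (m <= n)%N >-> (m <= n)%O}.
  move=> m n mn; apply/subsetPset; apply: setIS => z /rectangleP h; apply/rectangleP.
  by have : m%:R <= n%:R :> R by [rewrite ler_nat]; move: h; lra.
have mAn n : measurable (A `&` box n) by apply: measurableI => //; exact: measurable_rectangle.
have c1 : leb2 (A `&` box n) @[n --> \oo] --> leb2 A.
  rewrite {2}cover; apply: nondecreasing_cvg_mu => //.
  by rewrite -cover.
have c2 : leb2 ((S : T * T -> T * T) @^-1` (A `&` box n)) @[n --> \oo] -->
    leb2 ((S : T * T -> T * T) @^-1` A).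
  rewrite {2}cover preimage_bigcup; apply: nondecreasing_cvg_mu.
  - by move=> n; exact: measurable_preimage.
  - by rewrite -preimage_bigcup -cover; exact: measurable_preimage.
  - by move=> m n mn; apply/subsetPset; apply: preimage_subset; apply/subsetPset; exact: nd.
move: c2; under eq_cvg do rewrite bounded.
by move=> c2; exact: (cvg_unique _ c2 c1).
Qed.

End duffing_flow_map.

(** * Rotation in the phase plane and the next descending zero *)

Section successor.
Context {R : realType}.
Variable alpha : R.
Hypothesis alpha3 : 3 <= alpha.
Variables P L : R.
Implicit Types (f x v y w : R -> R) (s t a b r : R).

Lemma sqr_le_force r : r ^+ 2 <= force alpha r * r / 2 + 1.
Proof.
move: (alpha3) => a3; rewrite (force_mul alpha3).
rewrite -(real_normK (num_real r)).
have r0 := normr_ge0 r; move: (`|r|) r0 => q q0.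
have [q1|q1] := leP 1 q.
  have : q `^ 4%:R <= q `^ (alpha + 1) by apply: ler_powR => //; lra.
  rewrite powR_mulrn//.
  have -> : q ^+ 4 = (q ^+ 2) ^+ 2 by rewrite -exprM.
  have := sqr_ge0 (q ^+ 2 - 1); lra.
have := powR_ge0 q (alpha + 1); have : q ^+ 2 <= 1 by rewrite expr_le1// ltW.
by lra.
Qed.

(** While x does not vanish, the polar angle atan (v / x) stays in an interval of
    length pi. Where the energy is at least P ^ 2 + 2 it decreases at a rate of at
    least 1/2. *)
Lemma rotation_bound f x v a b : tame P L f -> dsol alpha f x v -> a <= b ->
  (forall t, a <= t <= b -> x t != 0) ->
  (forall t, a <= t <= b -> P ^+ 2 + 2 <= energy alpha (x t, v t)) ->
  b - a < 2 * pi.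
Proof.
move: (alpha3) => a3 [fP _] xv ab x0 hE.
pose A t := atan (v t * (x t)^-1).
pose dA t := (1 + (v t * (x t)^-1) ^+ 2)^-1 *
  ((f t - force alpha (x t)) * (x t)^-1 + v t * (- v t / x t ^+ 2)).
have hA t : a <= t <= b -> is_derive t 1 A (dA t).
  move=> tab; have [dx dv] := xv t.
  have d := derM dv (derV (x0 t tab) dx).
  exact: (der_comp d (is_derive1_atan _)).
have hl t : a <= t <= b -> is_derive t 1 (fun s : R => - 2^-1 * s) (- 2^-1).
  by move=> _; apply: der_eq (derZ (- 2^-1) (der_id t)) _; rewrite mulr1.
have hle t : a <= t <= b -> dA t <= - 2^-1.
  move=> tab; have xt := x0 t tab; have := hE t tab; rewrite /energy/= /potential.
  have x2 : 0 < x t ^+ 2 by rewrite exprn_even_gt0.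
  have -> : dA t = (f t * x t - force alpha (x t) * x t - v t ^+ 2) / (x t ^+ 2 + v t ^+ 2).
    rewrite /dA; field; rewrite xt/=; have := sqr_ge0 (v t) => v2.
    by rewrite !gt_eqF// ltr_wpDr.
  have v2 := sqr_ge0 (v t).
  rewrite ler_pdivrMr; last by lra.
  have F0 := force_mul_ge0 alpha3 (x t); have F4 := sqr_le_force (x t).
  have : force alpha (x t) * x t / (alpha + 1) <= force alpha (x t) * x t.
    by rewrite ler_pdivrMr; [nra|lra].
  have : 2 * (f t * x t) <= P ^+ 2 + x t ^+ 2.
    have := power_bound (x t) (fP t); have := ler_norm (x t * f t); lra.
  by lra.
have := der_le_diff ab hA hl hle.
have := @atan_ltpi2 R (v a * (x a)^-1); have := @atan_gtNpi2 R (v b * (x b)^-1).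
by rewrite /A; lra.
Qed.

(** Near c the velocity is below v c / 2. *)
Lemma zero_crossing f x v (c : R) : dsol alpha f x v -> x c = 0 -> v c < 0 ->
  exists2 d, 0 < d & (forall t, c < t < c + d -> x t < 0) /\
    (forall t, c - d < t < c -> 0 < x t).
Proof.
move=> xv xc vc.
have cv : {for c, continuous v} by exact: der_continuous (xv c).2.
have : \forall t \near c, v t < v c / 2.
  by apply: (cv (fun q => q < v c / 2)); apply: lt_nbhsl; lra.
move=> /nbhs_ballP[d /= d0 hd].
have hv t : `|t - c| < d -> v t < v c / 2.
  by move=> td; apply: hd; rewrite /ball/= distrC.
have hl t : is_derive t 1 (fun s : R => v c / 2 * s) (v c / 2).
  by apply: der_eq (derZ (v c / 2) (der_id t)) _; rewrite mulr1.
exists d => //; split=> t /andP[t1 t2].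
  have : x t - x c <= v c / 2 * t - v c / 2 * c.
    apply: (@der_le_diff _ x v (fun s : R => v c / 2 * s) (fun=> v c / 2)
      c t (ltW t1) (fun q _ => (xv q).1) (fun q _ => hl q)) => q qct.
    by apply/ltW/hv; rewrite ltr_norml; lra.
  rewrite xc subr0 -mulrBr => h; apply: le_lt_trans h _.
  by rewrite nmulr_rlt0 ?subr_gt0//; lra.
have : x c - x t <= v c / 2 * c - v c / 2 * t.
  apply: (@der_le_diff _ x v (fun s : R => v c / 2 * s) (fun=> v c / 2)
    t c (ltW t2) (fun q _ => (xv q).1) (fun q _ => hl q)) => q qct.
  by apply/ltW/hv; rewrite ltr_norml; lra.
rewrite xc sub0r -mulrBr => h.
have : v c / 2 * (c - t) < 0 by rewrite nmulr_rlt0 ?subr_gt0//; lra.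
by lra.
Qed.

Lemma dsolN f x v : dsol alpha f x v ->
  dsol alpha (fun t => - f t) (fun t => - x t) (fun t => - v t).
Proof.
move=> xv t; have [dx dv] := xv t; split; first exact: derN dx.
by apply: der_eq (derN dv) _; rewrite forceN; ring.
Qed.

Lemma tameN f : tame P L f -> tame P L (fun t => - f t).
Proof.
move=> [h1 h2]; split=> [t|s t]; first by rewrite normrN.
by rewrite -opprD normrN.
Qed.

(** The rotation allows 2 pi without zero, counted from one unit of time after a zero,
    where x is no longer 0. *)
Definition half_turn : R := 2 * pi + 1.

Lemma half_turn_gt0 : 0 < half_turn.
Proof. by have := pi_gt0 R; rewrite /half_turn; lra. Qed.

Lemma dsol_within_continuous f x v a b : dsol alpha f x v ->
  {within `[a, b], continuous x}.
Proof.
move=> xv; apply: continuous_subspaceT => t; exact: der_continuous (xv t).1.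
Qed.

(** x cannot stay away from 0 for long, so there is a first zero after a. There v is
    nonnegative because x was negative before, and nonzero because the energy at a
    zero of x is v ^ 2 / 2. *)
Lemma next_zero f x v (a : R) : tame P L f -> dsol alpha f x v ->
  x a = 0 -> v a < 0 ->
  (forall t, a <= t <= a + half_turn -> P ^+ 2 + 2 <= energy alpha (x t, v t)) ->
  exists2 b, a < b <= a + half_turn &
    [/\ x b = 0, 0 < v b & forall t, a < t < b -> x t < 0].
Proof.
move=> tf xv xa va hE.
have h0 := half_turn_gt0.
have [d d0 [neg _]] := zero_crossing xv xa va.
pose Z := [set t : R | a < t /\ x t = 0].
have [z0 z0a Zz0] : exists2 z0, z0 <= a + half_turn & Z z0.
  apply: contrapT => nz.
  have : (a + half_turn) - (a + 1) < 2 * pi.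
    apply: (rotation_bound tf xv) => [|t tab|t tab].
    - by have := pi_gt0 R; rewrite /half_turn; lra.
    - apply/eqP => xt; apply: nz; exists t; first by case/andP: tab.
      by split=> //; move: tab; lra.
    - by apply: hE; move: tab; lra.
  by rewrite /half_turn; lra.
have lbZ : lbound Z a by move=> t [/ltW].
have hZ : has_inf Z by split; [exists z0|exists a].
pose b := inf Z.
have bz t : Z t -> b <= t by exact: ge_inf hZ.2 _.
have ab : a + d <= b.
  apply: lb_le_inf; first by exists z0.
  move=> t [at_ xt]; rewrite leNgt; apply/negP => td.
  by have := neg t; rewrite at_ td xt ltxx => /(_ isT).
have nz t : a < t < b -> x t != 0.
  move=> /andP[at_ tb]; apply/eqP => xt.
  by have := bz t (conj at_ xt); rewrite leNgt tb.
have negb t : a < t < b -> x t < 0.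
  move=> tab; have /andP[at_ tb] := tab; have xt := nz t tab.
  rewrite lt_neqAle xt/= leNgt; apply/negP => xt0.
  pose q := Num.min (a + d / 2) t.
  have q1 : a < q by rewrite /q lt_min at_ andbT; lra.
  have q2 : q <= t by rewrite /q ge_min lexx orbT.
  have q3 : q < a + d by rewrite /q gt_min; apply/orP; left; lra.
  have xq : x q < 0 by apply: neg; rewrite q1.
  have [c] := @IVT R x q t 0 q2 (dsol_within_continuous xv)
    ltac:(rewrite ge_min (ltW xq) le_max (ltW xt0) orbT//).
  rewrite in_itv/= => /andP[qc ct] xc.
  have : x c != 0 by apply: nz; rewrite (lt_le_trans q1 qc) (le_lt_trans ct tb).
  by rewrite xc eqxx.
have xb : x b = 0.
  apply/eqP; apply: contrapT => /negP xb.
  have cx : {for b, continuous x} by exact: der_continuous (xv b).1.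
  have : \forall t \near b, x t != 0.
    exact: cvgr_neq0 cx xb.
  move=> /nbhs_ballP[e /= e0 he].
  have [t Zt tb] := inf_adherent e0 hZ.
  have := bz t Zt => bt.
  have : x t != 0.
    by apply: he; rewrite /ball/= ler0_norm ?subr_le0// opprB ltrBlDl.
  by case: Zt => _ ->; rewrite eqxx.
have bmax : b <= a + half_turn by apply: le_trans z0a; exact: bz.
have ab' : a < b by lra.
exists b; first by rewrite ab' bmax.
split=> //.
rewrite lt_neqAle; apply/andP; split.
  apply/eqP => vb; have := hE b; rewrite (ltW ab') bmax => /(_ isT).
  rewrite /energy/= -vb xb /potential force0 mul0r expr0n/= !mul0r addr0.
  by have := sqr_ge0 P; lra.
rewrite leNgt; apply/negP => vb.
have [e e0 [_ pos]] := zero_crossing xv xb vb.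
pose q := Num.max ((a + b) / 2) (b - e / 2).
have q1 : a < q < b.
  by rewrite lt_max gt_max; apply/andP; split; [apply/orP; left|apply/andP; split]; lra.
have := negb q q1; rewrite ltNge => /negP; apply; apply/ltW/pos.
have /andP[_ ->] := q1; rewrite andbT lt_max; apply/orP; right; lra.
Qed.

Definition return_time : R := half_turn + half_turn.

(** Half a turn through negative values, followed by the same for - x, which solves
    the equation with forcing - f. *)
Lemma next_descending_zero f x v (a : R) : tame P L f -> dsol alpha f x v ->
  x a = 0 -> v a < 0 ->
  (forall t, a <= t <= a + return_time -> P ^+ 2 + 2 <= energy alpha (x t, v t)) ->
  exists2 c, a < c <= a + return_time &
    [/\ x c = 0, v c < 0 & forall t, a < t < c -> ~ (x t = 0 /\ v t < 0)].
Proof.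
move=> tf xv xa va hE; have h0 := half_turn_gt0.
have [b /andP[ab bm] [xb vb nb]] : exists2 b, a < b <= a + half_turn &
    [/\ x b = 0, 0 < v b & forall t, a < t < b -> x t < 0].
  by apply: (next_zero tf xv) => // t tab; apply: hE; move: tab; rewrite /return_time; lra.
have [|||c /andP[bc cm] [xc vc nc]] := @next_zero _ _ _ b (tameN tf) (dsolN xv).
- by rewrite xb oppr0.
- by rewrite oppr_lt0.
- move=> t tab; rewrite (_ : energy _ _ = energy alpha (x t, v t)).
    by apply: hE; move: tab; rewrite /return_time; lra.
  by rewrite /energy/= potentialN sqrrN.
exists c; first by rewrite /return_time; apply/andP; split; lra.
split; [by apply/eqP; rewrite -oppr_eq0 xc|by rewrite -oppr_gt0|].
move=> t /andP[at_ tc] [xt vt].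
have [tb|bt|tb] := ltgtP t b.
- by have := nb t; rewrite at_ tb xt ltxx => /(_ isT).
- by have := nc t; rewrite bt tc xt oppr0 ltxx => /(_ isT).
- by move: vt; rewrite tb; lra.
Qed.

(** From an energy above this value the solution keeps an energy of at least
    P ^ 2 + 2 for a whole turn, by the exponential bound on the energy. *)
Definition energy_threshold : R := (P ^+ 2 + 2 + P ^+ 2 / 2) * expR return_time.
(** The term P + 4 makes v ^ 2 / 2 at least P + 2 as well: while x moves through a
    unit interval, the kinetic energy changes by at most P + 1. *)
Definition velocity_bound : R := - (energy_threshold + P + 4).

Lemma energy_threshold_ge0 : 0 <= energy_threshold.
Proof. by rewrite mulr_ge0 ?expR_ge0//; have := sqr_ge0 P; lra. Qed.

Lemma below_velocity_bound u : 0 <= P -> u < velocity_bound ->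
  [/\ u < 0, energy_threshold <= u ^+ 2 / 2 & P + 2 <= u ^+ 2 / 2].
Proof.
have := energy_threshold_ge0; rewrite /velocity_bound; move: energy_threshold => Q Q0 P0 uv.
by split; [lra|nra|nra].
Qed.

Lemma energy_turn f x v (a t : R) : tame P L f -> dsol alpha f x v ->
  energy_threshold <= energy alpha (x a, v a) -> a <= t <= a + return_time ->
  P ^+ 2 + 2 <= energy alpha (x t, v t).
Proof.
move=> tf xv Ea tab; rewrite leNgt; apply/negP => Et.
have := dsol_energy alpha3 t a tf xv.
have : expR `|a - t| <= expR return_time by rewrite ler_expR ler_norml; move: tab; lra.
have := energy_ge0 alpha3 (x t, v t); have := expR_gt0 return_time.
have := sqr_ge0 P.
move: Ea Et; rewrite /energy_threshold.
move: (energy _ _) (energy _ _) (expR _) (expR _) => B A e' e hA hB p e0 B0 ee h.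
have : (B + P ^+ 2 / 2) * e' <= (B + P ^+ 2 / 2) * e by rewrite ler_wpM2l//; lra.
have : (B + P ^+ 2 / 2) * e < (P ^+ 2 + 2 + P ^+ 2 / 2) * e.
  by rewrite ltr_pM2r//; lra.
by lra.
Qed.

End successor.

(** * The successor map *)

Section escaping_orbits.
Context {R : realType}.
Variable alpha : R.
Hypothesis alpha3 : 3 <= alpha.
Variables P L : R.
Implicit Types (f x v y w : R -> R) (s t a b r : R) (z : R * R).

Lemma dsol_derive1 f x v : dsol alpha f x v -> x^`()%classic = v.
Proof. by move=> xv; apply/funext => t; rewrite derive1E; have [[_ ->] _] := xv t. Qed.

Lemma duffing_solutionP f x : duffing_solution alpha f x <-> dsol alpha f x x^`()%classic.
Proof.
split=> [h t|h t].
  have [dx dv e] := h t; split; first by apply: DeriveDef => //; rewrite derive1E.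
  apply: DeriveDef => //; rewrite -derive1E.
  by rewrite -e /force addrK.
have [[dx ex] [dv ev]] := h t; split=> //.
by rewrite derive1nS derive1n1 derive1E ev /force subrK.
Qed.

Lemma duffing_flow_eq f x v a : tame P L f -> dsol alpha f x v -> x a = 0 ->
  duffing_flow alpha f (v a, a) = x.
Proof.
move=> tf xv xa; have xE := dsol_derive1 xv.
have ex : [set x | [/\ duffing_solution alpha f x, x (v a, a).2 = 0 &
    x^`()%classic (v a, a).2 = (v a, a).1]] x.
  by split=> //=; [apply/duffing_solutionP; rewrite xE|rewrite xE].
have := @xgetI _ (cst 0) _ _ ex; rewrite -/(duffing_flow alpha f (v a, a)).
set y := duffing_flow _ _ _ => -[/duffing_solutionP sy /= ya wa].
by have [] := dsol_unique alpha3 tf sy xv (etrans ya (esym xa)) wa.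
Qed.

Lemma successor_spec f x v a : tame P L f -> dsol alpha f x v -> x a = 0 ->
  v a < velocity_bound P -> let D := descending_zeros alpha f (v a, a) in
  [/\ D !=set0, D (inf D) & exists c, [/\ successor alpha f (v a, a) = (v c, c),
    a < c, c <= a + return_time & x c = 0]].
Proof.
move=> tf xv xa va D; have P0 := tame_bound_ge0 tf.
have xE := dsol_derive1 xv; have fE := duffing_flow_eq tf xv xa.
have [va0 vq _] := below_velocity_bound P0 va.
have Ea : energy_threshold P <= energy alpha (x a, v a).
  by rewrite /energy/= xa /potential force0 mul0r mul0r addr0.
have [c /andP[ac cm] [xc vc nc]] := next_descending_zero alpha3 tf xv xa va0
  (fun t => energy_turn alpha3 tf xv Ea).
have DE s : D s <-> [/\ a < s, x s = 0 & v s < 0].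
  by rewrite /D /descending_zeros/= fE xE.
have Dc : D c by apply/DE.
have lb : lbound D c.
  move=> s /DE[as_ xs vs]; rewrite leNgt; apply/negP => sc.
  by apply: (nc s) => //; rewrite as_.
have iD : inf D = c.
  apply/eqP; rewrite eq_le; apply/andP; split.
    by apply: ge_inf => //; exists c.
  by apply: lb_le_inf => //; exists c.
split; [by exists c|by rewrite iD|].
by exists c; split=> //; rewrite /successor -/D iD fE xE.
Qed.

Lemma successor_map_well_defined f : tame P L f ->
  successor_well_defined alpha f (left_of (velocity_bound P)).
Proof.
move=> tf [v0 t0]; rewrite /left_of/= => vt.
have [x [v [xv xs vs]]] := dsol_exists alpha3 t0 0 v0 tf.
rewrite -vs; have [] := successor_spec tf xv xs; first by rewrite vs.
by split.
Qed.

Lemma orbit_times f x v a : tame P L f -> dsol alpha f x v -> x a = 0 ->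
  iterates_defined alpha f (left_of (velocity_bound P)) (v a, a) ->
  let t n := (iter n (successor alpha f) (v a, a)).2 in
  forall n, [/\ iter n (successor alpha f) (v a, a) = (v (t n), t n), x (t n) = 0,
    t n < t n.+1 & t n.+1 <= t n + return_time].
Proof.
move=> tf xv xa hz t.
have base n : iter n (successor alpha f) (v a, a) = (v (t n), t n) /\ x (t n) = 0.
  elim: n => [|n [e xn]]; first by split.
  have := hz n; rewrite /left_of/= e/= => vn.
  have [_ _ [c [sc _ _ xc]]] := successor_spec tf xv xn vn.
  have eS : iter n.+1 (successor alpha f) (v a, a) = (v c, c) by rewrite iterS e sc.
  by rewrite /t eS.
move=> n; have [e xn] := base n; have [e' xn'] := base n.+1.
have := hz n; rewrite /left_of/= e/= => vn.
have [_ _ [c [sc nc cn xc]]] := successor_spec tf xv xn vn.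
have tc : t n.+1 = c by rewrite /t iterS e sc.
by rewrite tc; split.
Qed.

(** The times t n of an escaping orbit tend to infinity, since energy stays bounded
    on bounded time intervals, and successive times differ by at most return_time.
    A state in the box of size r between t n and t n.+1 would bound the energy at
    t n, which is v n ^ 2 / 2 and tends to infinity. *)
Theorem escaping_leaves_boxes f z : tame P L f -> escaping_set alpha f (velocity_bound P) z ->
  forall r, exists M, forall t, M <= t -> ~ in_box r (dflow alpha f z.2 (0, z.1) t).
Proof.
case: z => v0 a tf [/= va hz hlim] r.
have [x [v [xv [xa va'] fE]]] := dflow_sol alpha3 a (0, v0) tf.
subst v0; have P0 := tame_bound_ge0 tf.
have tP := orbit_times tf xv (esym xa) hz.
set t := fun n => (iter n (successor alpha f) (v a, a)).2 in tP.
have tmono n m : (n <= m)%N -> t n <= t m.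
  move=> nm; rewrite -(subnKC nm); elim: (m - n)%N => [|k IH]; rewrite ?addn0//.
  by rewrite addnS; apply: le_trans IH _; have [_ _ /ltW] := tP (n + k)%N.
have vlim (C : R) : exists n0, forall n, (n0 <= n)%N -> v (t n) < C.
  have := hlim; move=> /cvgrNyPlt/(_ C) [n0 _ h].
  by exists n0 => n n0n; have := h n n0n; have [-> _ _ _] := tP n.
have Et n : energy alpha (x (t n), v (t n)) = v (t n) ^+ 2 / 2.
  by have [_ xn _ _] := tP n; rewrite /energy/= xn /potential force0 mul0r mul0r addr0.
have big (C : R) : 0 <= C -> exists n0, forall n, (n0 <= n)%N ->
    C < energy alpha (x (t n), v (t n)).
  move=> C0; have [n0 h] := vlim (- (C + 2)); exists n0 => n /h vn.
  by rewrite Et; nra.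
have PP : 0 <= P ^+ 2 / 2 by rewrite divr_ge0// sqr_ge0.
have unb (M : R) : exists n, M < t n.
  apply: contrapT => nex.
  have tM n : t n <= M by rewrite leNgt; apply/negP => h; apply: nex; exists n.
  pose C := (energy alpha (x a, v a) + P ^+ 2 / 2) * expR (M - a).
  have C0 : 0 <= C by rewrite mulr_ge0 ?expR_ge0// addr_ge0// energy_ge0.
  have [n0 /(_ n0 (leqnn _))] := big C C0.
  have := dsol_energy alpha3 a (t n0) tf xv.
  have at_ : a <= t n0 by exact: (tmono 0%N).
  rewrite ger0_norm ?subr_ge0// => h.
  have : (energy alpha (x a, v a) + P ^+ 2 / 2) * expR (t n0 - a) <= C.
    apply: ler_wpM2l; first by rewrite addr_ge0// energy_ge0.
    by rewrite ler_expR; have := tM n0; lra.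
  by lra.
pose Er := r ^+ 2 / 2 + `|potential alpha r|.
pose C := (Er + P ^+ 2 / 2) * expR return_time.
have Er0 : 0 <= Er by rewrite addr_ge0// divr_ge0// sqr_ge0.
have C0 : 0 <= C by rewrite mulr_ge0 ?expR_ge0// addr_ge0.
have [n0 hn0] := big C C0.
exists (t n0) => s ts; rewrite fE => bs.
have [n [n0n tns stn]] : exists n, [/\ (n0 <= n)%N, t n <= s & s < t n.+1].
  have ex : exists k, s < t (n0 + k)%N.+1.
    have [m ms] := unb s; exists m; apply: lt_le_trans ms _.
    by apply: tmono; apply: leqW; exact: leq_addl.
  case: (ex_minnP ex) => k sk kmin; exists (n0 + k)%N; split=> //.
    by rewrite leq_addr.
  case: k sk kmin => [|k] sk kmin; first by rewrite addn0.
  rewrite leNgt; apply/negP => h; have := kmin k.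
  by rewrite -addnS h => /(_ isT); rewrite ltnn.
have [_ _ _ tr] := tP n.
have := hn0 n n0n; have := dsol_energy alpha3 s (t n) tf xv.
have : expR `|t n - s| <= expR return_time by rewrite ler_expR ler_norml; lra.
have := energy_in_box alpha3 bs.
have : potential alpha r <= `|potential alpha r| by exact: ler_norm.
have := energy_ge0 alpha3 (x s, v s); have := expR_gt0 (return_time (R := R)).
rewrite /C /Er; move: PP.
move: (energy _ _) (energy _ _) (expR _) (expR _) (P ^+ 2 / 2) (r ^+ 2 / 2) => B A e' e p q.
move=> p0 e0 A0 pr hA ee h hB.
have : (A + p) * e' <= (A + p) * e by rewrite ler_wpM2l//; lra.
have : (A + p) * e <= (q + `|potential alpha r| + p) * e by rewrite ler_pM2r//; lra.
lra.
Qed.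

End escaping_orbits.

(** * Slow growth of the energy *)

Section adiabatic_growth.
Context {R : realType}.
Implicit Types (alpha P r : R) (f x v : R -> R).

Lemma powR_root (u p A t k : R) : 0 <= u -> 0 < p -> 0 <= A -> 0 <= t ->
  u `^ p <= A * t `^ k -> u <= A `^ p^-1 * t `^ (k / p).
Proof.
move=> u0 p0 A0 t0 h.
have -> : u = (u `^ p) `^ p^-1 by rewrite -powRrM mulfV ?gt_eqF// powRr1.
rewrite powRrM -powRM ?powR_ge0//.
by rewrite ge0_ler_powR ?nnegrE ?powR_ge0 ?mulr_ge0 ?powR_ge0 ?invr_ge0// ltW.
Qed.

(** Turns growth of a modified energy W, which dominates half of the potential plus
    the kinetic energy, into growth of the state. *)
Lemma energy_growth_bounds alpha (C k t W x0 v0 : R) : 3 <= alpha -> 0 <= C -> 0 <= t ->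
  potential alpha x0 / 2 + v0 ^+ 2 / 2 <= W -> W <= C * t `^ k ->
  `|x0| <= (2 * (alpha + 1) * C) `^ (alpha + 1)^-1 * t `^ (k / (alpha + 1)) /\
  `|v0| <= (2 * C) `^ 2^-1 * t `^ (k / 2).
Proof.
move=> a3 C0 t0 hW WC; have a0 : 0 < alpha + 1 by lra.
have V0 := potential_ge0 a3 x0; have v2 := sqr_ge0 v0.
split; apply: powR_root => //.
- by rewrite !mulr_ge0//; lra.
- have : potential alpha x0 <= 2 * (C * t `^ k) by lra.
  rewrite /potential (force_mul a3) ler_pdivrMr//.
  by move/le_trans; apply; rewrite le_eqVlt; apply/orP; left; apply/eqP; ring.
- by rewrite mulr_ge0.
- by rewrite powR_mulrn// real_normK ?num_real// -mulrA; lra.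
Qed.

(** The difference is 2 x / ((q s + x ^ 2) s) with q = sqrt 2: for alpha = 3 the angle
    atan (v / s) of the rotation has derivative - sqrt 2 x up to a bounded error. *)
Lemma cubic_weight (x s q : R) : 1 <= s -> s ^+ 2 = 1 + x ^+ 4 / 2 ->
  1 <= q -> q ^+ 2 = 2 -> `|q * x - x ^+ 3 / s| <= 1.
Proof.
move=> s1 s2 q1 q2.
have s0 : 0 < s by lra.
have qs0 : 1 <= q * s by nra.
have qx : 0 < q * s + x ^+ 2 by have := sqr_ge0 x; lra.
have -> : q * x - x ^+ 3 / s = x * 2 / ((q * s + x ^+ 2) * s).
  have e : (q * s) ^+ 2 - x ^+ 4 = 2 by rewrite exprMn q2 s2; field.
  have -> : x * 2 = x * ((q * s) ^+ 2 - x ^+ 4) by rewrite e.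
  by field; rewrite !gt_eqF.
rewrite normrM normfV (gtr0_norm (mulr_gt0 qx s0)).
rewrite ler_pdivrMr ?mulr_gt0// mul1r normrM (ger0_norm (_ : 0 <= 2 :> R))//.
have : 2 * `|x| <= 1 + x ^+ 2.
  by rewrite -(real_normK (num_real x)); have := sqr_ge0 (`|x| - 1); lra.
have : q * s + x ^+ 2 <= (q * s + x ^+ 2) * s by rewrite ler_peMr// ltW.
lra.
Qed.

Lemma cubic_force (x0 : R) : force 3 x0 = x0 ^+ 3 :> R.
Proof.
rewrite /force (_ : 3 - 1 = 2%:R :> R); last by ring.
by rewrite powR_mulrn// real_normK ?num_real// -exprSr.
Qed.

Section cubic.
Variables (P P1 P2 : R) (f f1 f2 x v : R -> R).
Hypothesis fP : forall t, `|f t| <= P.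
Hypothesis f1P : forall t, `|f1 t| <= P1.
Hypothesis f2P : forall t, `|f2 t| <= P2.
Hypothesis df : forall t : R, is_derive t 1 f (f1 t).
Hypothesis df1 : forall t : R, is_derive t 1 f1 (f2 t).
Hypothesis xv : dsol 3 f x v.

Let q : R := Num.sqrt 2.
Let s t : R := Num.sqrt (1 + x t ^+ 4 / 2).
(* For alpha = 3 the energy corrected by - f x has derivative - f' x, of the order of
   the fourth root of the energy, and would grow like t ^ (4/3), too fast. The angle G
   is a bounded primitive of - sqrt 2 x up to a bounded error; the term in f' G
   therefore absorbs - f' x, at the cost of one more derivative of f. *)
Let G t : R := atan (v t * (s t)^-1).
Let c0 : R := 1 + P ^+ 2 + 1 + P1 * pi.
Let W t : R := energy 3 (x t, v t) - f t * x t - q^-1 * (f1 t * G t) + c0.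

Let P0 : 0 <= P. Proof. exact: le_trans (fP 0). Qed.
Let P10 : 0 <= P1. Proof. exact: le_trans (f1P 0). Qed.
Let P20 : 0 <= P2. Proof. exact: le_trans (f2P 0). Qed.

Let q2 : q ^+ 2 = 2. Proof. by rewrite sqr_sqrtr. Qed.
Let q1 : 1 <= q. Proof. by rewrite -[leLHS]sqrtr1 ler_sqrt; lra. Qed.
Let x40 t : 0 <= x t ^+ 4. Proof. exact: exprn_even_ge0. Qed.
Let u0 t : 0 < 1 + x t ^+ 4 / 2. Proof. by have := x40 t; lra. Qed.
Let s2 t : s t ^+ 2 = 1 + x t ^+ 4 / 2. Proof. by rewrite sqr_sqrtr// ltW. Qed.
Let s1 t : 1 <= s t.
Proof. by rewrite -[leLHS]sqrtr1 ler_sqrt ?(ltW (u0 t))//; have := x40 t; lra. Qed.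

Let G_bound t : `|G t| <= pi.
Proof.
have := atan_gtNpi2 (v t * (s t)^-1); have := atan_ltpi2 (v t * (s t)^-1).
by rewrite ler_norml /G; have := pi_gt0 R; lra.
Qed.

Let dW t : R := - (q^-1 * (f2 t * G t)) -
  q^-1 * (f1 t * ((q * x t - x t ^+ 3 / s t) + f t * s t / (s t ^+ 2 + v t ^+ 2))).

Let der_W (t : R) : is_derive t 1 W (dW t).
Proof.
have [dx dv] := xv t; have sp : 0 < s t by have := s1 t; lra.
have dsq := derZ 2^-1 (der_sqr dv).
have dV := der_comp dx (der_potential (lexx 3) (x t)).
have dfx := derM (df t) dx.
have du : is_derive t 1 (fun r => 1 + (x r ^+ 2) ^+ 2 * 2^-1) (2 * x t ^+ 3 * v t).
  apply: der_eq (derD (der_cst 1 t) (derM (der_sqr (der_sqr dx)) (der_cst 2^-1 t))) _.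
  by rewrite mulr0 addr0 add0r; field.
have ds : is_derive t 1 s ((2 * s t)^-1 * (2 * x t ^+ 3 * v t)).
  have -> : s = (fun r => Num.sqrt (1 + (x r ^+ 2) ^+ 2 * 2^-1)).
    by apply/funext => r; rewrite /s -exprM.
  apply: (der_comp du); rewrite -exprM; apply: is_derive1_sqrt.
  by rewrite exprM; have := u0 t; rewrite -exprM.
have dvs := derM dv (derV (negbT (gt_eqF sp)) ds).
have dG := der_comp dvs (is_derive1_atan _).
have dfG := derZ q^-1 (derM (df1 t) dG).
have -> : W = (fun r => 2^-1 * v r ^+ 2 + potential 3 (x r) - f r * x r -
    q^-1 * (f1 r * atan (v r * (s r)^-1)) + c0).
  by apply/funext => r; rewrite /W /energy/= [_ / 2]mulrC.
apply: der_eq (derD (derB (derB (derD dsq dV) dfx) dfG) (der_cst c0 t)) _.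
rewrite cubic_force /dW -/(G t).
have sv : s t ^+ 2 + v t ^+ 2 != 0.
  by rewrite gt_eqF// ltr_pwDl ?exprn_gt0// sqr_ge0.
have q0 : q != 0 by rewrite gt_eqF// (lt_le_trans ltr01 q1).
by field; rewrite q0 sv gt_eqF.
Qed.

Let dW_bound t : `|dW t| <= P2 * pi + P1 * (1 + P).
Proof.
have qi : q^-1 <= 1 by rewrite invf_le1// (lt_le_trans ltr01 q1).
have qi0 : 0 <= q^-1 by rewrite invr_ge0 (le_trans ler01 q1).
have sp := s1 t; have sv : 0 < s t ^+ 2 + v t ^+ 2.
  by have := sqr_ge0 (v t); nra.
have shrink (y Y : R) : `|y| <= Y -> `|q^-1 * y| <= Y.
  move=> yY; rewrite normrM (ger0_norm qi0).
  by have := normr_ge0 y; nra.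
rewrite /dW; apply: le_trans (ler_normB _ _) _; rewrite normrN; apply: lerD; apply: shrink.
  by rewrite normrM; apply: ler_pM.
rewrite normrM; apply: ler_pM => //.
apply: le_trans (ler_normD _ _) _; apply: lerD; first exact: (cubic_weight sp (s2 t) q1 q2).
rewrite normrM normfV (gtr0_norm sv) normrM (ger0_norm (_ : 0 <= s t)); last by lra.
rewrite ler_pdivrMr//; apply: ler_pM => //; first lra.
by have := sqr_ge0 (v t); nra.
Qed.

Let fx_bound t : `|f t * x t| <= P ^+ 2 + 1 + x t ^+ 4 / 8.
Proof.
have -> : x t ^+ 4 = (x t ^+ 2) ^+ 2 by rewrite -exprM.
have := sqr_ge0 (x t ^+ 2 - 1); have := sqr_ge0 (2 * P - `|x t|).
rewrite normrM; have := fP t; have := normr_ge0 (x t); have := normr_ge0 (f t).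
have e : `|x t| ^+ 2 = x t ^+ 2 by exact: real_normK (num_real _).
by rewrite -e; move: (`|f t|) (`|x t|) => a b; nra.
Qed.

Let fG_bound t : `|q^-1 * (f1 t * G t)| <= P1 * pi.
Proof.
have qi : q^-1 <= 1 by rewrite invf_le1// (lt_le_trans ltr01 q1).
have qi0 : 0 <= q^-1 by rewrite invr_ge0 (le_trans ler01 q1).
rewrite normrM (ger0_norm qi0) -[leRHS]mul1r; apply: ler_pM => //.
by rewrite normrM; apply: ler_pM.
Qed.

Let potE t : potential 3 (x t) = x t ^+ 4 / 4.
Proof. by rewrite /potential cubic_force -exprSr; congr (_ / _); ring. Qed.

Lemma cubic_growth r n : in_box r (x n%:R, v n%:R) ->
  exists W0 : R, potential 3 (x 0) / 2 + v 0 ^+ 2 / 2 <= W0 /\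
  W0 <= (r ^+ 2 / 2 + r ^+ 4 / 4 + 3 * (c0 + r ^+ 4) + (P2 * pi + P1 * (1 + P))) * (1 + n%:R).
Proof.
move=> [/= xr vr]; exists (W 0); split.
  have := fx_bound 0; have := fG_bound 0; rewrite /W /energy/= potE /c0 !ler_norml.
  lra.
have : `|W n%:R - W 0| <= (P2 * pi + P1 * (1 + P)) * `|n%:R - 0|.
  by apply: (@der_lipschitz _ W dW) => t _; [exact: der_W|exact: dW_bound].
rewrite subr0 (ger0_norm (ler0n _ _)) ler_norml => /andP[h _].
have r0 : 0 <= r by exact: le_trans xr.
have x4 : x n%:R ^+ 4 <= r ^+ 4.
  by rewrite -(ger0_norm (x40 _)) normrX; apply: lerXn2r; rewrite ?nnegrE.
have v2 : v n%:R ^+ 2 <= r ^+ 2.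
  by rewrite -(real_normK (num_real (v _))); apply: lerXn2r; rewrite ?nnegrE.
have Wn : W n%:R <= r ^+ 2 / 2 + r ^+ 4 / 4 + 3 * (c0 + r ^+ 4).
  have := fx_bound n%:R; have := fG_bound n%:R; rewrite /W /energy/= potE /c0 !ler_norml.
  have : 0 <= P1 * pi by rewrite mulr_ge0// ltW// pi_gt0.
  by have := x40 n%:R; have := sqr_ge0 P; lra.
have n0 : 0 <= n%:R :> R by [].
have c00 : 0 <= P2 * pi + P1 * (1 + P).
  by apply: addr_ge0; apply: mulr_ge0; rewrite ?pi_ge0 ?addr_ge0.
have B0 : 0 <= r ^+ 2 / 2 + r ^+ 4 / 4 + 3 * (c0 + r ^+ 4).
  have : 0 <= c0 by rewrite /c0 !addr_ge0 ?sqr_ge0// mulr_ge0// ltW// pi_gt0.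
  have := sqr_ge0 r; have : 0 <= r ^+ 4 by exact: exprn_ge0.
  lra.
have Bn := mulr_ge0 B0 n0; move: h Wn c00 B0 Bn.
move: (P2 * pi + _) (r ^+ 2 / 2 + _ + _) => A B h Wn c00 B0 Bn.
by lra.
Qed.

End cubic.

Section supercubic.
Variables (alpha P P1 : R) (f f1 x v : R -> R).
Hypothesis alpha3 : 3 <= alpha.
Hypothesis fP : forall t, `|f t| <= P.
Hypothesis f1P : forall t, `|f1 t| <= P1.
Hypothesis df : forall t : R, is_derive t 1 f (f1 t).
Hypothesis xv : dsol alpha f x v.

Let c0 : R := 1 + (alpha + 1)^-1 + P ^+ 2 * (alpha + 1) / 4.
(* Here W' = - f' x and |x| <= c W ^ (1 / (alpha + 1)), so that W ^ g has a bounded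
   derivative and W grows at most like t ^ (1 / g) = t ^ ((alpha + 1) / alpha). *)
Let W t : R := energy alpha (x t, v t) - f t * x t + c0.
Let g : R := alpha / (alpha + 1).
Let c : R := (2 * (alpha + 1)) `^ (alpha + 1)^-1.

Let a0 : 0 < alpha + 1. Proof. by move: (alpha3) => a3; lra. Qed.
Let P0 : 0 <= P. Proof. exact: le_trans (fP 0). Qed.
Let P10 : 0 <= P1. Proof. exact: le_trans (f1P 0). Qed.

Let fx_bound t : `|f t * x t| <= potential alpha (x t) / 2 + (c0 - 1).
Proof.
have := sqr_le_force alpha3 (x t).
have -> : force alpha (x t) * x t = (alpha + 1) * potential alpha (x t).
  by rewrite /potential [RHS]mulrC divfK// gt_eqF.
rewrite /c0 => h.
have h2 : (alpha + 1)^-1 * x t ^+ 2 <= potential alpha (x t) / 2 + (alpha + 1)^-1.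
  have e : (alpha + 1)^-1 * ((alpha + 1) * potential alpha (x t) / 2 + 1) =
      potential alpha (x t) / 2 + (alpha + 1)^-1 by field; rewrite gt_eqF.
  by rewrite -e ler_wpM2l// invr_ge0 ltW.
have := fP t; rewrite normrM; move: (normr_ge0 (x t)) (normr_ge0 (f t)).
rewrite -(real_normK (num_real (x t))) in h2.
move: h2; move: (`|f t|) (`|x t|) => F X h2 X0 F0 FP.
have h3 : F * X <= P * X by rewrite ler_wpM2r.
have h4 : P * X <= (alpha + 1)^-1 * X ^+ 2 + P ^+ 2 * (alpha + 1) / 4.
  rewrite -subr_ge0.
  have -> : (alpha + 1)^-1 * X ^+ 2 + P ^+ 2 * (alpha + 1) / 4 - P * X =
      (alpha + 1)^-1 * (X - P * (alpha + 1) / 2) ^+ 2.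
    by field; rewrite gt_eqF.
  by rewrite mulr_ge0 ?sqr_ge0// invr_ge0 ltW.
lra.
Qed.

Let W_ge t : 1 + potential alpha (x t) / 2 + v t ^+ 2 / 2 <= W t.
Proof.
have := fx_bound t; rewrite ler_norml /W /energy/= => /andP[_ h].
lra.
Qed.

Let W_gt0 t : 0 < W t.
Proof.
have := W_ge t; have := potential_ge0 alpha3 (x t); have := sqr_ge0 (v t); lra.
Qed.

Let der_W (t : R) : is_derive t 1 W (- (f1 t * x t)).
Proof.
have [dx dv] := xv t.
have dsq := derZ 2^-1 (der_sqr dv).
have dV := der_comp dx (der_potential alpha3 (x t)).
have dfx := derM (df t) dx.
have -> : W = (fun r => 2^-1 * v r ^+ 2 + potential alpha (x r) - f r * x r + c0).
  by apply/funext => r; rewrite /W /energy/= [_ / 2]mulrC.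
by apply: der_eq (derD (derB (derD dsq dV) dfx) (der_cst c0 t)) _; field.
Qed.

Let x_bound t : `|x t| <= c * W t `^ (alpha + 1)^-1.
Proof.
have := @powR_root (`|x t|) (alpha + 1) (2 * (alpha + 1)) (W t) 1.
rewrite mul1r powRr1 ?(ltW (W_gt0 t))//; apply=> //.
  by rewrite mulr_ge0// ltW.
have : potential alpha (x t) <= 2 * W t.
  by have := W_ge t; have := sqr_ge0 (v t); lra.
by rewrite /potential (force_mul alpha3) ler_pdivrMr// mulrAC.
Qed.

Let dU_bound t : `|g * W t `^ (g - 1) * (- (f1 t * x t))| <= g * P1 * c.
Proof.
have g0 : 0 <= g by rewrite divr_ge0 ?(ltW a0)//; move: (alpha3) => a3; lra.
rewrite normrM normrN normrM (ger0_norm g0) (ger0_norm (powR_ge0 _ _)) normrM.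
have h : W t `^ (g - 1) * W t `^ (alpha + 1)^-1 = 1.
  rewrite -powRD; last by apply/implyP => _; rewrite gt_eqF.
  rewrite (_ : g - 1 + (alpha + 1)^-1 = 0) ?powRr0//.
  by rewrite /g; field; rewrite gt_eqF.
have -> : g * P1 * c = g * W t `^ (g - 1) * (P1 * (c * W t `^ (alpha + 1)^-1)).
  transitivity (g * P1 * c * (W t `^ (g - 1) * W t `^ (alpha + 1)^-1)).
    by rewrite h mulr1.
  by ring.
apply: ler_wpM2l; first by rewrite mulr_ge0 ?powR_ge0.
by apply: ler_pM.
Qed.

Lemma supercubic_growth r n : in_box r (x n%:R, v n%:R) ->
  exists W0 : R, potential alpha (x 0) / 2 + v 0 ^+ 2 / 2 <= W0 /\
  W0 <= ((r ^+ 2 / 2 + 2 * potential alpha r + 2 * c0) `^ g + g * P1 * c) `^ g^-1 *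
    (1 + n%:R) `^ g^-1.
Proof.
move: (alpha3) => a3; move=> [/= xr vr]; exists (W 0); split.
  by have := W_ge 0; lra.
have g0 : 0 < g by rewrite divr_gt0//; lra.
have : `|W n%:R `^ g - W 0 `^ g| <= (g * P1 * c) * `|n%:R - 0|.
  apply: (@der_lipschitz _ (fun t => W t `^ g) (fun t => g * W t `^ (g - 1) * (- (f1 t * x t)))).
    by move=> t _; exact: (der_comp (der_W t) (is_derive1_powR g (W_gt0 t))).
  by move=> t _; exact: dU_bound.
rewrite subr0 (ger0_norm (ler0n _ _)) ler_norml => /andP[h _].
have r0 : 0 <= r by exact: le_trans xr.
have v2 : v n%:R ^+ 2 <= r ^+ 2.
  by rewrite -(real_normK (num_real (v _))); apply: lerXn2r; rewrite ?nnegrE.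
have Vr : potential alpha (x n%:R) <= potential alpha r.
  by apply: potential_mono => //; rewrite (ger0_norm r0).
have c00 : 0 <= c0.
  by rewrite /c0 !addr_ge0// ?invr_ge0 ?mulr_ge0 ?sqr_ge0// ltW.
have Wn : W n%:R <= r ^+ 2 / 2 + 2 * potential alpha r + 2 * c0.
  have := fx_bound n%:R; rewrite ler_norml /W /energy/= => /andP[h1 h2].
  by have := potential_ge0 alpha3 r; lra.
have Un : W n%:R `^ g <= (r ^+ 2 / 2 + 2 * potential alpha r + 2 * c0) `^ g.
  by apply: ge0_ler_powR; rewrite ?nnegrE ?(ltW g0) ?(ltW (W_gt0 _)) ?(le_trans (ltW (W_gt0 n%:R)) Wn).
set U := (r ^+ 2 / 2 + _ + _) `^ g in Un *.
have A0 : 0 <= g * P1 * c by rewrite mulr_ge0 ?powR_ge0// mulr_ge0// ltW.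
have U0 : 0 <= U by exact: powR_ge0.
have n0 : 0 <= n%:R :> R by [].
have hU : W 0 `^ g <= (U + g * P1 * c) * (1 + n%:R).
  have := mulr_ge0 U0 n0; move: h Un; move: (g * P1 * c) A0 => A A0; lra.
rewrite -powRM ?addr_ge0//.
rewrite -[leLHS](powRr1 (ltW (W_gt0 0))) -[X in _ `^ X <= _](mulfV (negbT (gt_eqF g0))) powRrM.
apply: ge0_ler_powR => //; rewrite ?nnegrE ?invr_ge0 ?(ltW g0) ?powR_ge0//.
by apply: mulr_ge0; rewrite addr_ge0.
Qed.

End supercubic.

(** A state from which a fixed box is reached at time n lies in a box with sides of
    orders n ^ a and n ^ b, hence in a set of area o(n). If the modified energy grows at
    most like t ^ k, then a = k / (alpha + 1) and b = k / 2: for alpha = 3 one has k = 1 and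
    a + b = 3/4, for alpha > 3 one has k = (alpha + 1) / alpha and
    a + b = (alpha + 3) / (2 alpha). *)
Theorem growth alpha : 3 <= alpha -> exists a b : R, [/\ 0 <= a, 0 <= b, a + b < 1 &
  forall P P1 P2 r : R, exists2 C : R, 0 <= C & forall (f f1 f2 x v : R -> R) n,
    (forall t, `|f t| <= P) -> (forall t, `|f1 t| <= P1) -> (forall t, `|f2 t| <= P2) ->
    (forall t : R, is_derive t 1 f (f1 t)) -> (forall t : R, is_derive t 1 f1 (f2 t)) ->
    dsol alpha f x v -> in_box r (x n%:R, v n%:R) ->
    `|x 0| <= C * (1 + n%:R) `^ a /\ `|v 0| <= C * (1 + n%:R) `^ b].
Proof.
move=> a3.
suff [k [k0 k1 H]] : exists k : R, [/\ 0 <= k, k / (alpha + 1) + k / 2 < 1 &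
    forall P P1 P2 r : R, exists2 C : R, 0 <= C & forall (f f1 f2 x v : R -> R) n,
    (forall t, `|f t| <= P) -> (forall t, `|f1 t| <= P1) -> (forall t, `|f2 t| <= P2) ->
    (forall t : R, is_derive t 1 f (f1 t)) -> (forall t : R, is_derive t 1 f1 (f2 t)) ->
    dsol alpha f x v -> in_box r (x n%:R, v n%:R) ->
    exists W0 : R, potential alpha (x 0) / 2 + v 0 ^+ 2 / 2 <= W0 /\ W0 <= C * (1 + n%:R) `^ k].
  exists (k / (alpha + 1)), (k / 2); split=> //.
  - by rewrite divr_ge0//; lra.
  - by rewrite divr_ge0.
  move=> P P1 P2 r; have [C C0 HC] := H P P1 P2 r.
  pose A := (2 * (alpha + 1) * C) `^ (alpha + 1)^-1.
  pose B := (2 * C) `^ 2^-1.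
  have A0 : 0 <= A by exact: powR_ge0.
  have B0 : 0 <= B by exact: powR_ge0.
  exists (A + B); first by rewrite addr_ge0.
  move=> f f1 f2 x v n hf hf1 hf2 df df1 xv bx.
  have [W0 [h1 h2]] := HC f f1 f2 x v n hf hf1 hf2 df df1 xv bx.
  have n0 : 0 <= 1 + n%:R :> R by rewrite addr_ge0.
  have [hx hv] := energy_growth_bounds a3 C0 n0 h1 h2.
  split; [apply: le_trans hx _|apply: le_trans hv _]; rewrite ler_wpM2r ?powR_ge0//.
    by rewrite lerDl.
  by rewrite lerDr.
have [a3'|a3'] := eqVneq alpha 3.
  exists 1; split=> //; first by rewrite a3' (_ : 3 + 1 = 4 :> R); [lra|ring].
  move=> P P1 P2 r.
  pose c0 := 1 + P ^+ 2 + 1 + P1 * pi.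
  pose C := r ^+ 2 / 2 + r ^+ 4 / 4 + 3 * (c0 + r ^+ 4) + (P2 * pi + P1 * (1 + P)).
  exists `|C| => // f f1 f2 x v n hf hf1 hf2 df df1 xv bx.
  rewrite a3' in xv *.
  have [W0 [h1 h2]] := cubic_growth hf hf1 hf2 df df1 xv bx.
  exists W0; split=> //; apply: le_trans h2 _.
  by rewrite powRr1 ?addr_ge0// ler_wpM2r ?addr_ge0// ler_norm.
have a4 : 3 < alpha by rewrite lt_neqAle eq_sym a3' a3.
have g0 : 0 < alpha / (alpha + 1) by rewrite divr_gt0//; lra.
exists (alpha / (alpha + 1))^-1; split.
- by rewrite invr_ge0 ltW.
- have -> : (alpha / (alpha + 1))^-1 / (alpha + 1) + (alpha / (alpha + 1))^-1 / 2 =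
      (alpha + 3) / (2 * alpha).
    by field; rewrite !gt_eqF//; lra.
  by rewrite ltr_pdivrMr; lra.
- move=> P P1 P2 r.
  exists (((r ^+ 2 / 2 + 2 * potential alpha r +
    2 * (1 + (alpha + 1)^-1 + P ^+ 2 * (alpha + 1) / 4)) `^ (alpha / (alpha + 1)) +
    alpha / (alpha + 1) * P1 * (2 * (alpha + 1)) `^ (alpha + 1)^-1)
    `^ (alpha / (alpha + 1))^-1); first exact: powR_ge0.
  move=> f f1 f2 x v n hf hf1 hf2 df df1 xv bx.
  exact: (supercubic_growth a3 hf hf1 df xv bx).
Qed.

End adiabatic_growth.

(** * Smooth functions on the torus and the quasi-periodic forcing *)

Section smooth_torus_functions.
Context {R : realType} {N : nat}.
Implicit Types (f : 'rV[R]_N -> R) (w x y : 'rV[R]_N).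

Lemma der_of_eps (F : R -> R) (t a : R) :
  (forall e, 0 < e -> exists2 d, 0 < d &
     forall h, `|h| < d -> `|F (t + h) - F t - h * a| <= e * `|h|) ->
  is_derive t 1 F a.
Proof.
move=> H; apply/is_derive1_caratheodory.
exists (fun z => if z == t then a else (F z - F t) / (z - t)); split.
- by move=> z; case: eqP => [->|/eqP zt]; rewrite ?subrr ?mulr0// divfK// subr_eq0.
- apply/cvgrPdist_le => e e0; have [d d0 hd] := H e e0.
  near=> z; rewrite eqxx; case: eqP => [_|/eqP zt]; first by rewrite subrr normr0 ltW.
  have zt0 : z - t != 0 by rewrite subr_eq0.
  have : `|z - t| < d.
    by rewrite distrC; near: z; apply: (@nbhsx_ballx _ R^o).
  move=> /hd; rewrite subrKC => h.
  rewrite -(ler_pM2r (_ : 0 < `|z - t|)) ?normr_gt0//; apply: le_trans h.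
  by rewrite -normrM -normrN le_eqVlt; apply/orP; left; apply/eqP; congr (`|_|); field.
- by rewrite eqxx.
Unshelve. all: by end_near. Qed.

Lemma is_derive_line f x w (s : R) : derivable f (x + s *: w) w ->
  is_derive s 1 (fun r : R => f (x + r *: w)) ('D_w f (x + s *: w)).
Proof.
move=> df.
have E : (fun h : R => h^-1 *: (((fun r : R => f (x + r *: w)) \o shift s) (h *: (1 : R)) -
    f (x + s *: w))) = (fun h : R => h^-1 *: ((f \o shift (x + s *: w)) (h *: w) - f (x + s *: w))).
  apply/funext => h /=; congr (_ *: (f _ - _)).
  by rewrite scalerDl addrCA [_ *: 1]mulr1 addrA.
by split; rewrite /derivable /derive E.
Qed.

Lemma partial_mean_value f x i (c : R) :
  (forall y, derivable f y (delta_mx 0 i)) ->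
  exists2 s : R, `|s| <= `|c| & f (x + c *: delta_mx 0 i) - f x =
    c * partial i f (x + s *: delta_mx 0 i).
Proof.
move=> df; pose F r := f (x + r *: delta_mx 0 i).
have dF (r : R) : is_derive r 1 F (partial i f (x + r *: delta_mx 0 i)).
  exact: is_derive_line.
have cF (a b : R) : {within `[a, b], continuous F}.
  by apply: continuous_subspaceT => r; exact: der_continuous (dF r).
have F0 : F 0 = f x by rewrite /F scale0r addr0.
have [c0|c0] := leP 0 c.
  have [s] := MVT_segment c0 (fun r _ => dF r) (cF _ _).
  rewrite in_itv/= => /andP[s0 sc] e; exists s; first by rewrite !ger0_norm.
  by rewrite -F0 -/(F c) e subr0 mulrC.
have [s] := MVT_segment (ltW c0) (fun r _ => dF r) (cF _ _).
rewrite in_itv/= => /andP[s0 sc] e; exists s.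
  by rewrite !ler0_norm ?lerN2// ltW.
by rewrite -F0 -/(F c) -opprB e; ring.
Qed.

Lemma Ck_continuous k f : Ck k f -> continuous f.
Proof. by case: k => [|k] // []. Qed.

Lemma CkW k f : Ck k.+1 f -> Ck k f.
Proof.
elim: k f => [|k IH] f [cf df]; first by [].
by split=> // i; have [d1 d2] := df i; split=> //; exact: IH.
Qed.

(** Move along the coordinates one at a time. By the mean value theorem each
    increment is a partial derivative at a nearby point, and partial derivatives are
    continuous. *)
Lemma partial_sum_increment f x (s : seq 'I_N) w : Ck 1 f ->
  forall e, 0 < e -> exists2 d, 0 < d & forall h : R, `|h| < d ->
    `|f (x + h *: \sum_(j <- s) w 0 j *: delta_mx 0 j) - f x -
      h * \sum_(j <- s) w 0 j * partial j f x| <= e * `|h|.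
Proof.
move=> [cf df]; elim: s => [|i s IH] e e0.
  exists 1 => // h _; rewrite !big_nil scaler0 addr0 subrr mulr0 subrr normr0.
  by rewrite mulr_ge0// ltW.
have [di ci] := df i.
have e2 : 0 < e / 2 by rewrite divr_gt0.
have [d1 d10 h1] := IH (e / 2) e2.
pose S := \sum_(j <- s) w 0 j *: delta_mx 0 j : 'rV[R]_N.
pose D := delta_mx 0 i : 'rV[R]_N.
have e3 : 0 < e / (2 * (`|w 0 i| + 1)).
  by rewrite divr_gt0// mulr_gt0// ltr_wpDl.
have /cvgrPdist_le/(_ _ e3) := ci x.
move=> /nbhs_ballP[d2 /= d20 h2].
pose C := `|S| + `|w 0 i| * `|D| + 1.
have C0 : 0 < C by rewrite /C ltr_wpDl// addr_ge0// mulr_ge0.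
exists (Num.min d1 (d2 / C)); first by rewrite lt_min d10 divr_gt0.
move=> h; rewrite lt_min => /andP[hd1 hd2].
rewrite !big_cons -/S -/D.
have [s0 sh] := partial_mean_value (x + h *: S) (h * w 0 i) di.
rewrite -/D => mv.
have -> : x + h *: (w 0 i *: D + S) = x + h *: S + (h * w 0 i) *: D.
  by rewrite scalerDr scalerA addrA addrAC.
have -> : forall a b c d, a - b - h * (c + d) = (a - f (x + h *: S) - h * c) +
  (f (x + h *: S) - b - h * d) :> R by move=> *; ring.
rewrite mv (splitr e) mulrDl; apply: le_trans (ler_normD _ _) _; apply: lerD; last exact: h1.
have -> : forall a b, h * w 0 i * a - h * (w 0 i * b) = h * (w 0 i * (a - b)) :> R.
  by move=> *; ring.
rewrite normrM mulrC ler_wpM2r// normrM.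
have : `|partial i f (x + h *: S + s0 *: D) - partial i f x| <= e / (2 * (`|w 0 i| + 1)).
  rewrite distrC; apply: h2; rewrite -ball_normE /ball_/=.
  rewrite (_ : x - _ = - (h *: S + s0 *: D)); last by rewrite -addrA opprD addrA subrr add0r.
  rewrite normrN; apply: le_lt_trans (ler_normD _ _) _; rewrite !normrZ.
  move: hd2; rewrite ltr_pdivlMr//; apply: le_lt_trans.
  rewrite /C !mulrDr mulr1; rewrite -addrA lerD2l.
  apply: le_trans (_ : `|h| * (`|w 0 i| * `|D|) <= _); last by rewrite lerDl.
  by rewrite mulrA -normrM ler_wpM2r.
move=> h3; apply: le_trans (_ : `|w 0 i| * (e / (2 * (`|w 0 i| + 1))) <= _).
  by rewrite ler_wpM2l.
rewrite mulrA ler_pdivrMr ?mulr_gt0 ?ltr_wpDl//.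
by have := normr_ge0 (w 0 i); nra.
Qed.

Theorem der_along_line f x w (t : R) : Ck 1 f ->
  is_derive t 1 (fun s : R => f (x + s *: w)) (\sum_j w 0 j * partial j f (x + t *: w)).
Proof.
move=> cf; apply: der_of_eps => e e0.
have [d d0 hd] := partial_sum_increment (x + t *: w) (index_enum 'I_N) w cf e0.
exists d => // h /hd.
by rewrite -row_sum_delta scalerDl addrA.
Qed.

Lemma partial_periodic i f : periodic1 f -> periodic1 (partial i f).
Proof.
move=> pf x j; rewrite /partial /derive.
have -> : (fun h : R => h^-1 *: ((f \o shift (x + delta_mx 0 j)) (h *: delta_mx 0 i) -
    f (x + delta_mx 0 j))) =
  (fun h : R => h^-1 *: ((f \o shift x) (h *: delta_mx 0 i) - f x)).
  by apply/funext => h; rewrite /= addrA !pf.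
by [].
Qed.

Lemma periodic_int f x i (k : int) : periodic1 f -> f (x + k%:~R *: delta_mx 0 i) = f x.
Proof.
move=> pf; have nat_case y (n : nat) : f (y + n%:R *: delta_mx 0 i) = f y.
  elim: n => [|n IH]; first by rewrite scale0r addr0.
  by rewrite -natr1 scalerDl scale1r addrA pf.
case: k => n; first exact: nat_case.
have -> : (Negz n)%:~R = - n.+1%:R :> R by rewrite NegzE mulrNz.
by rewrite scaleNr -(nat_case (x - n.+1%:R *: delta_mx 0 i) n.+1) subrK.
Qed.

Lemma periodic_int_vector f x (k : 'I_N -> int) (s : seq 'I_N) : periodic1 f ->
  f (x + \sum_(i <- s) (k i)%:~R *: delta_mx 0 i) = f x.
Proof.
move=> pf; elim: s => [|i s IH]; first by rewrite big_nil addr0.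
by rewrite big_cons addrCA addrC periodic_int.
Qed.

Lemma periodic_shift f x (k : 'I_N -> int) : periodic1 f ->
  f (x + \row_i (k i)%:~R) = f x.
Proof.
move=> pf; rewrite -(periodic_int_vector x k (index_enum 'I_N) pf).
congr (f (_ + _)); rewrite [LHS]row_sum_delta.
by apply: eq_bigr => i _; rewrite mxE.
Qed.

(** All values are taken on the unit cube, which is compact. *)
Lemma continuous_periodic_bounded f : continuous f -> periodic1 f ->
  exists M, forall x, `|f x| <= M.
Proof.
move=> cf pf.
have cK : compact [set x : 'rV[R]_N | forall i, `[0, 1]%classic (x ord0 i)].
  by apply: (@rV_compact R N (fun=> `[0, 1]%classic)) => _; exact: segment_compact.
have : compact (f @` [set x : 'rV[R]_N | forall i, `[0, 1]%classic (x ord0 i)]).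
  by apply: continuous_compact => //; exact: continuous_subspaceT.
move=> /compact_bounded[M [_ hM]].
exists (M + 1) => x.
pose k i := - Num.floor (x 0 i).
rewrite -(periodic_shift x k pf).
apply: (hM (M + 1)); first by rewrite ltrDl.
exists (x + \row_i (k i)%:~R) => //= i.
rewrite !mxE /k in_itv/= mulrNz subr_ge0 floor_le lerBlDr addrC ltW//.
by have := floorD1_gt (x 0 i); rewrite intrD.
Qed.

(** Makes the supremum that defines Ck_norm a genuine one. *)
Lemma Ck_words_bounded k f : Ck k f -> periodic1 f -> exists M,
  forall s x, (size s <= k)%N -> `|foldr partial f s x| <= M.
Proof.
elim: k f => [|k IH] f hf pf.
  have [M hM] := continuous_periodic_bounded hf pf.
  by exists M => s x; rewrite leqn0 => /nilP ->.
have [M hM] := continuous_periodic_bounded (Ck_continuous hf) pf.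
have /choice[Mi hMi] : forall i, exists Mi, forall s x, (size s <= k)%N ->
    `|foldr partial (partial i f) s x| <= Mi.
  by move=> i; apply: IH; [exact: (hf.2 i).2|exact: partial_periodic].
have S0 : 0 <= \sum_i `|Mi i| by apply: sumr_ge0.
exists (`|M| + \sum_i `|Mi i|) => s x; case/lastP: s => [_|s i].
  by apply: le_trans (hM x) _; apply: le_trans (ler_norm _) _; rewrite lerDl.
rewrite size_rcons ltnS foldr_rcons => sk; apply: le_trans (hMi i s x sk) _.
apply: le_trans (ler_norm _) _; rewrite (bigD1 i)//= addrCA lerDl addr_ge0//.
exact: sumr_ge0.
Qed.

Lemma Ck_norm_ge k f s x : Ck_torus k f -> (size s <= k)%N ->
  `|foldr partial f s x| <= Ck_norm k f.
Proof.
move=> [hf pf] sk; have [M hM] := Ck_words_bounded hf pf.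
apply: sup_upper_bound; last by exists s, x.
split; first by exists `|foldr partial f s x|, s, x.
by exists M => _ [s' [x' [sk' ->]]]; exact: hM.
Qed.

End smooth_torus_functions.

Section quasi_periodic_forcing.
Context {R : realType} {N : nat}.
Variables (p : 'rV[R]_N -> R) (omega : 'rV[R]_N).
Hypothesis hp : Ck_torus 4 p.
Implicit Types (Theta : 'rV[R]_N).

Let pc : Ck 4 p := hp.1.
Let pp : periodic1 p := hp.2.

Definition forcing_d1 Theta (t : R) : R :=
  \sum_i omega 0 i * partial i p (Theta + t *: omega).
Definition forcing_d2 Theta (t : R) : R :=
  \sum_i omega 0 i * \sum_j omega 0 j * partial j (partial i p) (Theta + t *: omega).

Lemma der_forcing Theta (t : R) :
  is_derive t 1 (forcing p omega Theta) (forcing_d1 Theta t).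
Proof. by apply: der_along_line; do 3 apply: CkW. Qed.

Lemma der_forcing_d1 Theta (t : R) :
  is_derive t 1 (forcing_d1 Theta) (forcing_d2 Theta t).
Proof.
have d i : is_derive t 1 (fun s : R => omega 0 i * partial i p (Theta + s *: omega))
    (omega 0 i * \sum_j omega 0 j * partial j (partial i p) (Theta + t *: omega)).
  apply: derZ; apply: der_along_line; do 2 apply: CkW; exact: (pc.2 i).2.
have := is_derive_sum d.
by congr is_derive; apply/funext => s; rewrite fct_sumE.
Qed.

Lemma forcing_bounds : exists P1 P2 : R, forall Theta t,
  `|forcing_d1 Theta t| <= P1 /\ `|forcing_d2 Theta t| <= P2.
Proof.
pose M := Ck_norm 4 p; pose S := \sum_i `|omega 0 i|.
have M0 : 0 <= M by apply: le_trans (Ck_norm_ge (s := [::]) 0 hp isT).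
exists (S * M), (S * (S * M)) => Theta t; split.
  apply: le_trans (ler_norm_sum _ _ _) _; rewrite mulr_suml; apply: ler_sum => i _.
  by rewrite normrM ler_wpM2l//; exact: (Ck_norm_ge (s := [:: i])).
apply: le_trans (ler_norm_sum _ _ _) _; rewrite [X in _ <= X]mulr_suml; apply: ler_sum => i _.
rewrite normrM ler_wpM2l//.
apply: le_trans (ler_norm_sum _ _ _) _; rewrite mulr_suml; apply: ler_sum => j _.
by rewrite normrM ler_wpM2l//; exact: (Ck_norm_ge (s := [:: j; i])).
Qed.

Lemma forcing_tame : exists L, forall Theta, tame (Ck_norm 4 p) L (forcing p omega Theta).
Proof.
have [P1 [P2 h]] := forcing_bounds; exists P1 => Theta; split=> [t|s t].
  exact: (Ck_norm_ge (s := [::])).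
apply: (@der_lipschitz _ _ (forcing_d1 Theta)) => r _; first exact: der_forcing.
by have [] := h Theta r.
Qed.

Lemma forcing_shift Theta s t :
  forcing p omega (Theta + s *: omega) t = forcing p omega Theta (t + s).
Proof. by rewrite /forcing -addrA -scalerDl [s + t]addrC. Qed.

Lemma forcing_periodic Theta (k : 'I_N -> int) :
  forcing p omega (Theta + \row_i (k i)%:~R) = forcing p omega Theta.
Proof.
apply/funext => t; rewrite /forcing addrAC; exact: periodic_shift.
Qed.

End quasi_periodic_forcing.

(** * Rotations of the torus *)

Section torus_rotation.
Context {R : realType}.
Local Notation T := (measurableTypeR R).
Local Notation leb := (@lebesgue_measure R).
Local Open Scope ereal_scope.

Definition frac (x : R) : R := (x - (Num.floor x)%:~R)%R.

Lemma frac_ge0 x : (0 <= frac x)%R.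
Proof. by rewrite subr_ge0 floor_le. Qed.

Lemma frac_lt1 x : (frac x < 1)%R.
Proof. by rewrite ltrBlDl; have := floorD1_gt x; rewrite intrD. Qed.

Lemma measurable_frac : measurable_fun setT frac.
Proof.
apply: measurable_funB; first exact: measurable_id.
move=> _ B mB; rewrite setTI.
have -> : (fun x : R => (Num.floor x)%:~R%R) @^-1` B = \bigcup_(k in [set: int])
    (`[k%:~R, (k + 1)%:~R[%classic `&` [set x | B (k%:~R : R)%R]).
  apply/seteqP; split=> [x /= Bx|x [k _ [/= kx Bk]]].
    by exists (Num.floor x) => //; split=> //=; rewrite in_itv/= floor_le floorD1_gt.
  by rewrite (_ : Num.floor x = k)//; apply/floor_def; move: kx; rewrite in_itv.
apply: countable_bigcupT_measurable => // k; apply: measurableI; first exact: measurable_itv.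
have [Bk|Bk] := pselect (B (k%:~R)%R).
  by rewrite (_ : [set _ | _] = setT)//; apply/seteqP; split.
by rewrite (_ : [set _ | _] = set0)//; apply/seteqP; split.
Qed.

Lemma uniform_lebesgue (A : set T) : measurable A ->
  uniform_prob (@ltr01 R) A = leb (A `&` `[0%R, 1%R[%classic).
Proof.
move=> mA; rewrite /uniform_prob integral_uniform_pdf.
have m1 : measurable (A `&` `[0%R, 1%R]%classic) by apply: measurableI => //; exact: measurable_itv.
have m2 : measurable (A `&` `[0%R, 1%R[%classic) by apply: measurableI => //; exact: measurable_itv.
rewrite (eq_integral (fun=> 1)); last first.
  move=> x; rewrite inE/= => -[_]; rewrite in_itv/= /uniform_pdf => ->.
  by rewrite subr0 invr1.
rewrite integral_cst// mul1e.
apply/eqP; rewrite eq_le; apply/andP; split; last first.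
  apply: le_measure; rewrite ?inE//; apply: setIS => x/=; rewrite !in_itv/=.
  by move=> /andP[-> /ltW].
apply: le_trans (_ : leb ((A `&` `[0%R, 1%R[%classic) `|` [set 1%R]) <= _).
  apply: le_measure; rewrite ?inE//.
    by apply: measurableU => //; exact: measurable_set1.
  move=> x/= [Ax]; rewrite !in_itv/= => /andP[x0].
  by rewrite le_eqVlt => /predU1P[->|x1]; [right|left; rewrite x0].
apply: le_trans (measureU2 _ _ _) _ => //.
rewrite [X in _ + X](_ : _ = 0) ?adde0//; exact: lebesgue_measure_set1.
Qed.

(** The rotation cuts the unit interval in two and translates the pieces. *)
Lemma rotation_uniform_preserving (w : R) :
  measure_preserving (uniform_prob (@ltr01 R)) (fun u : T => frac (u + w)%R : T).
Proof.
have mr : measurable_fun (setT : set T) (fun u : T => frac (u + w)%R : T).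
  apply: (measurableT_comp measurable_frac).
  by apply: measurable_funD; [exact: measurable_id|exact: measurable_cst].
split=> // A mA; rewrite !uniform_lebesgue//; last exact: measurable_preimage.
pose w0 := frac w; have w00 : (0 <= w0)%R := frac_ge0 w; have w01 : (w0 < 1)%R := frac_lt1 w.
have fE (u : R) (k : int) : (0 <= u + w0 - k%:~R < 1)%R -> frac (u + w) = (u + w0 - k%:~R)%R.
  move=> h; rewrite /frac (_ : Num.floor (u + w) = (Num.floor w + k)%R).
    by rewrite intrD /w0 /frac; ring.
  by apply: floor_def; rewrite !intrD; move: h; rewrite /w0 /frac; lra.
have f0 (u : R) : (0 <= u + w0 < 1)%R -> frac (u + w) = (u + w0)%R.
  by move=> h; rewrite (fE u 0%R) subr0.
have f1 (u : R) : (0 <= u + (w0 - 1) < 1)%R -> frac (u + w) = (u + (w0 - 1))%R.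
  by move=> h; rewrite (fE u 1%R) -addrA.
pose A1 := A `&` `[w0, 1%R[%classic; pose A2 := A `&` `[0%R, w0[%classic.
have mA1 : measurable A1 by apply: measurableI => //; exact: measurable_itv.
have mA2 : measurable A2 by apply: measurableI => //; exact: measurable_itv.
have mtr c B : measurable (B : set T) -> measurable ((fun x : R => (x + c)%R) @^-1` B : set T).
  move=> mB; apply: (@measurable_preimage _ _ T T (fun x : R => (x + c)%R)) => //.
  by apply: measurable_funD; [exact: measurable_id|exact: measurable_cst].
have -> : ((fun u : T => frac (u + w)%R : T) @^-1` A) `&` `[0%R, 1%R[%classic =
    ((fun x : R => (x + w0)%R) @^-1` A1) `|` ((fun x : R => (x + (w0 - 1))%R) @^-1` A2).
  apply/seteqP; split=> u; rewrite /A1 /A2/= !in_itv/=.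
    move=> [Au /andP[u0 u1]]; have [h|h] := ltP (u + w0)%R 1%R.
      left; split; last by lra.
      by rewrite -f0//; lra.
    right; split; last by lra.
    by rewrite -f1//; lra.
  move=> [[Au h]|[Au h]].
    by split; [rewrite f0//; lra|lra].
  by split; [rewrite f1//; lra|lra].
rewrite measureU; last 3 first.
- exact: mtr.
- exact: mtr.
- by apply/seteqP; split=> u //=; rewrite /A1 /A2/= !in_itv/= => -[[_ h] [_ h']]; lra.
transitivity (leb A1 + leb A2).
  by congr (_ + _); exact: lebesgue_translation.
rewrite -measureU//.
  congr (leb _); apply/seteqP; split=> u; rewrite /A1 /A2/= !in_itv/=.
    by move=> [[? ?]|[? ?]]; split=> //; lra.
  move=> [Au h]; have [hw|hw] := ltP u w0.
    by right; split=> //; lra.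
  by left; split=> //; lra.
by apply/seteqP; split=> u //=; rewrite /A1 /A2/= !in_itv/= => -[[_ h] [_ h']]; lra.
Qed.

Definition rotate (N : nat) (w : 'I_N -> R) (theta : N.-tuple T) : N.-tuple T :=
  [tuple (frac (tnth theta i + w i)%R : T) | i < N].

Lemma measurable_rotate N (w : 'I_N -> R) : measurable_fun setT (rotate w).
Proof.
apply/measurable_fun_tnthP => i.
have -> : (@tnth N T ^~ i \o rotate w) = (fun theta => frac (tnth theta i + w i)%R).
  by apply/funext => theta; rewrite /= tnth_mktuple.
apply: (measurableT_comp measurable_frac); apply: measurable_funD.
  exact: measurable_tnth.
exact: measurable_cst.
Qed.

Theorem rotate_preserving N (w : 'I_N -> R) :
  measure_preserving (@haar_torus R N) (rotate w).
Proof.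
split; first exact: measurable_rotate.
elim: N w => [|n IH] w A mA.
  by congr (_ _); apply/seteqP; split=> t /=; rewrite [rotate _ _]tuple0 [t]tuple0.
pose w' i := w (lift ord0 i).
pose F (z : T * n.-tuple T) : T * n.-tuple T := (frac (z.1 + w ord0)%R, rotate w' z.2).
have mF : measurable_fun setT F.
  apply: measurable_fun_pair.
    apply: (measurableT_comp measurable_frac).
    by apply: measurable_funD; [exact: measurable_fst|exact: measurable_cst].
  exact: (measurableT_comp (measurable_rotate w') measurable_snd).
have [_ pF] : measure_preserving (uniform_prob (@ltr01 R) \x haar_torus n)%E F.
  apply: (@skew_product_preserving R _ _ _ _ (uniform_prob (@ltr01 R)) (@haar_torus R n)
    (fun u : T => frac (u + w ord0)%R : T) (fun _ => rotate w')) => //.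
    exact: rotation_uniform_preserving.
  by move=> _ B mB; exact: IH.
have cE z : rotate w (cons_pair z) = cons_pair (F z).
  apply: eq_from_tnth => i; rewrite tnth_mktuple.
  case: (unliftP ord0 i) => [j|] ->; last by rewrite !tnth0.
  by rewrite !tnthS tnth_mktuple.
have mc : measurable (@cons_pair R n @^-1` A : set (T * n.-tuple T)).
  by apply: measurable_preimage => //; exact: measurable_cons_pair.
rewrite /= /distribution /pushforward -(pF _ mc); congr (_ _).
by apply/seteqP; split=> z /=; rewrite cE.
Qed.

End torus_rotation.

Section torus_measurability.
Context {R : realType} {N : nat}.
Local Notation T := (measurableTypeR R).

(** A continuous function of measurable coordinates, of which those of index at least
    m are constant. By induction on m: the coordinate of index m is first frozen, then
    let vary by measurable_caratheodory. *)
Lemma measurable_continuous_row d (Y : measurableType d) (f : 'rV[R]_N -> R)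
    (q : 'I_N -> Y -> R) : continuous f ->
  (forall i, measurable_fun setT (q i)) ->
  measurable_fun setT (fun y => f (\row_i q i y)).
Proof.
move=> cf mq.
suff H m : forall q : 'I_N -> Y -> R, (forall i, measurable_fun setT (q i)) ->
    (forall i : 'I_N, (m <= i)%N -> exists c, q i = cst c) ->
    measurable_fun setT (fun y => f (\row_i q i y)).
  by apply: (H N) => // i; rewrite leqNgt ltn_ord.
elim: m => [|m IH] {mq}q mq hq.
  have /choice[c hc] : forall i, exists c, q i = cst c by move=> i; exact: hq.
  rewrite (_ : (fun y => _) = cst (f (\row_i c i))); first exact: measurable_cst.
  by apply/funext => y; congr f; apply/rowP => i; rewrite !mxE hc.
have [mN|Nm] := ltnP m N; last first.
  apply: IH => // i mi; exfalso; have := ltn_ord i.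
  by rewrite ltnNge (leq_trans Nm mi).
pose i0 := Ordinal mN.
pose q' (s : R) i := if i == i0 then cst s else q i.
rewrite (_ : (fun y => _) = (fun y => f (\row_i q' (q i0 y) i y))); last first.
  apply/funext => y; congr f; apply/rowP => i; rewrite !mxE /q'.
  by case: eqP => [->|].
apply: (@measurable_caratheodory R _ Y (fun s y => f (\row_i q' s i y)) (q i0)) => //.
  move=> s; apply: IH => i; rewrite /q'; first by case: eqP => // _; exact: measurable_cst.
  case: eqP => [_ _|ii mi]; first by exists s.
  apply: hq; rewrite ltn_neqAle mi andbT; apply/eqP => e; apply: ii.
  exact/val_inj.
move=> y s; apply: (@continuous_comp _ _ _ (fun s => \row_i q' s i y) f); last exact: cf.
have -> : (fun s : R => \row_i q' s i y) =
    (fun s : R => (\row_i (if i == i0 then 0 else q i y)) + s *: delta_mx 0 i0).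
  apply/funext => r; apply/rowP => i; rewrite !mxE eqxx/= /q' eq_sym.
  by case: eqP => [_|_]; rewrite ?mulr1 ?add0r ?mulr0 ?addr0.
apply: cvgD; first exact: cvg_cst.
by apply: cvgZ; [exact: cvg_id|exact: cvg_cst].
Qed.

End torus_measurability.

(** * Null sets *)

Section null_sets.
Context {R : realType}.
Local Notation T := (measurableTypeR R).
Local Notation leb := (@lebesgue_measure R).
Local Notation leb2 := (@lebesgue2 R).
Local Open Scope ereal_scope.

Lemma null_sections d1 d2 (T1 : measurableType d1) (T2 : measurableType d2)
    (m1 : {measure set T1 -> \bar R}) (m2 : {sigma_finite_measure set T2 -> \bar R})
    (A : set (T1 * T2)) : measurable A ->
  (m1 \x m2) A = 0 <-> {ae m1, forall x, m2 (xsection A x) = 0}.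
Proof.
move=> mA; have ms := measurable_fun_xsection m2 mA.
have e : \int[m1]_x `|(m2 \o xsection A) x| = (m1 \x m2) A.
  by apply: eq_integral => x _; rewrite gee0_abs.
rewrite -e; split.
  by move=> /(ae_eq_integral_abs _ measurableT ms); apply: filterS => x; exact.
by move=> h; apply/(ae_eq_integral_abs _ measurableT ms); apply: filterS h => x h _.
Qed.

Lemma swap_null (A : set (T * T)) : measurable A -> leb2 A = 0 ->
  measurable [set z : T * T | A (z.2, z.1)] /\ leb2 [set z : T * T | A (z.2, z.1)] = 0.
Proof.
move=> mA A0; split; last by rewrite -[RHS]A0; exact: (swap_preserving mA).
by apply: (measurable_preimage (F := fun z : T * T => (z.2, z.1))) => //;
  exact: measurable_fun_pair.
Qed.

(** The points of I that an expanding map sends to an interval lie in an interval at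
    most 2 / c times as long; A is covered by intervals of arbitrarily small total
    length. *)
Lemma expanding_null (phi : R -> R) (I A : set T) (c : R) : (0 < c)%R ->
  measurable I -> measurable_fun (setT : set T) (phi : T -> T) ->
  (forall a b : R, I a -> I b -> (c * `|a - b| <= `|phi a - phi b|)%R) ->
  measurable A -> leb A = 0 -> leb (I `&` [set x : T | A (phi x)]) = 0.
Proof.
move=> c0 mI mphi exp mA A0.
have mpre (J : set T) : measurable J -> measurable (I `&` [set x : T | J (phi x)]).
  by move=> mJ; apply: measurableI => //; exact: (measurable_preimage mphi mJ).
have small (J : set T) : ocitv J ->
    leb (I `&` [set x : T | J (phi x)]) <= (2 / c)%:E * leb J.
  move=> /ocitvP[->|[[a b] /= ab ->]].
    by rewrite (_ : _ `&` _ = set0) ?measure0 ?mule0// -subset0 => x [].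
  rewrite (lebesgue_ocitv (ltW ab)) -EFinM.
  pose B := I `&` [set x : T | `]a, b]%classic (phi x)].
  suff : leb B <= (2 / c * (b - a))%:E by [].
  have mB : measurable B by apply: mpre; exact: measurable_itv.
  have [B0|/set0P[q [Iq]]] := eqVneq B set0.
    by rewrite B0 measure0 lee_fin mulr_ge0 ?divr_ge0 ?subr_ge0// ltW.
  rewrite /= in_itv/= => /andP[qa qb].
  pose l := ((b - a) / c)%R.
  have cl : (c * l = b - a)%R by rewrite /l; field; rewrite gt_eqF.
  have l0 : (0 < l)%R by rewrite divr_gt0// subr_gt0.
  have -> : (2 / c * (b - a) = 2 * l)%R by rewrite /l; field; rewrite gt_eqF.
  have ball (y : R) : (2 * l)%:E = leb `[(y - l)%R, (y + l)%R]%classic.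
    have yl : (y - l < y + l)%R by lra.
    by rewrite lebesgue_measure_itv/= lte_fin yl -EFinB; congr (_%:E); ring.
  rewrite (ball q); apply: le_measure; rewrite ?inE//.
  have near (x y : R) : (`|x - y| <= l)%R -> (y - l <= x <= y + l)%R.
    by rewrite ler_norml => /andP[? ?]; apply/andP; split; lra.
  move=> x [Ix]; rewrite /= !in_itv/= => /andP[xa xb]; apply: near.
  rewrite -(ler_pM2l c0) cl; apply: le_trans (exp x q Ix Iq) _.
  by rewrite ler_norml; apply/andP; split; lra.
apply/eqP; rewrite eq_le measure_ge0 andbT; apply/lee_addgt0Pr => e e0; rewrite add0e.
pose e' := (e * c / 2)%R.
have e'0 : (0 < e')%R by rewrite divr_gt0// mulr_gt0.
have /ereal_inf_lt[z [/= M covM sM ze]] : leb A < e'%:E by rewrite A0 lte_fin.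
have [oM AM] := covM.
have mM k : measurable (M k : set T) by apply: sub_sigma_algebra; exact: oM.
apply: le_trans (_ : \sum_(k <oo) (2 / c)%:E * leb (M k) <= _).
  apply: le_trans (_ : \sum_(k <oo) leb (I `&` [set x : T | M k (phi x)]) <= _).
    apply: measure_sigma_subadditive.
    - by move=> k; exact: mpre.
    - exact: mpre.
    - by move=> x [Ix /AM[k _ Mk]]; exists k.
  by apply: lee_nneseries => [k _ _|k _]; [exact: measure_ge0|exact: small (oM k)].
rewrite nneseriesZl//.
have lt : \sum_(k <oo) leb (M k) <= e'%:E.
  apply/ltW; apply: le_lt_trans ze; rewrite -sM.
  rewrite le_eqVlt; apply/orP; left; apply/eqP; apply: eq_eseriesr => k _.
  exact: (measurable_mu_extE _ (oM k)).
apply: le_trans (lee_pmul _ _ (lexx (2 / c)%:E) lt) _.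
- by rewrite lee_fin divr_ge0// ltW.
- by apply: nneseries_ge0 => k _ _; exact: measure_ge0.
- by rewrite -EFinM lee_fin /e' le_eqVlt; apply/orP; left; apply/eqP; field; rewrite gt_eqF.
Qed.

Lemma expanding_plane_null (phi : R -> R) (I : set T) (A : set (T * T)) (c : R) : (0 < c)%R ->
  measurable I -> measurable_fun (setT : set T) (phi : T -> T) ->
  (forall a b : R, I a -> I b -> (c * `|a - b| <= `|phi a - phi b|)%R) ->
  measurable A -> leb2 A = 0 ->
  measurable [set z : T * T | I z.2 /\ A (z.1, phi z.2)] /\
  leb2 [set z : T * T | I z.2 /\ A (z.1, phi z.2)] = 0.
Proof.
move=> c0 mI mphi exp mA A0; set B := [set z : T * T | _].
have mB : measurable B.
  apply: measurableI; first exact: (measurable_preimage (@measurable_snd _ _ T T)).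
  apply: (measurable_preimage (F := fun z : T * T => (z.1, phi z.2 : T))) => //.
  apply: measurable_fun_pair => //; exact: measurableT_comp mphi measurable_snd.
split=> //; apply/(null_sections leb leb mB).
move: A0 => /(null_sections leb leb mA); apply: filterS => t At.
rewrite (_ : xsection B t = I `&` [set x : T | xsection A t (phi x)]).
  by apply: (expanding_null c0) => //; exact: measurable_xsection.
by apply/seteqP; split=> x; rewrite /xsection/= !inE.
Qed.

(** The pairs (t, x) whose section in v has positive measure form a set with null
    sections over each t. By Fubini and an exchange of coordinates, for almost every x
    almost every t has a null section in v. *)
Lemma almost_every_slice (C : set (T * (T * T))) : measurable C ->
  (forall t, leb2 (xsection C t) = 0) ->
  {ae leb, forall x, leb2 [set z : T * T | C (z.1, (x, z.2))] = 0}.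
Proof.
move=> mC C0.
pose C' := [set z : (T * T) * T | C (z.1.1, (z.1.2, z.2))].
have mC' : measurable C'.
  apply: (measurable_preimage (F := fun z : (T * T) * T => (z.1.1, (z.1.2, z.2)))) => //.
  apply: measurable_fun_pair.
    exact: (measurableT_comp (@measurable_fst _ _ T T) (@measurable_fst _ _ (T * T)%type T)).
  apply: measurable_fun_pair; last exact: measurable_snd.
  exact: (measurableT_comp (@measurable_snd _ _ T T) (@measurable_fst _ _ (T * T)%type T)).
have mh := measurable_fun_xsection leb mC'.
pose G := [set z : T * T | leb (xsection C' z) != 0].
have mG : measurable G by rewrite -[G]setTI; exact: emeasurable_neq.
have sec t x : xsection C' (t, x) = xsection (xsection C t) x.
  by apply/seteqP; split=> v; rewrite /xsection/= !inE/= inE.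
have G0 : leb2 G = 0.
  apply/(null_sections leb leb mG); apply: nearW => t.
  apply: measure_negligible; first exact: measurable_xsection.
  have /(null_sections leb leb (measurable_xsection t mC)) := C0 t.
  apply: negligibleS => x; rewrite /xsection/= inE /G/= sec => /eqP + h.
  by apply; rewrite h.
have [mG' G'0] := swap_null mG G0.
move: G'0 => /(null_sections leb leb mG'); apply: filterS => x Gx.
have mD : measurable [set z : T * T | C (z.1, (x, z.2))].
  apply: (measurable_preimage (F := fun z : T * T => (z.1, (x, z.2)))) => //.
  apply: measurable_fun_pair => //; apply: measurable_fun_pair => //.
apply/(null_sections leb leb mD).
exists (xsection [set z : T * T | G (z.2, z.1)] x); split=> //.
  exact: measurable_xsection.
move=> t /= h; rewrite /xsection/= inE; apply/eqP => h0; apply: h; rewrite -[RHS]h0 sec.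
by congr (leb _); apply/seteqP; split=> v; rewrite /xsection/= !inE/= inE.
Qed.

Lemma ae_exists_unit (Q : R -> Prop) : {ae leb, forall x, Q x} ->
  exists x : R, (0 < x < 1)%R /\ Q x.
Proof.
move=> [M [mM M0 QM]]; apply: contrapT => h.
have : leb `]0%R, 1%R]%classic <= leb (M `|` [set 1%R]).
  apply: le_measure; rewrite ?inE//; first exact: measurableU.
  move=> x; rewrite /= in_itv/= => /andP[x0 x1].
  have [->|x1'] := eqVneq x 1%R; first by right.
  left; apply: QM => /= Qx; apply: h; exists x; split=> //.
  by rewrite x0 lt_neqAle x1'.
have h1 : leb [set (1%R : R)] = 0 by exact: lebesgue_measure_set1.
have h2 : leb (M `|` [set 1%R]) <= leb M + leb [set (1%R : R)].
  exact: (measureU2 leb mM (measurable_set1 _)).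
move: h2; rewrite M0 h1 adde0 => h2 /le_trans/(_ h2).
by rewrite lebesgue_ocitv// subr0 lee_fin ler10.
Qed.

End null_sets.

(** * Wandering sets and escaping states *)

Section wandering_sets.
Context {R : realType}.

Lemma sublinear_eq0 (c K k : R) : 0 <= c -> 0 <= K -> 0 <= k -> k < 1 ->
  (forall m : nat, m%:R * c <= K * (1 + m%:R) `^ k) -> c = 0.
Proof.
move=> c0 K0 k0 k1 H; apply/eqP; rewrite eq_le c0 andbT leNgt; apply/negP => cp.
pose B := (2 * K / c + 1) `^ (1 - k)^-1.
have k1' : 0 < 1 - k by lra.
have q0 : 0 < 2 * K / c + 1.
  by rewrite ltr_wpDl// divr_ge0 ?mulr_ge0// ltW.
pose m := (Num.truncn B).+1.
have Bm : B < m%:R by exact: truncnS_gt.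
have m1 : 1 <= m%:R :> R by rewrite ler1n.
have hB : B `^ (1 - k) = 2 * K / c + 1.
  by rewrite -powRrM mulVf ?gt_eqF// powRr1// ltW.
have h1 : 2 * K / c + 1 <= (1 + m%:R) `^ (1 - k).
  rewrite -hB; apply: ge0_ler_powR; rewrite ?nnegrE ?powR_ge0//; lra.
have e : (1 + m%:R) `^ (1 - k) * (1 + m%:R) `^ k = 1 + m%:R :> R.
  rewrite -powRD; last by apply/implyP => _; rewrite gt_eqF// ltr_wpDr.
  by rewrite subrK powRr1// addr_ge0.
have p0 : 0 < (1 + m%:R) `^ k :> R by rewrite powR_gt0// ltr_wpDr.
have := H m; apply/negP; rewrite -ltNge.
have h2 : (2 * K / c + 1) * (1 + m%:R) `^ k <= 1 + m%:R by rewrite -[leRHS]e ler_pM2r.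
have h3 : (2 * K + c) * (1 + m%:R) `^ k <= (1 + m%:R) * c.
  rewrite -(ler_pM2r cp) in h2; apply: le_trans h2.
  rewrite le_eqVlt; apply/orP; left; apply/eqP; field.
  by rewrite gt_eqF.
have : 0 < c * (1 + m%:R) `^ k by rewrite mulr_gt0.
have : (1 + m%:R) * c <= 2 * (m%:R * c) by nra.
move: h3; rewrite mulrDl; move: ((1 + m%:R) `^ k) => X; lra.
Qed.

Local Open Scope ereal_scope.

(** The preimages of a wandering set W are disjoint and have the measure of W. If the
    first m of them fit in a set of measure o(m), then m mu(W) = o(m). *)
Lemma wandering_null d (X : measurableType d) (mu : {measure set X -> \bar R})
    (F : X -> X) (W : set X) (Y : nat -> set X) (K k : R) :
  measure_preserving mu F -> measurable W ->
  (forall n x, W x -> ~ W (iter n.+1 F x)) ->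
  (0 <= K)%R -> (0 <= k)%R -> (k < 1)%R ->
  (forall m, measurable (Y m)) ->
  (forall m, mu (Y m) <= (K * (1 + m%:R) `^ k)%:E) ->
  (forall n m x, (n <= m)%N -> W (iter n F x) -> Y m x) ->
  mu W = 0.
Proof.
move=> pF mW wander K0 k0 k1 mY hY hWY.
have pn n := measure_preserving_iter n pF.
pose P n := iter n F @^-1` W.
have mP n : measurable (P n) by apply: measurable_preimage => //; exact: (pn n).1.
have muP n : mu (P n) = mu W by exact: (pn n).2.
have fin : mu W \is a fin_num.
  rewrite ge0_fin_numE ?measure_ge0//.
  apply: le_lt_trans (ltry (K * (1 + 0%:R) `^ k)); apply: le_trans (hY 0%N).
  by apply: le_measure; rewrite ?inE// => x Wx; exact: (hWY 0%N 0%N).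
have tP : trivIset setT P.
  apply/trivIsetP => i j _ _; wlog ij : i j / (i < j)%N.
    move=> hw; rewrite neq_ltn => /orP[ij|ij].
      by apply: hw => //; rewrite ltn_eqF.
    by rewrite setIC; apply: hw => //; rewrite ltn_eqF.
  move=> _; apply/seteqP; split=> x //= [Wi Wj].
  apply: (wander (j - i.+1)%N _ Wi).
  by rewrite subnSK// -iterD subnK// ltnW.
rewrite -(fineK fin); congr (_%:E).
apply: (@sublinear_eq0 _ K k) => // m.
rewrite -lee_fin; apply: le_trans (hY m).
have -> : (m%:R * fine (mu W))%:E = mu (\big[setU/set0]_(i < m) P i).
  rewrite measure_bigsetU//.
  rewrite (eq_bigr (fun _ => (fine (mu W))%:E)); last first.
    by move=> i _; rewrite fineK//; exact: muP.
  by rewrite sumEFin sumr_const card_ord mulr_natl.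
apply: le_measure; rewrite ?inE//.
  by apply: bigsetU_measurable => i _; exact: mP.
move=> x; rewrite -bigcup_mkord => -[i /= im].
by apply: hWY; exact: ltnW.
Qed.

End wandering_sets.

Section torus_dynamics.
Context {R : realType} {N : nat}.
Variable alpha : R.
Hypothesis alpha3 : 3 <= alpha.
Variables (omega : 'rV[R]_N) (p : 'rV[R]_N -> R).
Hypothesis hp : Ck_torus 4 p.
Variable L : R.
Hypothesis tameL : forall Theta, tame (Ck_norm 4 p) L (forcing p omega Theta).

Local Notation T := (measurableTypeR R).
Local Notation leb := (@lebesgue_measure R).
Local Notation leb2 := (@lebesgue2 R).
Local Notation X := (N.-tuple T * (T * T))%type.
Local Notation mu := ((haar_torus N) \x leb2)%E.
Local Notation f theta := (forcing p omega (row_of_tuple theta)).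

(** The phase moves by omega in unit time, which makes the equation autonomous on the
    product of the torus and the plane. *)
Definition torus_step (x : X) : X :=
  (rotate (fun i => omega 0 i) x.1, dflow alpha (f x.1) 0 x.2 1).

Lemma row_rotate (theta : N.-tuple T) : exists k : 'I_N -> int,
  row_of_tuple (rotate (fun i => omega 0 i) theta) =
  row_of_tuple theta + omega + \row_i (k i)%:~R.
Proof.
exists (fun i => - Num.floor (tnth theta i + omega 0 i)); apply/rowP => i.
by rewrite !mxE tnth_mktuple /frac mulrNz.
Qed.

Lemma forcing_rotate theta t :
  f (rotate (fun i => omega 0 i) theta) t = f theta (t + 1).
Proof.
have [k ->] := row_rotate theta; rewrite (forcing_periodic omega hp).
by rewrite -[omega in LHS]scale1r -forcing_shift scale1r.
Qed.

Lemma dsol_shift (g h : R -> R) x v (c : R) : (forall t, h t = g (t + c)) ->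
  dsol alpha g x v -> dsol alpha h (fun t => x (t + c)) (fun t => v (t + c)).
Proof.
move=> hg xv t; have [dx dv] := xv (t + c); rewrite hg; split; exact: der_shift.
Qed.

Lemma iter_torus_step (theta : N.-tuple T) (z : T * T) n :
  (forall t, f (iter n torus_step (theta, z)).1 t = f theta (t + n%:R)) /\
  (iter n torus_step (theta, z)).2 = dflow alpha (f theta) 0 z n%:R.
Proof.
have [x [v [xv zE E]]] := dflow_sol alpha3 0 z (tameL (row_of_tuple theta)).
elim: n => [|n [IH1 IH2]].
  by split=> [t|]; [rewrite addr0|rewrite E -zE].
rewrite iterS; set y := iter n _ _ in IH1 IH2 *; split=> [t|].
  by rewrite /torus_step /= forcing_rotate IH1 -addrA [1 + _]addrC natr1.
rewrite /torus_step [LHS]/= IH2 !E.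
have sol := dsol_shift IH1 xv.
have := dflowE alpha3 0 1 (tameL (row_of_tuple y.1)) sol.
by rewrite add0r addrC natr1.
Qed.

Lemma torus_step_preserving : measure_preserving mu torus_step.
Proof.
have H := @skew_product_preserving R _ _ (N.-tuple T) (T * T)%type (haar_torus N) leb2
  (rotate (fun i => omega 0 i)) (fun theta z => dflow alpha (f theta) 0 z 1).
apply: H.
- exact: rotate_preserving.
- have mF (q : X -> R) : measurable_fun setT q ->
      measurable_fun setT (fun x : X => f x.1 (q x)).
    move=> mq; rewrite /forcing.
    apply: (@eq_measurable_fun _ _ _ _ setT
      (fun x : X => p (\row_i (tnth x.1 i + q x * omega 0 i)))) => [x _|].
      by congr p; apply/rowP => i; rewrite !mxE.
    apply: measurable_continuous_row => [|i]; first exact: Ck_continuous hp.1.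
    apply: measurable_funD.
      exact: (measurableT_comp (measurable_tnth i) measurable_fst).
    by apply: measurable_funM => //; exact: measurable_cst.
  have [m1 m2] := @measurable_dflow R alpha alpha3 (Ck_norm 4 p) L _ X
    (fun x => f x.1) (fun=> 0) (fun=> 1) (fun x => x.2)
    (fun x => tameL (row_of_tuple x.1)) mF (measurable_cst _) (measurable_cst _)
    (measurableT_comp (@measurable_fst _ _ T T) measurable_snd)
    (measurableT_comp (@measurable_snd _ _ T T) measurable_snd).
  apply: measurable_fun_pair.
    exact: (measurableT_comp (measurable_rotate _) measurable_fst).
  by apply/measurable_fun_pairP; split.
- by move=> theta B mB; exact: (dflow_preserving alpha3 0 1 (tameL (row_of_tuple theta))).2.
Qed.

Definition box (r : R) : set X := [set x | in_box r x.2].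

(** A trajectory that leaves every box is in each box that it meets for a last time;
    the states of these last visits form wandering sets. *)
Definition last_visit (r : R) : set X :=
  box r `&` \bigcap_n ~` (iter n.+1 torus_step @^-1` box r).

Lemma measurable_in_box (r : R) : measurable ([set z | in_box r z] : set (T * T)).
Proof.
rewrite (_ : [set z | _] = `[- r, r]%classic `*` `[- r, r]%classic).
  by apply: measurableX; exact: measurable_itv.
by apply/seteqP; split=> -[a b]; rewrite /in_box/= !in_itv/= !ler_norml.
Qed.

Lemma measurable_box r : measurable (box r).
Proof.
exact: (measurable_preimage (@measurable_snd _ _ _ (T * T)%type) (measurable_in_box r)).
Qed.

Lemma measurable_last_visit r : measurable (last_visit r).
Proof.
apply: measurableI; first exact: measurable_box.
apply: bigcapT_measurable => n; apply: measurableC; apply: measurable_preimage.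
  exact: (measure_preserving_iter n.+1 torus_step_preserving).1.
exact: measurable_box.
Qed.

(** States that are in the box of size r after n <= m steps fill, by slow growth, at
    most a rectangle of area of order m ^ (a + b) over the torus. *)
Lemma last_visit_null r : mu (last_visit r) = 0%E.
Proof.
have [a [b [a0 b0 ab H]]] := growth alpha3.
have [P1 [P2 hP]] := forcing_bounds omega hp.
have [C C0 HC] := H (Ck_norm 4 p) P1 P2 r.
have hC (theta : N.-tuple T) (z : T * T) n : in_box r (dflow alpha (f theta) 0 z n%:R) ->
    `|z.1 : R| <= C * (1 + n%:R) `^ a /\ `|z.2 : R| <= C * (1 + n%:R) `^ b.
  have [x [v [xv zE E]]] := dflow_sol alpha3 0 z (tameL (row_of_tuple theta)).
  rewrite E => bx.
  have [|||||h1 h2] := HC (f theta) (forcing_d1 p omega (row_of_tuple theta))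
      (forcing_d2 p omega (row_of_tuple theta)) x v n _ _ _ _ _ xv bx.
  - exact: (tameL _).1.
  - by move=> t; have [] := hP (row_of_tuple theta) t.
  - by move=> t; have [] := hP (row_of_tuple theta) t.
  - by move=> t; exact: der_forcing.
  - by move=> t; exact: der_forcing_d1.
  by rewrite zE.
(* C + 1 instead of C: the rectangles are half-open and need positive sides *)
pose A m := (C + 1) * (1 + m%:R) `^ a; pose B m := (C + 1) * (1 + m%:R) `^ b.
have m1 m : 1 <= 1 + m%:R :> R by rewrite lerDl.
have A0 m : 0 < A m by rewrite mulr_gt0 ?powR_gt0//; lra.
have B0 m : 0 < B m by rewrite mulr_gt0 ?powR_gt0//; lra.
pose Q m := rectangle (- A m) (A m) (- B m) (B m).
pose Y m : set X := [set: N.-tuple T] `*` Q m.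
have mY m : measurable (Y m) by apply: measurableX => //; exact: measurable_rectangle.
have ab0 : 0 <= a + b by rewrite addr_ge0.
have K0 : 0 <= 4 * (C + 1) ^+ 2 by rewrite mulr_ge0// sqr_ge0.
apply: (wandering_null torus_step_preserving (measurable_last_visit r) _ K0 ab0 ab mY).
- by move=> n x [_ h] [bx _]; exact: (h n I bx).
- move=> m; have hA := A0 m; have hB := B0 m.
  have e : mu (Y m) = (haar_torus N setT * leb2 (Q m))%E.
    exact: (product_measure1E (haar_torus N) leb2 measurableT (measurable_rectangle _ _ _ _)).
  suff : (mu (Y m) <= (4 * (C + 1) ^+ 2 * (1 + m%:R) `^ (a + b))%:E)%E by [].
  rewrite e.
  rewrite probability_setT mul1e.
  have -> : leb2 (Q m) = ((A m - - A m) * (B m - - B m))%:E.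
    by apply: lebesgue2_rectangle; lra.
  rewrite lee_fin powRD; last by apply/implyP => _; rewrite gt_eqF// (lt_le_trans ltr01 (m1 m)).
  by rewrite /A /B le_eqVlt; apply/orP; left; apply/eqP; ring.
- move=> n m [theta z] nm [+ _]; rewrite /box/= (iter_torus_step theta z n).2 => /hC[h1 h2].
  split=> //; apply/rectangleP.
  have nmR : 1 + n%:R <= 1 + m%:R :> R by rewrite lerD2l ler_nat.
  have pa : (1 + n%:R) `^ a <= (1 + m%:R) `^ a.
    by apply: ge0_ler_powR; rewrite ?nnegrE// (le_trans ler01)//.
  have pb : (1 + n%:R) `^ b <= (1 + m%:R) `^ b.
    by apply: ge0_ler_powR; rewrite ?nnegrE// (le_trans ler01)//.
  have qa : 0 < (1 + m%:R) `^ a :> R by rewrite powR_gt0// (lt_le_trans ltr01 (m1 m)).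
  have qb : 0 < (1 + m%:R) `^ b :> R by rewrite powR_gt0// (lt_le_trans ltr01 (m1 m)).
  have hA : C * (1 + n%:R) `^ a < A m.
    by rewrite /A mulrDl mul1r; apply: le_lt_trans (_ : C * (1 + m%:R) `^ a < _);
      [rewrite ler_wpM2l|rewrite ltrDl].
  have hB : C * (1 + n%:R) `^ b < B m.
    by rewrite /B mulrDl mul1r; apply: le_lt_trans (_ : C * (1 + m%:R) `^ b < _);
      [rewrite ler_wpM2l|rewrite ltrDl].
  by move: h1 h2; rewrite !ler_norml => /andP[? ?] /andP[? ?]; split; apply/andP; split; lra.
Qed.

Definition escaping_states : set X :=
  \bigcup_r \bigcup_n (iter n torus_step @^-1` last_visit r%:R).

Lemma measurable_escaping_states : measurable escaping_states.
Proof.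
apply: bigcupT_measurable => r; apply: bigcupT_measurable => n.
apply: measurable_preimage; last exact: measurable_last_visit.
exact: (measure_preserving_iter n torus_step_preserving).1.
Qed.

Lemma escaping_states_null : mu escaping_states = 0%E.
Proof.
apply: measure_negligible; first exact: measurable_escaping_states.
apply: negligible_bigcup => r; apply: negligible_bigcup => n.
apply/negligibleP.
  apply: measurable_preimage; last exact: measurable_last_visit.
  exact: (measure_preserving_iter n torus_step_preserving).1.
transitivity (mu (last_visit r%:R)); last exact: last_visit_null.
by apply: (measure_preserving_iter n torus_step_preserving).2; exact: measurable_last_visit.
Qed.

Lemma escaping_in_states (theta : N.-tuple T) (z : T * T) :
  (forall r, exists M, forall t, M <= t -> ~ in_box r (dflow alpha (f theta) 0 z t)) ->
  escaping_states (theta, z).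
Proof.
move=> H.
have stateE n := (iter_torus_step theta z n).2.
pose r := (Num.truncn (`|z.1 : R| + `|z.2 : R|)).+1.
have zr : in_box r%:R z.
  have : `|z.1 : R| + `|z.2 : R| < r%:R by exact: truncnS_gt.
  by have := normr_ge0 (z.1 : R); have := normr_ge0 (z.2 : R); split; lra.
have [M hM] := H r%:R.
pose P n := `[< in_box r%:R (iter n torus_step (theta, z)).2 >].
have exP : exists n, P n by exists 0%N; exact/asboolP.
have ubP n : P n -> (n <= Num.truncn `|M|)%N.
  move=> /asboolP; rewrite stateE => h; rewrite leqNgt; apply/negP => nM.
  apply: (hM n%:R) h; apply: le_trans (ler_norm _) _; apply/ltW.
  by apply: lt_le_trans (truncnS_gt _) _; rewrite ler_nat.
have [n /asboolP Pn maxn] := ex_maxnP exP ubP.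
exists r => //; exists n => //; split; first exact: Pn.
move=> k _ /= h; have := maxn (k.+1 + n)%N.
rewrite /P iterD; rewrite leqNgt ltnS leq_addl => hh.
by have : false by apply: hh; exact/asboolP.
Qed.

Theorem almost_all_phases : {ae haar_torus N, forall theta,
  exists N1 : set (T * T), [/\ measurable N1, leb2 N1 = 0%E &
    forall z : T * T,
    (forall r, exists M, forall t, M <= t -> ~ in_box r (dflow alpha (f theta) 0 z t)) ->
    N1 z]}.
Proof.
have mE := measurable_escaping_states.
have /(null_sections (haar_torus N) leb2 mE) := escaping_states_null.
apply: filterS => theta h; exists (xsection escaping_states theta); split.
- exact: measurable_xsection.
- exact: h.
- by move=> z hz; rewrite /xsection/= inE; exact: escaping_in_states.
Qed.

End torus_dynamics.

(** * From states at a fixed time to the successive zeros *)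

Section transversal.
Context {R : realType}.
Variable alpha : R.
Hypothesis alpha3 : 3 <= alpha.
Variables P L : R.
Implicit Types (f x v y w : R -> R) (s t e r : R).

(** Where a solution decreases, its position can serve as independent variable. Time t
    and kinetic energy e = v ^ 2 / 2 then satisfy dt/dx = - 1 / sqrt (2 e) and
    de/dx = f t - force x, again a separable system. The maximum here and the clipping
    in work_rate make its fields bounded and Lipschitz without changing them where
    1 <= e and 0 <= x <= 1. *)
Definition clock_rate e := - (Num.sqrt (2 * Num.max e 1))^-1.

Definition work_rate f s t := f t - force alpha (clip 1 s).

Lemma bounded_lipschitzW (L1 M1 L2 M2 : R) (a : R -> R -> R) : L1 <= L2 -> M1 <= M2 ->
  bounded_lipschitz L1 M1 a -> bounded_lipschitz L2 M2 a.
Proof.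
move=> LL MM [aM aL]; split=> [s z|s s' z z']; first exact: le_trans (aM s z) MM.
by apply: le_trans (aL s s' z z') _; rewrite ler_wpM2r// addr_ge0.
Qed.

Lemma clock_rate_lipschitz : bounded_lipschitz 1 1 (fun _ : R => clock_rate).
Proof.
have m1 e : 1 <= Num.max e 1 by rewrite le_max lexx orbT.
have s1 e : 1 <= Num.sqrt (2 * Num.max e 1).
  by rewrite -[leLHS]sqrtr1 ler_sqrt; have := m1 e; lra.
have sE e : Num.sqrt (2 * Num.max e 1) ^+ 2 = 2 * Num.max e 1.
  by rewrite sqr_sqrtr//; have := m1 e; lra.
have maxL e e' : `|Num.max e 1 - Num.max e' 1| <= `|e - e'|.
  have := ler_norm (e - e'); have := ler_norm (- (e - e')); rewrite normrN.
  by rewrite ler_norml; have [] := leP e 1; have [] := leP e' 1; lra.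
split=> [_ e|s s' e e']; rewrite /clock_rate.
  rewrite normrN ger0_norm ?invr_ge0 ?sqrtr_ge0// invf_le1//.
  exact: lt_le_trans ltr01 (s1 e).
rewrite mul1r; apply: le_trans (_ : `|e - e'| <= _); last by rewrite lerDr.
apply: le_trans (maxL e e'); move: (s1 e) (s1 e') (sE e) (sE e').
set p := Num.sqrt _; set q := Num.sqrt _; set m := Num.max e 1; set m' := Num.max e' 1.
move=> p1 q1 pE qE; move: p q m m' p1 q1 pE qE => p q m m' p1 q1 pE qE.
have -> : - p^-1 - - q^-1 = (p - q) / (p * q) by field; apply/andP; split; apply: negbT; rewrite gt_eqF//; lra.
have -> : m - m' = (p - q) * ((p + q) / 2) by nra.
have pq : 1 <= p * q by nra.
rewrite normrM [leRHS]normrM ler_wpM2l// !ger0_norm; first last.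
- by rewrite invr_ge0; lra.
- by lra.
by apply: le_trans (_ : 1 <= _); [rewrite invf_le1; lra|lra].
Qed.

Lemma work_rate_lipschitz f : tame P L f ->
  bounded_lipschitz (clip_lip alpha L 1) (clip_bound alpha P 1) (work_rate f).
Proof.
move=> tf; have [bM bL] := clipped_force_lipschitz alpha3 tf ler01.
split=> [s t|s s' t t']; first exact: bM.
by rewrite [`|s - s'| + _]addrC; exact: bL.
Qed.

(** The energy e loses at most P + 1 on [0, 1], so it remains at least 1. Then the state of
    the solution at time tt x, and the pair (x, - sqrt (2 e x)), are two curves in the
    variable x with the same equations and the same initial value. *)
Lemma crossing_state f y w (tt e : R -> R) (x1 : R) : tame P L f -> dsol alpha f y w ->
  y (tt 0) = 0 -> w (tt 0) < velocity_bound P -> e 0 = w (tt 0) ^+ 2 / 2 ->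
  solves (fun _ : R => clock_rate) (work_rate f) tt e ->
  0 <= x1 <= 1 ->
  [/\ 1 <= e x1, y (tt x1) = x1 & w (tt x1) = - Num.sqrt (2 * e x1)].
Proof.
move=> tf yw y0 w0 e0 te /andP[x0 x1'].
have P0 := tame_bound_ge0 tf.
have [wneg _ wP] := below_velocity_bound P0 w0.
have force1 s : `|s| <= 1 -> `|force alpha s| <= 1.
  move: (alpha3) => a3 s1; rewrite norm_force//.
  apply: le_trans (_ : 1 `^ alpha <= _); last by rewrite powR1.
  apply: ge0_ler_powR; rewrite ?nnegrE//; lra.
have e1 s : 0 <= s <= 1 -> 1 <= e s.
  move=> /andP[s0 s1].
  have : `|e s - e 0| <= (P + 1) * s - (P + 1) * 0.
    apply: (@der_norm_le_diff _ e (fun r => work_rate f r (tt r))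
      (fun r => (P + 1) * r) (fun=> (P + 1) * 1) _ _ s0
      (fun r _ => (te r).2) (fun r _ => derZ _ (der_id r))) => r _.
    rewrite mulr1 /work_rate; apply: le_trans (ler_normB _ _) _.
    by apply: lerD; [exact: tf.1|apply: force1; exact: clip_norm].
  by rewrite ler_norml => /andP[+ _]; rewrite e0; nra.
pose rt s := Num.sqrt (2 * e s).
have rt1 s : 0 <= s <= 1 -> 1 <= rt s.
  by move=> /e1 es; rewrite -[leLHS]sqrtr1 ler_sqrt; lra.
have clockE s : 0 <= s <= 1 -> clock_rate (e s) = - (rt s)^-1.
  by move=> /e1 es; rewrite /clock_rate max_l.
pose C := 1 + alpha * (1 + reach alpha P 1 (- w (tt 0))) `^ (alpha - 1).
have tt1 s : 0 <= s <= 1 -> `|tt s - tt 0| <= 1.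
  move=> /andP[s0 s1]; apply: le_trans (_ : 1 * s - 1 * 0 <= _); last lra.
  apply: (@der_norm_le_diff _ tt (fun r => clock_rate (e r))
    (fun r => 1 * r) (fun=> 1 * 1) _ _ s0
    (fun r _ => (te r).1) (fun r _ => derZ _ (der_id r))) => r _.
  by rewrite mulr1; exact: (clock_rate_lipschitz).1 0 _.
have b0 : in_box (- w (tt 0)) (y (tt 0), w (tt 0)).
  by rewrite /in_box/= y0 normr0 ltr0_norm//; split=> //; lra.
have K0 : 0 <= reach alpha P 1 (- w (tt 0)).
  have t01 : `|tt 0 - tt 0| <= 1 by rewrite subrr normr0.
  by have [/= + _] := dsol_reach alpha3 tf yw b0 t01; exact: le_trans.
have yK s : 0 <= s <= 1 -> `|y (tt s)| <= 1 + reach alpha P 1 (- w (tt 0)).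
  move=> s01.
  by have [/= + _] := dsol_reach alpha3 tf yw b0 (tt1 s s01); lra.
have rt0 : rt 0 = - w (tt 0).
  by rewrite /rt e0 mulrC divfK ?pnatr_eq0// sqrtr_sqr ltr0_norm.
have c0 : 0 <= alpha * (1 + reach alpha P 1 (- w (tt 0))) `^ (alpha - 1).
  by move: (alpha3) => a3; rewrite mulr_ge0 ?powR_ge0//; lra.
have C1 : 1 <= C by rewrite /C lerDl.
have mm s : Num.min 0 x1 <= s <= Num.max 0 x1 -> 0 <= s <= 1.
  by rewrite min_l// max_r// => /andP[-> /le_trans]; exact.
have D : (y (tt x1) - x1) ^+ 2 + (w (tt x1) - - rt x1) ^+ 2 <=
    ((y (tt 0) - 0) ^+ 2 + (w (tt 0) - - rt 0) ^+ 2) * expR (2 * C * `|x1 - 0|).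
  apply: (@lipschitz_dependence R (fun s => y (tt s)) (fun s => w (tt s)) (fun s => s)
    (fun s => - rt s)
    (fun s => w (tt s) * clock_rate (e s))
    (fun s => (f (tt s) - force alpha (y (tt s))) * clock_rate (e s))
    (fun=> 1) (fun s => - ((2 * rt s)^-1 * (2 * work_rate f s (tt s))))).
  - by lra.
  - move=> r /mm r01; have [dt _] := te r; have [dy dw] := yw (tt r).
    split; first exact: der_comp dt dy.
    exact: (der_comp dt dw).
  - move=> r /mm r01; split; first exact: der_id.
    have pos : 0 < 2 * e r by have := e1 r r01; lra.
    exact: derN (der_comp (derZ 2 (te r).2) (is_derive1_sqrt pos)).
  move=> r /mm r01; rewrite (clockE _ r01).
  have r1 := rt1 r r01; have rn0 : rt r != 0 by rewrite gt_eqF//; lra.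
  have inv1 : `|(rt r)^-1| <= 1 by rewrite ger0_norm ?invr_ge0 ?invf_le1//; lra.
  split.
    have -> : w (tt r) * - (rt r)^-1 - 1 = - ((rt r)^-1 * (w (tt r) - - rt r)) by field.
    rewrite normrN normrM; apply: ler_pM => //; lra.
  have /andP[r0 r1'] := r01.
  have -> : (f (tt r) - force alpha (y (tt r))) * - (rt r)^-1 -
      - ((2 * rt r)^-1 * (2 * work_rate f r (tt r))) =
      (rt r)^-1 * (force alpha (y (tt r)) - force alpha r).
    rewrite /work_rate clip_id; last by rewrite ger0_norm.
    by field.
  rewrite normrM; apply: le_trans (_ : 1 * `|force alpha (y (tt r)) - force alpha r| <= _).
    by rewrite ler_wpM2r.
  rewrite mul1r; apply: le_trans (force_lipschitz alpha3 (yK r r01) _) _.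
    by rewrite ger0_norm//; lra.
  by rewrite ler_wpM2r// /C lerDr.
have {}D : (y (tt x1) - x1) ^+ 2 + (w (tt x1) - - rt x1) ^+ 2 <= 0.
  apply: le_trans D _; rewrite y0 rt0.
  by rewrite opprK !subrr expr0n/= addr0 mul0r.
have := sqr_ge0 (y (tt x1) - x1); have := sqr_ge0 (w (tt x1) - - rt x1) => h1 h2.
split; first by apply: e1; rewrite x0.
  by apply/eqP; rewrite -subr_eq0 -(sqrf_eq0 (_ - _)); apply/eqP; lra.
by apply/eqP; rewrite -subr_eq0 -(sqrf_eq0 (_ - _)); apply/eqP; rewrite -/(rt x1); lra.
Qed.

Local Notation T := (measurableTypeR R).
Local Notation leb := (@lebesgue_measure R).
Local Notation leb2 := (@lebesgue2 R).

Lemma sweep_exists f (x1 : R) : tame P L f -> exists S : R * R -> R * R,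
  measure_preserving leb2 (S : T * T -> T * T) /\
  forall z : R * R, exists tt (e : R -> R), [/\ solves (fun _ : R => clock_rate) (work_rate f) tt e,
    z = (tt 0, e 0) & S z = (tt x1, e x1)].
Proof.
move=> tf.
have L0 := clip_lip_gt0 alpha3 1 (tame_lipschitz_ge0 tf).
pose L' := 1 + clip_lip alpha L 1; pose M' := Num.max 1 (clip_bound alpha P 1).
have L'0 : 0 < L' by rewrite /L'; lra.
have ba : bounded_lipschitz L' M' (fun _ : R => clock_rate).
  by apply: bounded_lipschitzW clock_rate_lipschitz; rewrite ?le_max ?lexx// /L'; lra.
have bb : bounded_lipschitz L' M' (work_rate f).
  by apply: bounded_lipschitzW (work_rate_lipschitz tf); rewrite ?le_max ?lexx ?orbT// /L'; lra.
have /choice[S hS] (z : R * R) : exists u : R * R, exists tt (e : R -> R),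
    [/\ solves (fun _ : R => clock_rate) (work_rate f) tt e,
    z = (tt 0, e 0) & u = (tt x1, e x1)].
  have [tt [e [te t0 e0]]] := picard_existence 0 z.1 z.2 L'0 ba bb.
  by exists (tt x1, e x1), tt, e; split=> //; rewrite t0 e0; case: z {t0 e0}.
exists S; split=> //; exact: (flow_preserving (ltW L'0) ba bb hS).
Qed.

(** In the space of (t, x, v) the states that lie in N1 when carried to time 0 form a
    null set, but the section x = 0 where the initial conditions live need not
    inherit this. By Fubini some section x = x1, with 0 < x1 < 1, is null. The flow in
    the variable x preserves the area dt de and carries the section at x1 back to the
    section at 0; the changes of variable between v and e preserve null sets. *)
Lemma escaping_initial_null f (N1 : set (T * T)) : tame P L f ->
  measurable N1 -> leb2 N1 = 0%E ->
  (forall z : R * R,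
    (forall r, exists M, forall t, M <= t -> ~ in_box r (dflow alpha f 0 z t)) -> N1 z) ->
  negligible leb2 (escaping_set alpha f (velocity_bound P)).
Proof.
move=> tf mN N0 hN.
pose C := [set q : T * (T * T) | N1 (dflow alpha f q.1 q.2 0)].
have mC : measurable C.
  have [m1 m2] := @measurable_dflow R alpha alpha3 P L _ (T * (T * T))%type
    (fun=> f) (fun q => q.1) (fun=> 0) (fun q => q.2) (fun=> tf)
    (fun q mq => measurableT_comp (continuous_measurable (lipschitz_continuous_R tf.2)) mq)
    measurable_fst (measurable_cst _)
    (measurableT_comp (@measurable_fst _ _ T T) measurable_snd)
    (measurableT_comp (@measurable_snd _ _ T T) measurable_snd).
  apply: (measurable_preimage
    (F := fun q : T * (T * T) => (dflow alpha f q.1 q.2 0 : T * T))) mN.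
  by apply/measurable_fun_pairP; split.
have C0 t : leb2 (xsection C t) = 0%E.
  rewrite -[RHS]N0 -[RHS](dflow_preserving alpha3 t 0 tf).2//.
  by congr (leb2 _); apply/seteqP; split=> z; rewrite /xsection/= inE.
have [x1 [/andP[x1p x11] D0]] := ae_exists_unit (almost_every_slice mC C0).
have [S [S_mp hS]] := sweep_exists x1 tf.
pose D := [set z : T * T | C (z.1, (x1, z.2))].
have mD : measurable D.
  apply: (measurable_preimage (F := fun z : T * T => (z.1, (x1 : T, z.2)))) => //.
  by apply: measurable_fun_pair => //; exact: measurable_fun_pair.
pose phi (e : R) := - Num.sqrt (2 * e).
have mphi : measurable_fun (setT : set T) (phi : T -> T).
  apply: continuous_measurable => e; apply: cvgN.
  apply: continuous_comp; first by apply: cvgM; [exact: cvg_cst|exact: cvg_id].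
  exact: sqrt_continuous.
pose A n := [set z : T * T | `[1, n.+1%:R]%classic (z.2 : R) /\ D (z.1, phi z.2)].
have hA n : measurable (A n) /\ leb2 (A n) = 0%E.
  (* on [1, n + 1] the derivative - 1 / sqrt (2 e) of phi has size at least 1 / k *)
  pose k := Num.sqrt (2 * n.+1%:R) : R.
  have k0 : 0 < k by rewrite sqrtr_gt0 mulr_gt0.
  have k0' : 0 < k^-1 by rewrite invr_gt0.
  apply: (expanding_plane_null k0' _ mphi _ mD D0); first exact: measurable_itv.
  move=> a b; rewrite /= !in_itv/= => /andP[a1 an] /andP[b1 bn].
  have -> : phi a - phi b = - (Num.sqrt (2 * a) - Num.sqrt (2 * b)) by rewrite /phi; ring.
  rewrite normrN ler_pdivrMl//.
  have sa : Num.sqrt (2 * a) <= k by rewrite ler_sqrt; lra.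
  have sb : Num.sqrt (2 * b) <= k by rewrite ler_sqrt; lra.
  have pE : Num.sqrt (2 * a) ^+ 2 = 2 * a by rewrite sqr_sqrtr//; lra.
  have qE : Num.sqrt (2 * b) ^+ 2 = 2 * b by rewrite sqr_sqrtr//; lra.
  move: (sqrtr_ge0 (2 * a)) (sqrtr_ge0 (2 * b)) sa sb pE qE.
  set p := Num.sqrt (2 * a); set q := Num.sqrt (2 * b) => p0 q0 pk qk pE qE.
  have -> : a - b = (p - q) * ((p + q) / 2) by nra.
  rewrite normrM mulrC ler_wpM2r// ger0_norm; lra.
pose B n := [set z : T * T | `]-oo, (velocity_bound P)[%classic (z.2 : R) /\
  A n (S (z.1, z.2 ^+ 2 / 2))].
have hB n : measurable (B n) /\ leb2 (B n) = 0%E.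
  have [mA A0] := hA n.
  have mSA : measurable ((S : T * T -> T * T) @^-1` A n).
    exact: measurable_preimage S_mp.1 mA.
  have SA0 : leb2 ((S : T * T -> T * T) @^-1` A n) = 0%E by rewrite -A0; exact: S_mp.2.
  (* both velocities are below - 4, where v ^ 2 / 2 has slope at most - 1 *)
  have [|||mB B0] := @expanding_plane_null R (fun v : R => v ^+ 2 / 2)
    `]-oo, (velocity_bound P)[%classic _ 1 ltr01 _ _ _ mSA SA0; last by split.
  - exact: measurable_itv.
  - apply: continuous_measurable => v; apply: cvgM; last exact: cvg_cst.
    exact: exprn_continuous.
  - move=> a b; rewrite /= !in_itv/= => av bv.
    have P0 := tame_bound_ge0 tf; have := energy_threshold_ge0 P.
    rewrite /velocity_bound in av bv => h0.
    have -> : a ^+ 2 / 2 - b ^+ 2 / 2 = (b - a) * (- (a + b) / 2) by field.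
    rewrite normrM mul1r distrC ler_peMr// ger0_norm; lra.
pose E n := [set z : T * T | B n (z.2, z.1)].
have hE n : measurable (E n) /\ leb2 (E n) = 0%E by case: (hB n) => *; exact: swap_null.
apply: (negligibleS (_ : _ `<=` \bigcup_n E n)); last first.
  apply: negligible_bigcup => n; apply/negligibleP; [exact: (hE n).1|exact: (hE n).2].
move=> [v0 t0] esc; have [v0s _ _] := esc; rewrite /= in v0s.
have [y [w [yw y0 w0]]] := dsol_exists alpha3 t0 0 v0 tf.
have [tt [e [te te0 Se]]] := hS (t0, v0 ^+ 2 / 2).
case: te0 => tt0 e0.
have [||||e1 yx wx] := @crossing_state f y w tt e x1 tf yw _ _ _ te _.
- by rewrite -tt0.
- by rewrite -tt0 w0.
- by rewrite -tt0 w0 -e0.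
- by rewrite !ltW.
exists (Num.truncn (e x1)) => //; split=> /=; first by rewrite in_itv.
rewrite Se; split=> /=; first by rewrite in_itv/= e1 ltW// truncnS_gt.
have h := dflowE alpha3 (tt x1) 0 tf yw; rewrite yx wx in h.
rewrite /phi /D /C/= h; apply: hN => r.
have [M hM] := escaping_leaves_boxes alpha3 tf esc r.
exists M => t /hM; rewrite /= -y0 -w0 !(dflowE alpha3 _ _ tf yw).
by [].
Qed.

End transversal.

Theorem theorem1p1 (R : realType) (alpha : R) (halpha : 3 <= alpha)
    (N : nat) (hN : (1 <= N)%N) (omega : 'rV[R]_N)
    (homega_pos : forall i, 0 < omega 0 i)
    (homega_indep : rationally_independent omega) :
  exists vstar : R -> R, forall p : 'rV[R]_N -> R, Ck_torus 4 p ->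
    let v := vstar (Ck_norm 4 p) in
    [/\ v < 0,
        forall Theta : 'rV[R]_N,
          successor_well_defined alpha (forcing p omega Theta) (left_of v) &
        {ae haar_torus N, forall theta,
          negligible lebesgue2
            (escaping_set alpha (forcing p omega (row_of_tuple theta)) v)}].
Proof.
exists (@velocity_bound R) => p hp v; have [L tf] := forcing_tame omega hp.
have P0 : 0 <= Ck_norm 4 p := tame_bound_ge0 (tf 0).
split.
- rewrite /v /velocity_bound oppr_lt0.
  by have := energy_threshold_ge0 (Ck_norm 4 p); lra.
- by move=> Theta; exact: (successor_map_well_defined halpha (tf Theta)).
- apply: filterS (almost_all_phases halpha hp tf) => theta [N1 [mN N0 H]].
  exact: (escaping_initial_null halpha (tf _) mN N0 H).
Qed.
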